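(* Let $M$ be the arithmetic matroid represented in $\mathbb{Z}^3$ by the columns of $$A=\begin{pmatrix}1&1&1&-3\\0&5&0&-5\\0&0&5&-5\end{pmatrix}.$$ Then the arithmetic independence posets of the central toric arrangements associated with the essential representations of $M$ (of which there are $13$ up to equivalence) are pairwise isomorphic. Their order complexes, with the bottom element removed, have reduced integral homology $0$, $\mathbb{Z}/5\mathbb{Z}$, $\mathbb{Z}^{73}$ in degrees $0,1,2$ respectively. Therefore these posets are not Cohen–Macaulay in characteristic $5$ and are not shellable.
   Context: For a finite list of vectors $(v_e)_{e\in E}$ in a finitely generated abelian group $G$, the associated arithmetic matroid is $(E,\mathrm{rk},m)$ with $\mathrm{rk}(X)=\mathrm{rk}(\langle v_e\rangle_{e\in X})$ and $m(X)=|\mathrm{Tor}(G/\langle v_e\rangle_{e\in X})|$ for $X\subseteq E$, where $\mathrm{Tor}$ is the torsion subgroup; $(G,(v_e)_{e\in E})$ is then called a representation of this arithmetic matroid. A representation is essential if $\mathrm{rk}(G)=\mathrm{rk}(E)$. Two representations $(G,(v_e))$, $(H,(w_e))$ are equivalent if there is a group isomorphism $\varphi\colon G\to H$ with $\varphi(\langle v_e\rangle)=\langle w_e\rangle$ for all $e\in E$. Here $E=\{1,2,3,4\}$ indexes the columns; since $m(\emptyset)=1$ every representation is in a free abelian group. A representation $(v_e)_{e\in E}$ in a lattice $G\cong\mathbb{Z}^r$ defines a central toric arrangement in the torus $T=\mathrm{Hom}(G,\mathbb{C}^* )\cong(\mathbb{C}^* )^r$, consisting of the hypertori $\{t\in T\mid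 t(v_e)=1\}$, $e\in E$. The arithmetic independence poset of a toric arrangement $\mathcal{A}$ is the set of pairs $(I,W)$, where $I\subseteq\mathcal{A}$ is an independent set (of the underlying matroid) and $W$ is a connected component of $\bigcap I$ (with $\bigcap\emptyset=T$), ordered by: $(I_1,W_1)\le(I_2,W_2)$ if and only if $I_1\subseteq I_2$ and $W_1\supseteq W_2$. Its bottom element is $(\emptyset,T)$. Cohen–Macaulayness and shellability of the poset refer to the order complex of the poset with its bottom element removed. *)

(* Defs.v *)
From HB Require Import structures.
From mathcomp Require Import all_boot all_order all_algebra.
From mathcomp Require Import generic_quotient ring_quotient complex finmap.
From mathcomp Require Import all_classical all_reals all_analysis.

Set Implicit Arguments.
Unset Strict Implicit.
Unset Printing Implicit Defensive.

Import numFieldNormedType.Exports.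
Import Order.TTheory GRing.Theory Num.Theory.

Local Open Scope classical_set_scope.
Local Open Scope ring_scope.

Section AbelianGroups.
Context (G : zmodType).

Definition zindep (n : nat) (x : 'I_n -> G) : Prop :=
  forall c : 'I_n -> int, \sum_i x i *~ c i = 0 -> forall i, c i = 0.

Definition has_zindep (H : set G) (n : nat) : Prop :=
  exists x : 'I_n -> G, (forall i, H (x i)) /\ zindep x.

(* The largest size of a linearly independent family in H; the default 0 is
   only reached when there are arbitrarily large independent families, hence
   not for a subgroup of a finitely generated group. *)
Definition zrank (H : set G) : nat :=
  xget 0%N [set n | has_zindep H n /\ forall k, has_zindep H k -> (k <= n)%N].

Definition torsion : set G := [set x | exists2 n : nat, (0 < n)%N & x *+ n = 0].

Section Span.
Context (E : finType) (v : E -> G) (X : {set E}).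

Definition zspan : {pred G} :=
  fun g => `[< exists c : E -> int, g = \sum_(e in X) v e *~ c e >].

Lemma zspan_zmod_closed : zmod_closed zspan.
Proof.
split; first by apply/asboolP; exists (fun=> 0); rewrite big1.
move=> _ _ /asboolP[c ->] /asboolP[d ->]; apply/asboolP.
exists (fun e => c e - d e); rewrite -sumrB.
by apply: eq_bigr => e _; rewrite mulrzBr.
Qed.

HB.instance Definition _ := GRing.isZmodClosed.Build G zspan zspan_zmod_closed.

Definition quot_zspan : zmodType := Quotient.quot zspan.

End Span.

Definition finitely_generated : Prop :=
  exists n (g : 'I_n -> G), forall x, x \in zspan g [set: 'I_n].

End AbelianGroups.

Definition zmod_isomorphic (A B : zmodType) : Prop :=
  exists f : {additive A -> B}, bijective f.

Record arith_matroid (E : finType) := ArithMatroid {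
  am_rk : {set E} -> nat;
  am_mult : {set E} -> nat
}.

(* The torsion subgroup of a finitely generated group is finite, so fset_set
   does not fall back on its default value in the cases of interest. *)
Definition arith_matroid_of (E : finType) (G : zmodType) (v : E -> G) :
    arith_matroid E :=
  ArithMatroid (fun X => zrank [set` zspan v X])
               (fun X => #|` fset_set (@torsion (quot_zspan v X))|).

Definition am_indep (E : finType) (M : arith_matroid E) (I : {set E}) : Prop :=
  am_rk M I = #|I|.

Record vector_config (E : finType) := VectorConfig {
  vc_group : zmodType;
  vc_vec : E -> vc_group;
  vc_fg : finitely_generated vc_group
}.

Definition represents (E : finType) (M : arith_matroid E)
    (r : vector_config E) : Prop :=
  arith_matroid_of (@vc_vec E r) = M.

Definition essential_representation (E : finType) (M : arith_matroid E)
    (r : vector_config E) : Prop :=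
  represents M r /\ zrank [set: vc_group r] = am_rk M [set: E].

Definition equivalent_representations (E : finType)
    (r s : vector_config E) : Prop :=
  exists f : {additive vc_group r -> vc_group s}, bijective f /\
    forall e, f @` [set` zspan (@vc_vec E r) [set e]%SET] =
              [set` zspan (@vc_vec E s) [set e]%SET].

Section ToricArrangement.
Context (R : realType) (E : finType) (G : zmodType) (v : E -> G).

(* Hom(G, C^* ) carries the topology of pointwise convergence, which for
   G = Z^r is that of (C^* )^r.  The library puts the norm topology on R[i]^o
   rather than on R[i]. *)
Definition torus : set {ptws G -> R[i]^o} :=
  [set t | (forall g, t g != 0) /\ (forall g h, t (g + h) = t g * t h)].

Definition hypertorus (e : E) : set {ptws G -> R[i]^o} :=
  [set t | torus t /\ t (v e) = 1].

Definition hypertori_cap (I : {set E}) : set {ptws G -> R[i]^o} :=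
  torus `&` \bigcap_(e in [set` I]) hypertorus e.

Definition ai_pred (p : {set E} * set {ptws G -> R[i]^o}) : bool :=
  `[< am_indep (arith_matroid_of v) p.1 /\
      exists2 t, hypertori_cap p.1 t &
                 p.2 = connected_component (hypertori_cap p.1) t >].

(* The hypertori are indexed by E, so I ranges over subsets of E. *)
Record ai_poset := AIPoset {
  ai_val :> {set E} * set {ptws G -> R[i]^o};
  _ : ai_pred ai_val
}.

HB.instance Definition _ := [isSub for ai_val].
HB.instance Definition _ := [Choice of ai_poset by <:].

Definition ai_le (x y : ai_poset) : bool :=
  ((val x).1 \subset (val y).1) && `[< (val y).2 `<=` (val x).2 >].

Lemma ai_le_refl : reflexive ai_le.
Proof. by move=> x; rewrite /ai_le subxx; apply/asboolP. Qed.

Lemma ai_le_anti : antisymmetric ai_le.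
Proof.
move=> x y /andP[/andP[xy1 /asboolP xy2] /andP[yx1 /asboolP yx2]].
apply: val_inj; case: (val x) (val y) xy1 xy2 yx1 yx2 => [I W] [J Z] /=.
by move=> IJ ZW JI WZ; congr pair; [apply/eqP; rewrite finset.eqEsubset IJ | apply/seteqP].
Qed.

Lemma ai_le_trans : transitive ai_le.
Proof.
move=> y x z /andP[xy1 /asboolP xy2] /andP[yz1 /asboolP yz2].
apply/andP; split; first exact: fintype.subset_trans xy1 yz1.
by apply/asboolP; apply: subset_trans yz2 xy2.
Qed.

HB.instance Definition _ := Order.Le_isPOrder.Build Order.default_display
  ai_poset ai_le_refl ai_le_anti ai_le_trans.

End ToricArrangement.

Definition arithmetic_independence_poset (R : realType) (E : finType)
    (r : vector_config E) : porderType Order.default_display :=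
  ai_poset R (@vc_vec E r).

Definition poset_isomorphic d1 d2 (P : porderType d1) (Q : porderType d2) : Prop :=
  exists f : P -> Q, bijective f /\ {mono f : x y / (x <= y)%O}.

Definition without_bottom d (P : porderType d) : set P :=
  [set x | ~ forall y, (x <= y)%O].
Arguments without_bottom {d} P.

(* Families of finite subsets K play the role of simplicial complexes; the
   empty face belongs to all the complexes below. *)

Definition order_complex d (P : porderType d) (A : set P) : set {fset P} :=
  [set s : {fset P} | [set` s] `<=` A /\ {in s &, forall x y, (x >=< y)%O}].

Definition link (V : choiceType) (K : set {fset V}) (s : {fset V}) :
    set {fset V} :=
  [set t : {fset V} | [disjoint s & t]%fset /\ K (s `|` t)%fset].

Definition facet (V : choiceType) (K : set {fset V}) (s : {fset V}) : Prop :=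
  K s /\ forall t, K t -> (s `<=` t)%fset -> t = s.

Section SimplicialHomology.
Context (R : pzRingType) (d : Order.disp_t) (P : porderType d).
Implicit Types (c : {fset P} -> R) (s : {fset P}).

(* Simplicial homology of subcomplexes K of an order complex.  Their faces are
   chains of P and are oriented by the order of P; a chain of degree n - 1 is a
   finitely supported function on the faces with n vertices. *)
Definition simplicial_chain (K : set {fset P}) (n : nat) c : Prop :=
  finite_set [set s | c s != 0] /\
  forall s, c s != 0 -> K s /\ #|` s| = n.

(* d[x_0 < ... < x_n] = \sum_i (-1)^i [x_0 < .. x_i omitted .. < x_n]; the
   exponent counts the vertices that precede the omitted vertex x.  Faces with
   one vertex are mapped to the empty face, i.e. the complex is augmented. *)
Definition boundary c : {fset P} -> R := fun s =>
  \sum_(x \in [set x | x \notin s])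
    (-1) ^+ #|` [fset y in s | (y < x)%O]%fset| * c (x |` s)%fset.

Lemma simplicial_chain0 K n : simplicial_chain K n 0.
Proof.
split=> [|s]; last by rewrite eqxx.
by rewrite (_ : mkset _ = set0)//; apply/seteqP; split=> s //=; rewrite eqxx.
Qed.

Lemma simplicial_chainB K n c1 c2 :
  simplicial_chain K n c1 -> simplicial_chain K n c2 ->
  simplicial_chain K n (c1 - c2).
Proof.
move=> [f1 h1] [f2 h2].
have supp s : (c1 - c2) s != 0 -> c1 s != 0 \/ c2 s != 0.
  rewrite !fctE; case: (eqVneq (c1 s) 0) => [->|]; last by left.
  by rewrite sub0r oppr_eq0; right.
split=> [|s /supp[/h1|/h2]//].
apply: (@sub_finite_set _ _ ([set s | c1 s != 0] `|` [set s | c2 s != 0])).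
  by move=> s /supp.
by rewrite finite_setU.
Qed.

Lemma boundary0 : boundary 0 = 0.
Proof. by apply/funext => s; apply: fsbig1 => x _; rewrite mulr0. Qed.

Lemma boundary_supp c s : finite_set [set t | c t != 0] ->
  finite_set [set x | x \notin s /\ c (x |` s)%fset != 0].
Proof.
move=> fc; pose f t : {fset P} := (t `\` s)%fset.
apply: (@sub_finite_set _ _ (\bigcup_(t in [set t | c t != 0]) [set` f t])).
  move=> x [xs cx]; exists (x |` s)%fset => //=.
  by rewrite /f !inE/= eqxx xs.
by apply: bigcup_finite => // t _; exact: finite_fset.
Qed.

Lemma boundaryB c1 c2 :
  finite_set [set s | c1 s != 0] -> finite_set [set s | c2 s != 0] ->
  boundary (c1 - c2) = boundary c1 - boundary c2.
Proof.
move=> f1 f2; apply/funext => s; rewrite -[RHS]/(boundary c1 s - boundary c2 s).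
pose X := fset_set ([set x | x \notin s /\ c1 (x |` s)%fset != 0] `|`
                    [set x | x \notin s /\ c2 (x |` s)%fset != 0]).
have Xfin : finite_set ([set x | x \notin s /\ c1 (x |` s)%fset != 0] `|`
                    [set x | x \notin s /\ c2 (x |` s)%fset != 0]).
  by rewrite finite_setU; split; exact: boundary_supp.
have Xs : [set` X] `<=` [set x | x \notin s].
  by move=> x; rewrite /= /X in_fset_set// inE /= => -[][].
have Xout x : x \notin s -> x \notin X ->
    c1 (x |` s)%fset = 0 /\ c2 (x |` s)%fset = 0.
  move=> xs; rewrite /X in_fset_set// => /negP xX.
  by split; apply/eqP; apply: contraPT xX => h; rewrite not_notE inE;
    [left|right].
have bE c : (forall x, x \notin s -> x \notin X -> c (x |` s)%fset = 0) ->
    boundary c s = \sum_(x <- enum_fset X | x \in [set x | x \notin s])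
      (-1) ^+ #|` [fset y in s | (y < x)%O]%fset| * c (x |` s)%fset.
  move=> c0; apply: fsbigE => [||x /= xs xX]; [exact: fset_uniq|exact: Xs|].
  by rewrite c0 ?mulr0.
rewrite (bE (c1 - c2)) ?(bE c1) ?(bE c2).
- by rewrite -sumrB; apply: eq_bigr => x _; rewrite -mulrBr.
- by move=> x xs /(Xout x xs)[].
- by move=> x xs /(Xout x xs)[].
- by move=> x xs /(Xout x xs)[e1 e2]; rewrite !fctE e1 e2 subrr.
Qed.

Section Degree.
Context (K : set {fset P}) (n : nat).

Definition is_cycle : {pred {fset P} -> R} :=
  fun c => `[< simplicial_chain K n.+1 c /\ boundary c = 0 >].

Lemma is_cycle_zmod_closed : zmod_closed is_cycle.
Proof.
split; first by apply/asboolP; split; [exact: simplicial_chain0|exact: boundary0].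
move=> c1 c2 /asboolP[k1 b1] /asboolP[k2 b2]; apply/asboolP.
split; first exact: simplicial_chainB.
by rewrite boundaryB ?b1 ?b2 ?subrr//; [case: k1|case: k2].
Qed.

HB.instance Definition _ :=
  GRing.isZmodClosed.Build ({fset P} -> R) is_cycle is_cycle_zmod_closed.

Record cycle := Cycle { cycle_val :> {fset P} -> R; _ : is_cycle cycle_val }.

HB.instance Definition _ := [isSub for cycle_val].
HB.instance Definition _ := [Choice of cycle by <:].
HB.instance Definition _ := [SubChoice_isSubZmodule of cycle by <:].

Definition is_boundary : {pred cycle} :=
  fun z => `[< exists2 b, simplicial_chain K n.+2 b & boundary b = val z >].

Lemma is_boundary_zmod_closed : zmod_closed is_boundary.
Proof.
split; first by apply/asboolP; exists 0; [exact: simplicial_chain0|exact: boundary0].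
move=> z1 z2 /asboolP[b1 k1 e1] /asboolP[b2 k2 e2]; apply/asboolP.
exists (b1 - b2); first exact: simplicial_chainB.
by rewrite boundaryB ?e1 ?e2 ?raddfB//; [case: k1|case: k2].
Qed.

HB.instance Definition _ :=
  GRing.isZmodClosed.Build cycle is_boundary is_boundary_zmod_closed.

Definition reduced_homology : zmodType := Quotient.quot is_boundary.

End Degree.
End SimplicialHomology.

(* The reduced homology of the link of every face vanishes below the dimension
   of the link: [n < dim (link K s)] is expressed by the existence of a face
   of the link of dimension at least n + 1.  Degree -1 needs no mention, since
   the reduced homology of a nonempty complex vanishes there. *)
Definition cohen_macaulay (k : fieldType) d (P : porderType d)
    (K : set {fset P}) : Prop :=
  forall s, K s -> forall n : nat,
    (exists2 t, link K s t & (n.+1 < #|` t|)%N) ->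
    forall x : reduced_homology k (link K s) n, x = 0.

Definition simplex (V : choiceType) (s : {fset V}) : set {fset V} :=
  [set t | (t `<=` s)%fset].

(* The facets can be listed as F_0, F_1, ... so that, for k > 0, the
   intersection of the simplex F_k with the union of the previous ones is pure
   of dimension dim F_k - 1 (with no purity assumption on K itself). *)
Definition shellable (V : choiceType) (K : set {fset V}) : Prop :=
  exists F : seq {fset V},
    [/\ uniq F, (forall s, s \in F <-> facet K s) &
        forall k, (0 < k < size F)%N ->
          forall t,
            facet (simplex (nth fset0 F k) `&`
                   \bigcup_(i in [set i | (i < k)%N]) simplex (nth fset0 F i)) t ->
            #|` t|.+1 = #|` nth fset0 F k| ].

Definition matrixA : 'M[int]_(3, 4) :=
  \matrix_(i < 3, j < 4)
    nth 0 (nth [::] [:: [:: 1; 1; 1; -3];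
                        [:: 0; 5; 0; -5];
                        [:: 0; 0; 5; -5] ] i) j.

Definition arith_matroidA : arith_matroid 'I_4 :=
  arith_matroid_of (fun j : 'I_4 => col j matrixA).

(* Main.v *)
Require Import Defs.
From HB Require Import structures.
From mathcomp Require Import all_boot all_order all_algebra.
From mathcomp Require Import generic_quotient ring_quotient complex finmap.
From mathcomp Require Import all_classical all_reals all_analysis.
From mathcomp Require Import ring lra zify.

(** Up to the signs of the four vectors, every essential representation of the arithmetic
    matroid is described by a vector [phi] with nonzero entries over the field with 5 elements,
    which sum up to 0: the vectors [v e] satisfy no relation besides multiples of their sum,
    and the group consists of the quotients by 5 of those combinations whose coefficients are
    orthogonal to [phi] modulo 5 (the record [good]).  The multiplicities force this form
    ([essential_signed_good]): those of the triples and of all four vectors agree, so each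
    vector is an integral combination of the other three and the coefficients of the relation
    are signs, and the pairs, of multiplicity 5, yield [phi].  Two representations are
    equivalent if and only if their vectors [phi] are proportional, and 13 vectors are left
    after scaling the first entry to 1 ([thirteen_classes]).

    A point [t] of an intersection of hypertori indexed by [I] takes values in the fifth roots
    of unity on the elements [g] such that [5 g] is a combination of the [v e] with [e] in [I].
    These values amount to a family of labels in Z/5 on [I] modulo constants; they distinguish
    the components ([component_labels], [labels_component]) and all labels occur
    ([labels_realize]).  As [phi] can be absorbed in the labels, the poset is always the poset
    [model] of pairs of a subset [I] with at most 3 elements and labels on [I] modulo
    constants, ordered by restriction ([essential_model]).

    The topology of the model is governed by [cocycle_classification]: with values in any
    abelian group, a 1-cocycle on the model without its bottom is a coboundary plus a multiple
    of one explicit cocycle [model_cocycle] by an element killed by 5.  Applied to the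
    universal cocycle, which sends an edge to its class modulo boundaries, this shows that the
    first homology is Z/5 ([model_homology1]).  Over the rationals, where nothing is killed by
    5, it gives the rank of the boundary from triangles to edges; there are 134 vertices, 660
    edges and 600 triangles, and no larger chains, so the second homology is free of rank
    600 - (660 - (134 - 1)) = 73 ([model_homology2]).

    The evaluation of [model_cocycle] on a loop is 1.  Hence the first homology does not vanish
    in characteristic 5, although the complex has dimension 2, and the complex is not
    Cohen-Macaulay.  A shelling would attach each triangle along edges to the previous ones,
    so that primitives of a cocycle on the single triangles could be adjusted one after the
    other to a global primitive ([shellable_primitive]); the loop shows that [model_cocycle]
    has none ([model_no_primitive]). *)

Set Implicit Arguments.
Unset Strict Implicit.
Unset Printing Implicit Defensive.

Import numFieldNormedType.Exports.
Import Order.TTheory GRing.Theory Num.Theory.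
Local Open Scope quotient_scope.
Local Open Scope ring_scope.

(** * Connected components of intersections of hypertori *)

Section TorusTopology.
Local Open Scope classical_set_scope.
Context (R : realType).
Local Notation C := (R[i]^o).

Lemma ptws_cvg (S : Type) (F : set_system S) (FF : Filter F) (G : Type)
    (f : S -> {ptws G -> C}) (h : {ptws G -> C}) :
  (forall g, (fun s => f s g) @ F --> (h g : C)) -> f @ F --> h.
Proof.
move=> fh; apply/cvg_sup => g U [V [[W oW <-] Wh WU]].
apply: filterS WU _; apply: (fh g).
by apply: open_nbhs_nbhs; split.
Qed.

Lemma real_complex_continuous : continuous (fun s : R => s%:C%C : C).
Proof.
move=> s; apply/cvgrPdist_lt => -[e e'].
rewrite ltcE /= => /andP[/eqP -> e0].
near=> u.
rewrite -raddfB /= normc_def /= expr0n /= addr0 sqrtr_sqr ltcE /= eqxx /=.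
near: u; exact: (@cvgr_dist_lt _ _ _ _ _ id s).
Unshelve. all: by end_near.
Qed.

Lemma exprz_continuous (m : int) (z : C) : z != 0 ->
  {for z, continuous (fun x : C => x ^ m : C)}.
Proof.
have natX (k : nat) : {for z, continuous (fun x : C => x ^+ k : C)}.
  elim: k => [|k IH]; first exact: cst_continuous.
  rewrite (_ : (fun x : C => x ^+ k.+1 : C) = (fun x : C => x * x ^+ k : C)).
    by apply: (@cvgM _ _ (nbhs z) _ id (fun x : C => x ^+ k : C) z (z ^+ k)); [exact: cvg_id|exact: IH].
  by apply/funext => x; rewrite exprS.
case: m => k z0; first exact: natX.
by apply: (@cvgV _ _ (nbhs z) _ (fun x : C => x ^+ k.+1 : C) (z ^+ k.+1)); [rewrite expf_neq0|exact: natX].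
Qed.

Section Components.
Context (E : finType) (G : zmodType) (v : E -> G) (I : {set E}).
Implicit Types (t : {ptws G -> C}) (n : {additive G -> int}).

(** The path from [t] follows the segment from 1 to [rho], which avoids 0
    because it stays in a half plane. *)
Lemma torus_segment t n (rho : C) :
  hypertori_cap v I t -> (forall e, e \in I -> n (v e) = 0) ->
  rho != 0 -> 0 <= 'Re rho ->
  connected_component (hypertori_cap v I) t (fun g => t g * rho ^ n g).
Proof.
move=> [[t0 tD] tI] nI rho0 rho_ge0.
pose z (s : R) : C := 1 + s%:C%C * (rho - 1).
pose f (s : R) : {ptws G -> C} := fun g => t g * z s ^ n g.
have z0 s : 0 <= s <= 1 -> z s != 0.
  move=> /andP[s_ge0]; rewrite le_eqVlt => /orP[/eqP->|s1].
    by rewrite /z mul1r addrC subrK.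
  apply/eqP => zs.
  have sC : s%:C%C \is Num.real by rewrite complex_real.
  have : 'Re (z s) = (1 - s)%:C%C + s%:C%C * 'Re rho.
    rewrite /z raddfD /= (Creal_ReP 1 _) ?rpred1// ReMl// raddfB /=.
    by rewrite (Creal_ReP 1 _) ?rpred1// !raddfB /= rmorph1; ring.
  rewrite zs raddf0 => /esym/eqP; rewrite gt_eqF//.
  rewrite ltr_wpDr ?mulr_ge0 ?ler0c//.
  by rewrite ltcR subr_gt0.
have fE : f 1 = (fun g => t g * rho ^ n g).
  by apply/funext => g; rewrite /f /z mul1r addrC subrK.
have f0 : f 0 = t.
  by apply/funext => g; rewrite /f /z mul0r addr0 exp1rz mulr1.
exists (f @` `[0, 1]); last first.
  by exists 1; [rewrite /= in_itv /= ler01 lexx|exact: fE].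
split.
- by exists 0; [rewrite /= in_itv /= ler01 lexx|exact: f0].
- move=> _ [s /= + <-]; rewrite in_itv /= => s01; split; [split|].
  + by move=> g; rewrite mulf_neq0 ?expfz_neq0 ?z0.
  + by move=> g h; rewrite /f tD raddfD /= (expfzDr _ _ (z0 s s01)) mulrACA.
  + move=> e /= eI; split; last by rewrite /f (tI e eI).2 (nI e eI) mulr1.
    split; first by move=> g; rewrite mulf_neq0 ?expfz_neq0 ?z0.
    by move=> g h; rewrite /f tD raddfD /= (expfzDr _ _ (z0 s s01)) mulrACA.
- apply: connected_continuous_connected; first exact: segment_connected.
  apply: continuous_in_subspaceT => s /set_mem /= s01.
  apply: ptws_cvg => g; apply: cvgMr.
  apply: (@continuous_comp _ _ _ z (fun x : C => x ^ n g : C)).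
    apply: cvgD; first exact: cvg_cst.
    by apply: cvgMl; exact: real_complex_continuous.
  by apply: exprz_continuous; exact: z0.
Qed.

(** A one-parameter subgroup that is constant on the hypertori of [I] does not
    leave a component: cross over by a square root of [rho], whose real part is
    nonnegative. *)
Lemma torus_subgroup t n (rho : C) :
  hypertori_cap v I t -> (forall e, e \in I -> n (v e) = 0) -> rho != 0 ->
  connected_component (hypertori_cap v I) t (fun g => t g * rho ^ n g).
Proof.
move=> tI nI rho0.
have [sigma [sigma2 sigma_ge0]] : exists s : C, s * s = rho /\ 0 <= 'Re s.
  have [s_ge0|s_lt0] := real_ge0P (Creal_Re (sqrtC (rho : R[i]))).
    by exists (sqrtC (rho : R[i])); rewrite -expr2 sqrtCK.
  exists (- sqrtC (rho : R[i])); split; first by rewrite mulrNN -expr2 sqrtCK.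
  by rewrite raddfN /= oppr_ge0 ltW.
have sigma0 : sigma != 0.
  by apply: contra_neq rho0 => s0; rewrite -sigma2 s0 mul0r.
have step := torus_segment tI nI sigma0 sigma_ge0.
apply: (connected_component_trans step).
have -> : (fun g => t g * rho ^ n g) =
    (fun g => (t g * sigma ^ n g) * sigma ^ n g) :> {ptws G -> C}.
  by apply/funext => g; rewrite -mulrA -expfzMl sigma2.
apply: torus_segment => //; exact: connected_component_sub step.
Qed.

(** Evaluation at [g] is continuous, so it is constant on a component where it
    only takes values in a finite set. *)
Lemma component_eval t t' g (S : seq C) :
  (forall s, hypertori_cap v I s -> s g \in S) ->
  connected_component (hypertori_cap v I) t t' -> t' g = t g.
Proof.
move=> hS [D [Dt DI Dconn] Dt'].
have eval_cts : continuous (fun s : {ptws G -> C} => s g : C).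
  exact: (@proj_continuous G (fun=> C) g).
have closedS (S' : set C) : finite_set S' -> closed S'.
  move: S'; apply/accessible_finite_set_closed.
  by apply: hausdorff_accessible; exact: norm_hausdorff.
have DE : D `&` [set s | s g = t g] = D.
  apply: Dconn; first by exists t.
  - exists (~` ((fun s : {ptws G -> C} => s g : C) @^-1` [set x | x \in S /\ x != t g])).
      apply: closed_openC; apply: preimage_closed => //.
      apply: closedS; apply: (@sub_finite_set _ _ [set` S]); last exact: finite_seq.
      by move=> x /= [].
    apply/seteqP; split=> s /= [Ds].
      by move=> st; split=> // -[_]; rewrite st eqxx.
    move=> /not_andP[|/negP/negPn/eqP//]; first by rewrite hS//; exact: DI.
  - exists ((fun s : {ptws G -> C} => s g : C) @^-1` [set t g]) => //.
    by apply: preimage_closed => //; apply: closedS; exact: finite_set1.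
by move: Dt'; rewrite -DE => -[].
Qed.

End Components.
End TorusTopology.

(** * Quotients, multiplicities and ranks *)

Lemma inj_surj_bijective (T U : Type) (f : T -> U) :
  injective f -> (forall u, exists t, f t = u) -> bijective f.
Proof.
move=> finj fsurj; rewrite -setTT_bijective; split => //.
- by move=> x y _ _; exact: finj.
- by move=> u _; have [t <-] := fsurj u; exists t.
Qed.

Section Quotients.
Variables (V : zmodType) (I : zmodClosed V).

Lemma quot_eqP (x y : V) :
  reflect (\pi_(Quotient.quot I) x = \pi_(Quotient.quot I) y) (x - y \in I).
Proof. by rewrite Quotient.idealrBE; exact: eqP. Qed.

Lemma quot_surj (y : Quotient.quot I) : exists x : V, y = \pi_(Quotient.quot I) x.
Proof. by exists (repr y); rewrite reprK. Qed.

Lemma quot_isomorphic (W : zmodType) (f : {additive V -> W}) :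
  (forall w, exists x, f x = w) -> (forall x, x \in I <-> f x = 0) ->
  zmod_isomorphic (Quotient.quot I) W.
Proof.
move=> fsurj fker.
pose h (y : Quotient.quot I) : W := f (repr y).
have hpi x : h (\pi_(Quotient.quot I) x) = f x.
  apply/eqP; rewrite -subr_eq0 -raddfB; apply/eqP/fker/quot_eqP.
  by rewrite reprK.
have hD : zmod_morphism h.
  move=> x y; have [[a ->] [b ->]] := (quot_surj x, quot_surj y).
  by rewrite -raddfB !hpi raddfB.
pose hA : {additive Quotient.quot I -> W} :=
  HB.pack h (GRing.isZmodMorphism.Build _ _ h hD).
exists hA; apply: inj_surj_bijective.
- move=> x y /=; have [[a ->] [b ->]] := (quot_surj x, quot_surj y).
  rewrite !hpi => /eqP; rewrite -subr_eq0 -raddfB => /eqP/fker.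
  by move/quot_eqP.
- by move=> w; have [x <-] := fsurj w; exists (\pi_(Quotient.quot I) x); rewrite -hpi.
Qed.
End Quotients.

(** Zero columns turn [C] into a singular square matrix. *)
Lemma int_left_kernel (k m : nat) (C : 'M[int]_(k, m)) : (m < k)%N ->
  exists2 e : 'rV[int]_k, e != 0 & e *m C = 0.
Proof.
move=> /subnKC; rewrite addSnnS; move: (k - m.+1)%N => p kE; subst k.
have : \det (row_mx C (0 : 'M[int]_(m + p.+1, p.+1))) == 0.
  rewrite -det_tr; apply/det0P; exists (row_mx 0 (const_mx 1)).
    apply/eqP; rewrite -(row_mx0 int 1 m p.+1) => /eq_row_mx[_ /matrixP/(_ 0 0)].
    by rewrite !mxE.
  by rewrite tr_row_mx mul_row_col mul0mx trmx0 mulmx0 addr0.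
move=> /det0P[e e0 eC]; exists e => //; move: eC.
by rewrite mul_mx_row mulmx0 -[RHS]row_mx0 => /eq_row_mx[].
Qed.

Section ArithMatroid.
Local Open Scope classical_set_scope.
Context (E : finType) (G : zmodType) (v : E -> G).
Implicit Types X Y : {set E}.

Definition sat X : set G :=
  [set g | exists2 n : nat, (0 < n)%N & g *+ n \in zspan v X].

Lemma sat_sub X (g h : G) : sat X g -> sat X h -> sat X (g - h).
Proof.
move=> [m m0 gm] [n n0 hn]; exists (m * n)%N; first by rewrite muln_gt0 m0.
by rewrite mulrnBl rpredB//; [rewrite mulrnA|rewrite mulnC mulrnA]; exact: rpredMn.
Qed.

Lemma torsion_piP X g : @torsion (quot_zspan v X) (\pi g) <-> sat X g.
Proof.
split=> -[n n0 gn]; exists n => //.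
  by rewrite -[_ *+ _]subr0; apply/quot_eqP; rewrite raddfMn raddf0.
by move: gn; rewrite -{1}[_ *+ _]subr0 => /quot_eqP; rewrite raddfMn raddf0.
Qed.

(** The torsion of the quotient by the span is the saturation modulo the span, so it is
    counted by any transversal. *)
Lemma am_mult_transversal X (T : finType) (r : T -> G) :
  (forall i, sat X (r i)) ->
  (forall i j, r i - r j \in zspan v X -> i = j) ->
  (forall g, sat X g -> exists i, g - r i \in zspan v X) ->
  am_mult (arith_matroid_of v) X = #|T|.
Proof.
move=> rsat rinj rsurj /=.
pose A := [fset \pi_(quot_zspan v X) (r i) | i in T]%fset.
have -> : @torsion (quot_zspan v X) = [set` A].
  apply/seteqP; split=> y /=; last first.
    by case/imfsetP => i _ ->; apply/torsion_piP.
  have [g ->] := quot_surj y => /torsion_piP/rsurj[i gi].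
  by apply/imfsetP; exists i => //; apply/quot_eqP.
rewrite set_fsetK card_imfset /= ?cardE//.
by move=> i j /quot_eqP/rinj.
Qed.

(** The default value of [fset_set] for infinite sets is empty, so a positive
    multiplicity forces the torsion subgroup to be finite. *)
Lemma am_mult_gt0 X n : (0 < n)%N -> am_mult (arith_matroid_of v) X = n ->
  exists r : 'I_n -> G,
  [/\ forall i, sat X (r i), forall i j, r i - r j \in zspan v X -> i = j &
      forall g, sat X g -> exists i, g - r i \in zspan v X].
Proof.
move=> n0 /= mn.
have fin : finite_set (@torsion (quot_zspan v X)).
  apply: contrapT => ninf; move: n0; rewrite -mn /fset_set.
  by case: pselect => // ?; rewrite cardfs0.
set A := fset_set _ in mn.
have mA : size (enum_fset A) = n by [].
pose r (i : 'I_n) : G := repr (nth (\pi 0) (enum_fset A) i).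
have rA (i : 'I_n) : nth (\pi 0) (enum_fset A) i \in A by rewrite mem_nth ?mA.
have inA y : (y \in A) <-> torsion y by rewrite in_fset_set// inE.
exists r; split.
- by move=> i; apply/torsion_piP; rewrite reprK; apply/inA/rA.
- move=> i j /quot_eqP; rewrite !reprK => /eqP; rewrite nth_uniq ?mA ?fset_uniq//.
  by move/eqP/val_inj.
- move=> g /torsion_piP/inA gA.
  have gi : (index (\pi g) (enum_fset A) < n)%N by rewrite -mA index_mem.
  by exists (Ordinal gi); apply/quot_eqP; rewrite reprK nth_index.
Qed.

Lemma zrankP (H : set G) n : has_zindep H n ->
  (forall k, has_zindep H k -> (k <= n)%N) -> zrank H = n.
Proof.
move=> Hn Hle; apply: xget_unique => // m [Hm mle].
by apply/eqP; rewrite eqn_leq mle// Hle.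
Qed.

(** A positive rank is not the default value of [zrank]. *)
Lemma zrank_gt0 (H : set G) n : (0 < n)%N -> zrank H = n ->
  has_zindep H n /\ forall k, has_zindep H k -> (k <= n)%N.
Proof.
move=> n0; rewrite /zrank; case: xgetP => [m -> [Hm mle] <- //|_ n0E].
by rewrite -n0E in n0.
Qed.

Lemma zspanP X g :
  reflect (exists c : E -> int, g = \sum_(e in X) v e *~ c e) (g \in zspan v X).
Proof. exact: asboolP. Qed.

(** The coefficients of the [x i] form a matrix with [k] rows and [#|X|] columns; if
    [k] were larger, a vector of its left kernel would be a relation between the [x i]. *)
Lemma zindep_leq X k (x : 'I_k -> G) (N : int) : N != 0 ->
  (forall i, x i *~ N \in zspan v X) -> zindep x -> (k <= #|X|)%N.
Proof.
move=> N0 xX xind; rewrite leqNgt; apply/negP => kX.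
have /choice[c xE] : forall i, exists c : E -> int,
    x i *~ N = \sum_(e in X) v e *~ c e by move=> i; apply/zspanP/xX.
have [e e0 eC] := int_left_kernel (\matrix_(i < k, j < #|X|) c i (enum_val j)) kX.
have /xind eN : \sum_i x i *~ (N * e 0 i) = 0.
  transitivity (\sum_i \sum_(a in X) v a *~ (c i a * e 0 i)).
    apply: eq_bigr => i _; rewrite mulrzA xE mulrz_suml.
    by apply: eq_bigr => a _; rewrite mulrzA.
  rewrite exchange_big big1 //= => a aX; rewrite -mulrz_sumr.
  rewrite (_ : \sum_i _ = 0) ?mulr0z//.
  have /matrixP/(_ 0 (enum_rank_in aX a)) := eC; rewrite !mxE; apply: etrans.
  by apply: eq_bigr => i _; rewrite mxE enum_rankK_in// mulrC.
move: e0; apply/negP/negPn/eqP/rowP => i; rewrite mxE.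
by have /eqP := eN i; rewrite mulf_eq0 (negPf N0) => /eqP.
Qed.

Lemma zspan_gen X e : e \in X -> v e \in zspan v X.
Proof.
move=> eX; apply/zspanP; exists (fun a => (a == e)%:Z).
rewrite (bigD1 e)//= eqxx mulr1z big1 ?addr0// => a /andP[_ /negPf->].
by rewrite mulr0z.
Qed.

Lemma zspan_mono X Y g : X \subset Y -> g \in zspan v X -> g \in zspan v Y.
Proof.
move=> XY /zspanP[c ->]; apply: rpred_sum => e eX.
by rewrite rpredMz ?zspan_gen// (fintype.subsetP XY).
Qed.

(** If [v] satisfied a relation on [X] with coefficient [N] at [e], then [N]
    times the span would be generated without [v e]. *)
Lemma zrank_indep X (c : E -> int) : zrank [set` zspan v X] = #|X| ->
  \sum_(e in X) v e *~ c e = 0 -> forall e, e \in X -> c e = 0.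
Proof.
move=> rX cv e eX; apply/eqP/negPn/negP => ce0.
have X0 : (0 < #|X|)%N by apply/card_gt0P; exists e.
have [[x [xX xind]] _] := zrank_gt0 X0 rX.
suff : (#|X| <= #|X :\ e|)%N by rewrite (cardsD1 e X) eX ltnn.
apply: (zindep_leq ce0 _ xind) => i; have /zspanP[d ->] := xX i.
rewrite mulrz_suml; apply: rpred_sum => a aX; rewrite -mulrzA.
have [->|ae] := eqVneq a e; last first.
  by rewrite rpredMz// zspan_gen// in_setD1 ae.
have -> : v e *~ (d e * c e) = - (\sum_(a in X :\ e) v a *~ c a) *~ d e.
  rewrite mulrC mulrzA; congr (_ *~ _).
  by move: cv; rewrite (big_setD1 e eX) => /eqP; rewrite addr_eq0 => /eqP ->.
rewrite rpredMz ?rpredN//; apply: rpred_sum => b bX.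
by rewrite rpredMz// zspan_gen.
Qed.

Lemma has_zindep_span X :
  (forall c : E -> int, \sum_(e in X) v e *~ c e = 0 -> forall e, e \in X -> c e = 0) ->
  has_zindep [set` zspan v X] #|X|.
Proof.
move=> ind; exists (fun i => v (enum_val i)).
split=> [i|c cv i]; first by rewrite /= zspan_gen// enum_valP.
have iX := enum_valP i.
pose d e := c (enum_rank_in iX e).
have dE j : d (enum_val j) = c j by rewrite /d enum_valK_in.
have /ind/(_ _ iX) : \sum_(e in X) v e *~ d e = 0; last by rewrite dE.
by rewrite big_enum_val /= -[RHS]cv; apply: eq_bigr => j _; rewrite dE.
Qed.

End ArithMatroid.

(** * Configurations determined by a vector modulo 5 *)

Section LinComb.
Context (E : finType) (G : zmodType) (v : E -> G).
Implicit Types (c d : E -> int) (X : {set E}).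

Definition lincomb c : G := \sum_e v e *~ c e.

Lemma lincombD c d : lincomb (fun e => c e + d e) = lincomb c + lincomb d.
Proof. by rewrite -big_split; apply: eq_bigr => e _; rewrite mulrzDr. Qed.

Lemma lincombN c : lincomb (fun e => - c e) = - lincomb c.
Proof. by rewrite -sumrN; apply: eq_bigr => e _; rewrite mulrNz. Qed.

Lemma lincombB c d : lincomb (fun e => c e - d e) = lincomb c - lincomb d.
Proof. by rewrite lincombD lincombN. Qed.

Lemma lincombZ c (n : int) : lincomb (fun e => c e * n) = lincomb c *~ n.
Proof. by rewrite mulrz_suml; apply: eq_bigr => e _; rewrite mulrzA. Qed.

Lemma lincomb_gen e : lincomb (fun a => (a == e)%:Z) = v e.
Proof.
rewrite /lincomb (bigD1 e)//= eqxx mulr1z big1 ?addr0// => a /negPf->.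
by rewrite mulr0z.
Qed.

Lemma lincomb_set X c : (forall e, e \notin X -> c e = 0) ->
  lincomb c = \sum_(e in X) v e *~ c e.
Proof.
move=> c0; rewrite /lincomb (bigID [in X])/= [X in _ + X]big1 ?addr0// => e eX.
by rewrite c0// mulr0z.
Qed.

Lemma zspan_lincombP X g :
  g \in zspan v X <->
  exists2 c, (forall e, e \notin X -> c e = 0) & g = lincomb c.
Proof.
split=> [/zspanP[c ->]|[c c0 ->]]; last first.
  by apply/zspanP; exists c; exact: lincomb_set.
exists (fun e => if e \in X then c e else 0) => [e /negPf-> //|].
rewrite (@lincomb_set X) => [|e /negPf-> //].
by apply: eq_bigr => e ->.
Qed.

End LinComb.

Lemma F5_intr_eq0 (n : int) : (n%:~R == 0 :> 'F_5) = (5 %| n)%Z.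
Proof. by rewrite -(dvdz_pcharf (pchar_Fp (isT : prime 5))). Qed.

Lemma F5_lift (x : 'F_5) : ((val x)%:Z)%:~R = x.
Proof. by rewrite -pmulrn natr_Zp. Qed.

(** [G] is the lattice of all [g] such that [5 g] is a combination of the [v e]
    whose coefficient vector [c] is orthogonal to [phi] modulo 5; the only
    relation between the [v e] is that they sum up to 0. *)
Record good (G : zmodType) (v : 'I_4 -> G) (phi : 'I_4 -> 'F_5) : Prop := Good {
  good_tf : forall (g : G) (n : int), n != 0 -> g *~ n = 0 -> g = 0;
  good_sum : \sum_e v e = 0;
  good_rel : forall c, lincomb v c = 0 -> forall i j, c i = c j;
  good_phi0 : forall e, phi e != 0;
  good_div : forall c, (exists g : G, g *~ 5 = lincomb v c) <->
                       \sum_e phi e * (c e)%:~R = 0;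
  good_gen : forall g : G, exists c, g *~ 5 = lincomb v c
}.

Section Good.
Context (G : zmodType) (v : 'I_4 -> G) (phi : 'I_4 -> 'F_5).
Hypothesis gv : good v phi.
Implicit Types (X Y : {set 'I_4}) (c d : 'I_4 -> int) (g : G).

Lemma good_inj (n : int) g h : n != 0 -> g *~ n = h *~ n -> g = h.
Proof.
move=> n0 gh; apply/eqP; rewrite -subr_eq0; apply/eqP/(good_tf gv n0).
by rewrite mulrzBl gh subrr.
Qed.

Lemma good_const (n : int) : lincomb v (fun=> n) = 0.
Proof. by rewrite /lincomb -mulrz_suml (good_sum gv) mul0rz. Qed.

Lemma good_shift c (n : int) : lincomb v (fun e => c e - n) = lincomb v c.
Proof. by rewrite lincombB good_const subr0. Qed.

Lemma good_eq c d : lincomb v c = lincomb v d -> forall i j, c i - d i = c j - d j.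
Proof.
move=> cd; apply: (good_rel gv (c := fun e => c e - d e)).
by rewrite lincombB cd subrr.
Qed.

Lemma good_eq0 l c d : c l = 0 -> d l = 0 -> lincomb v c = lincomb v d -> c =1 d.
Proof.
move=> cl dl /good_eq/(_ _ l) cd e; have := cd e; rewrite cl dl subrr => /eqP.
by rewrite subr_eq0 => /eqP.
Qed.

Lemma good_orth g c : g *~ 5 = lincomb v c -> \sum_e phi e * (c e)%:~R = 0.
Proof. by move=> gc; apply/(good_div gv); exists g. Qed.

Definition kap g : 'I_4 -> int := projT1 (cid (good_gen gv g)).
Lemma kapE g : g *~ 5 = lincomb v (kap g).
Proof. exact: projT2 (cid (good_gen gv g)). Qed.

(** The coefficients of [5 g] normalised to vanish at [l]. *)
Definition coord l e g : int := kap g e - kap g l.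

Lemma coordll l g : coord l l g = 0. Proof. exact: subrr. Qed.

Lemma coordE l g : g *~ 5 = lincomb v (fun e => coord l e g).
Proof. by rewrite good_shift -kapE. Qed.

Lemma coord_unique l g c : g *~ 5 = lincomb v c -> c l = 0 -> forall e, coord l e g = c e.
Proof.
by move=> gc cl; apply: (good_eq0 (coordll l g) cl); rewrite -coordE.
Qed.

(** The relations between the [v e] are multiples of their sum, so the coefficients of
    [5 g] are unique once one of them is prescribed. *)
Lemma coord_is_zmod_morphism l e : zmod_morphism (coord l e).
Proof.
move=> g h; apply: (@coord_unique _ _ (fun e => coord l e g - coord l e h)).
  by rewrite lincombB mulrzBl -!coordE.
by rewrite !coordll subrr.
Qed.

HB.instance Definition _ l e :=
  GRing.isZmodMorphism.Build G int (coord l e) (coord_is_zmod_morphism l e).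

Lemma coord_orth l g : \sum_e phi e * (coord l e g)%:~R = 0.
Proof. by apply: (@good_orth g); exact: coordE. Qed.

Lemma coord_gen l e a : e != l -> coord l a (v e) = (a == e)%:Z * 5.
Proof.
move=> el; apply: (@coord_unique _ _ (fun a => (a == e)%:Z * 5)).
  by rewrite lincombZ lincomb_gen.
by rewrite eq_sym (negPf el).
Qed.

Lemma sat_coord X l g e : l \notin X -> sat v X g -> e \notin X -> coord l e g = 0.
Proof.
move=> lX [n n0 /zspan_lincombP[c c0 gn]] eX.
have : coord l e (g *+ n) = c e * 5.
  apply: (@coord_unique _ _ (fun e => c e * 5)); first by rewrite gn lincombZ.
  by rewrite c0.
rewrite raddfMn c0// mul0r => /eqP; rewrite mulrn_eq0 => /orP[/eqP n0'|/eqP //].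
by rewrite n0' in n0.
Qed.

Lemma coord_sat X l g : (forall e, e \notin X -> coord l e g = 0) -> sat v X g.
Proof.
move=> h; exists 5%N => //; apply/zspan_lincombP.
by exists (fun e => coord l e g) => //; rewrite -coordE.
Qed.

(** In terms of the coordinates, the span consists of the elements of the saturation all
    of whose coordinates are divisible by 5. *)
Lemma zspan_coord X l g : l \notin X -> sat v X g ->
  (g \in zspan v X) <-> forall e, (5 %| coord l e g)%Z.
Proof.
move=> lX gX; split=> [/zspan_lincombP[c c0 gc] e|dvd].
  have -> : coord l e g = c e * 5; last exact: dvdz_mull.
  apply: (@coord_unique _ _ (fun e => c e * 5)); first by rewrite gc lincombZ.
  by rewrite c0.
apply/zspan_lincombP; exists (fun e => (coord l e g %/ 5)%Z) => [e eX|].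
  by rewrite (sat_coord lX).
apply: (@good_inj 5) => //; rewrite -lincombZ (coordE l).
by apply: eq_bigr => e _; rewrite divzK.
Qed.

(** Since the four vectors sum up to 0, they span the same lattice as any three of them. *)
Lemma good_reduce X : exists Y, exists2 l, l \notin Y &
  [/\ #|Y| = minn #|X| 3, zspan v X =i zspan v Y & (#|Y| == 0%N) = (#|X| == 0%N)].
Proof.
have [l lX|XT] := pickP (fun l => l \notin X).
  exists X; exists l => //; split=> //; apply/esym/minn_idPl.
  suff : (#|X| < 4)%N by [].
  rewrite -[X in (_ < X)%N](card_ord 4); apply: proper_card.
  by apply/properP; split; [exact/fintype.subsetP|exists l].
have -> : X = [set: 'I_4]%SET by apply/setP => e; have := XT e; rewrite inE => /negbFE.
exists [set~ ord0]; exists ord0; first by rewrite !inE eqxx.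
split; first by rewrite cardsC1 cardsT card_ord.
  move=> g; apply/idP/idP => [/zspan_lincombP[c _ ->]|]; last first.
    exact/zspan_mono/finset.subsetT.
  rewrite -(good_shift _ (c ord0)); apply/zspan_lincombP.
  by exists (fun e => c e - c ord0) => // e; rewrite !inE negbK => /eqP->; rewrite subrr.
by rewrite cardsT cardsC1 card_ord.
Qed.

Lemma good_zindep_leq k (x : 'I_k -> G) : zindep x -> (k <= 3)%N.
Proof.
move=> xind; have -> : 3%N = #|[set~ ord0 : 'I_4]| by rewrite cardsC1 card_ord.
apply: (@zindep_leq _ _ v _ _ _ 5) xind => // i; rewrite (coordE ord0).
apply/zspan_lincombP; exists (fun e => coord ord0 e (x i)) => // e.
by rewrite !inE negbK => /eqP->; rewrite coordll.
Qed.

Lemma good_has_zindep Y l : l \notin Y -> has_zindep [set` zspan v Y] #|Y|.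
Proof.
move=> lY; apply: has_zindep_span => c cv e eY.
pose d e := if e \in Y then c e else 0.
have -> : c e = d e by rewrite /d eY.
have dl : d l = 0 by rewrite /d (negPf lY).
rewrite -dl; apply: (good_rel gv).
rewrite (@lincomb_set _ _ _ Y) => [|a /negPf aY]; last by rewrite /d aY.
by rewrite -[RHS]cv; apply: eq_bigr => a aY; rewrite /d aY.
Qed.

Lemma good_rk X : am_rk (arith_matroid_of v) X = minn #|X| 3.
Proof.
have [Y [l lY [cardY XY _]]] := good_reduce X.
rewrite /= (_ : [set` zspan v X]%classic = [set` zspan v Y]%classic); last first.
  by apply/seteqP; split=> g /=; rewrite XY.
apply: zrankP; first by rewrite -cardY; exact: good_has_zindep lY.
move=> k [x [xY xind]]; rewrite -cardY.
by apply: (@zindep_leq _ _ v _ _ _ 1 _ _ xind) => // i; rewrite mulr1z; exact: xY.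
Qed.

Lemma good_zrankT : zrank [set: G]%classic = 3.
Proof.
apply: zrankP; last by move=> k [x [_ xind]]; exact: good_zindep_leq xind.
have := @good_has_zindep [set~ ord0] ord0; rewrite cardsC1 card_ord => /(_ _)[|x [_ xind]].
  by rewrite !inE eqxx.
by exists x.
Qed.


(** Given the classes modulo 5 of all coordinates in [Y] but one, the last one
    is determined by orthogonality to [phi]. *)
Lemma good_class Y l p (d : 'I_4 -> 'F_5) : l \notin Y -> p \in Y ->
  (forall e, e \notin Y :\ p -> d e = 0) ->
  exists g, sat v Y g /\
    forall e, e != p -> (coord l e g)%:~R = d e.
Proof.
move=> lY pY d0; have pl : p != l by apply: contraNneq lY => <-.
pose x := - (\sum_(e | e != p) phi e * d e) / phi p.
pose c (e : 'I_4) : int := if e == p then (val x)%:Z else (val (d e))%:Z.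
have cE e : (c e)%:~R = if e == p then x else d e.
  by rewrite /c; case: eqP => _; exact: F5_lift.
have c0 e : e \notin Y -> c e = 0.
  move=> eY; have ep : e != p by apply: contraNneq eY => ->.
  by rewrite /c (negPf ep) d0// !inE ep.
have [|g gc] := (good_div gv c).2.
  rewrite (bigD1 p)//= cE eqxx /x mulrC divfK ?(good_phi0 gv)//.
  rewrite -[X in - X + _](_ : \sum_(e | e != p) phi e * (c e)%:~R = _) ?addNr//.
  by apply: eq_bigr => e /negPf ep; rewrite cE ep.
have gcE := coord_unique gc (c0 _ lY).
exists g; split; first by apply: (@coord_sat _ l) => e eY; rewrite gcE c0.
by move=> e /negPf ep; rewrite gcE cE ep.
Qed.

(** The coordinate at [p] is divisible by 5 as soon as the others are, because [phi p]
    is invertible. *)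
Lemma good_zspan Y l p g : l \notin Y -> p \in Y -> sat v Y g ->
  (forall e, e \in Y :\ p -> (coord l e g)%:~R = 0 :> 'F_5) -> g \in zspan v Y.
Proof.
move=> lY pY gY h; apply/(zspan_coord lY gY) => e; rewrite -F5_intr_eq0.
have h' a : a != p -> (coord l a g)%:~R = 0 :> 'F_5.
  move=> ap; have [aY|aY] := boolP (a \in Y); first by apply: h; rewrite !inE ap.
  by rewrite (sat_coord lY gY aY).
have [->|/h' -> //] := eqVneq e p.
have := coord_orth l g; rewrite (bigD1 p)//= big1 => [|a /h' ->]; last exact: mulr0.
by rewrite addr0 => /eqP; rewrite mulf_eq0 (negPf (good_phi0 gv p)).
Qed.

(** By [good_class] and [good_zspan], the saturation modulo the span is parametrised by
    the classes modulo 5 of all coordinates in [Y] but one. *)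
Lemma good_mult X :
  am_mult (arith_matroid_of v) X =
  if #|X| == 0%N then 1%N else (5 ^ (minn #|X| 3).-1)%N.
Proof.
have [Y [l lY [cardY XY X0]]] := good_reduce X.
have satXY g : sat v X g <-> sat v Y g by split=> -[n n0 gn]; exists n; rewrite // ?XY// -XY.
rewrite -X0 -cardY; case: ifP => [/eqP/cards0_eq Y0|/negbT].
  rewrite -[RHS]card_unit; apply: (@am_mult_transversal _ _ _ _ _ (fun=> 0)).
  - by move=> _; exists 1%N; rewrite // mulr1n rpred0.
  - by case=> -[].
  - move=> g /satXY gY; exists tt; rewrite subr0 XY.
    by apply/(zspan_coord lY gY) => e; rewrite (sat_coord lY gY)// Y0 inE.
rewrite cards_eq0 => /set0Pn[p pY].
pose T := {d : {ffun 'I_4 -> 'F_5} | d \in pffun_on 0 (mem (Y :\ p)) predT}.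
have T0 (d : T) e : e \notin Y :\ p -> val d e = 0.
  move=> eY; case: d => d /= /pffun_onP[/supportP + _]; exact.
have /choice[r rP] : forall d : T, exists g, sat v Y g /\
    forall e, e != p -> (coord l e g)%:~R = val d e.
  by move=> d; apply: good_class => //; exact: T0.
have -> : (5 ^ #|Y|.-1)%N = #|{: T}|.
  by rewrite card_sig card_pffun_on (cardsD1 p Y) pY card_Fp.
apply: (@am_mult_transversal _ _ _ _ _ r).
- by move=> d; apply/satXY; exact: (rP d).1.
- move=> d d'; rewrite XY => /(zspan_coord lY (sat_sub (rP d).1 (rP d').1)) h.
  apply: val_inj; apply/ffunP => e.
  have [ep|ep] := eqVneq e p; first by rewrite !T0// !inE ep eqxx.
  apply/eqP; rewrite -subr_eq0 -!(rP _).2// -rmorphB /= -raddfB.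
  by rewrite F5_intr_eq0; exact: h.
- move=> g /satXY gY.
  pose d := [ffun e => if e \in Y :\ p then (coord l e g)%:~R else 0 : 'F_5].
  have dT : d \in pffun_on 0 (mem (Y :\ p)) predT.
    apply/pffun_onP; split=> //.
    by apply/supportP => e /negPf eY; rewrite ffunE eY.
  exists (Sub d dT : T); rewrite XY.
  apply: (good_zspan lY pY); first exact: sat_sub gY (rP _).1.
  move=> e eY; rewrite (raddfB (coord l e)) intrB (rP _).2; last by move: eY; rewrite !inE => /andP[].
  by rewrite SubK ffunE eY subrr.
Qed.

End Good.

(** * The configurations in the lattice of rank 3 and their arithmetic matroid *)

Notation o0 := (ord0 : 'I_4).
Notation o1 := (lift ord0 (ord0 : 'I_3)).
Notation o2 := (lift ord0 (lift ord0 (ord0 : 'I_2))).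
Notation o3 := (lift ord0 (lift ord0 (lift ord0 (ord0 : 'I_1)))).

Lemma I4_ind (P : 'I_4 -> Prop) : P o0 -> P o1 -> P o2 -> P o3 -> forall e, P e.
Proof.
move=> P0 P1 P2 P3 [[|[|[|[|//]]]] lt4].
- by rewrite (_ : Ordinal _ = o0)//; exact: val_inj.
- by rewrite (_ : Ordinal _ = o1)//; exact: val_inj.
- by rewrite (_ : Ordinal _ = o2)//; exact: val_inj.
- by rewrite (_ : Ordinal _ = o3)//; exact: val_inj.
Qed.

Lemma sum_I4 (V : nmodType) (F : 'I_4 -> V) :
  \sum_e F e = F o0 + (F o1 + (F o2 + F o3)).
Proof. by rewrite !big_ord_recl big_ord0 addr0. Qed.

Lemma mulmxzE m n (A : 'M[int]_(m, n)) (k : int) i j : (A *~ k) i j = k * A i j.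
Proof.
case: k => k; first by rewrite -pmulrn mulmxnE -mulr_natl natz.
by rewrite NegzE mulrNz -pmulrn mxE mulmxnE -mulr_natl natz mulNr.
Qed.

Section Configurations.
Implicit Types b c : int.

Definition config_vec b c (e : 'I_4) : 'cV[int]_3 :=
  \col_i nth 0 (nth [::] [:: [:: 1; b; c; - (1 + b + c)];
                            [:: 0; 5; 0; -5];
                            [:: 0; 0; 5; -5]] i) e.

Definition config_phi b c (e : 'I_4) : 'F_5 :=
  (nth 0 [:: 1; b; c; - (1 + b + c)] e)%:~R.

Lemma lincomb_config b c (d : 'I_4 -> int) : lincomb (config_vec b c) d =
  \col_i nth 0 [:: d o0 + b * d o1 + c * d o2 - (1 + b + c) * d o3;
                   5 * (d o1 - d o3); 5 * (d o2 - d o3)] i.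
Proof.
apply/colP => i; rewrite /lincomb sum_I4 !mxE !mulmxzE !mxE /=.
by case: i => -[|[|[|//]]] /= _; ring.
Qed.

Lemma config_phi_sum b c (d : 'I_4 -> int) : \sum_e config_phi b c e * (d e)%:~R =
  (d o0 + b * d o1 + c * d o2 - (1 + b + c) * d o3)%:~R.
Proof. by rewrite sum_I4 /config_phi /= -!rmorphM -!rmorphD /=; congr (_ %:~R); ring. Qed.

(** Divisibility by 5 of a combination of the columns is a condition on the first row only,
    which is [phi] modulo 5. *)
Lemma config_good b c :
  [&& b%:~R != 0 :> 'F_5, c%:~R != 0 :> 'F_5 & (1 + b + c)%:~R != 0 :> 'F_5] ->
  good (config_vec b c) (config_phi b c).
Proof.
move=> /and3P[b0 c0 d0]; split.
- move=> g n n0 /colP gn; apply/colP => i; have /eqP := gn i.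
  by rewrite mulmxzE !mxE mulf_eq0 (negPf n0) /= => /eqP.
- have -> : \sum_e config_vec b c e = lincomb (config_vec b c) (fun=> 1) by [].
  rewrite lincomb_config; apply/colP => i; rewrite !mxE.
  by case: i => -[|[|[|//]]] /= _; ring.
- move=> d; rewrite lincomb_config => /colP dE.
  have := dE ord0; have := dE (lift ord0 ord0); have := dE ord_max.
  rewrite !mxE /= => d2 d1 d0'.
  have e2 : d o2 = d o3 by lia.
  have e1 : d o1 = d o3 by lia.
  have e0 : d o0 = d o3 by move: d0'; rewrite e1 e2; nia.
  suff e : forall i, d i = d o3 by move=> i j; rewrite !e.
  by apply: I4_ind.
- by apply: I4_ind; rewrite /config_phi //= rmorphN oppr_eq0.
- move=> d; rewrite config_phi_sum lincomb_config; split=> [[g /colP/(_ ord0)]|/eqP].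
    rewrite mulmxzE !mxE /= => <-; apply/eqP; rewrite F5_intr_eq0.
    exact: dvdz_mulr.
  rewrite F5_intr_eq0 => /dvdzP[q qE].
  exists (\col_i nth 0 [:: q; d o1 - d o3; d o2 - d o3] i).
  apply/colP => i; rewrite mulmxzE !mxE.
  by case: i => -[|[|[|//]]] //= _; rewrite qE mulrC.
- move=> g.
  exists (fun e : 'I_4 => nth 0 [:: 5 * g ord0 0 - b * g (lift ord0 ord0) 0 - c * g ord_max 0;
     g (lift ord0 ord0) 0; g ord_max 0; 0] e).
  rewrite lincomb_config; apply/colP => i; rewrite mulmxzE !mxE /=.
  case: i => -[|[|[|//]]] //= lt3; rewrite ?subr0 ?mulr0.
  + by rewrite (_ : Ordinal lt3 = ord0); [ring|exact: val_inj].
  + by congr (_ * g _ _); exact: val_inj.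
  + by congr (_ * g _ _); exact: val_inj.
Qed.

Lemma matrixA_good : good (fun j : 'I_4 => col j matrixA) (config_phi 1 1).
Proof.
rewrite (_ : (fun j => _) = config_vec 1 1); first exact: config_good.
apply/funext => j; apply/colP => i; rewrite !mxE.
by case: i => -[|[|[|//]]] //= _; move: j; apply: I4_ind.
Qed.

Lemma config_fg : finitely_generated 'cV[int]_3.
Proof.
exists 3, (fun i => delta_mx i 0) => x; apply/zspanP; exists (fun i => x i 0).
apply/colP => i; rewrite summxE (bigD1 i) ?inE//= big1 => [|j /andP[_ ji]].
  by rewrite addr0 mulmxzE !mxE !eqxx mulr1.
by rewrite mulmxzE !mxE eq_sym (negPf ji) mulr0.
Qed.

End Configurations.

(** The rank and the multiplicity of a subset are given by its cardinality. *)
Lemma good_arith_matroid (G : zmodType) (v : 'I_4 -> G) phi : good v phi ->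
  arith_matroid_of v = arith_matroidA.
Proof.
move=> gv.
have eqM (M N : arith_matroid 'I_4) :
    am_rk M =1 am_rk N -> am_mult M =1 am_mult N -> M = N.
  by case: M N => [r m] [r' m'] /= /funext -> /funext ->.
apply: eqM => X; first by rewrite (good_rk gv) (good_rk matrixA_good).
by rewrite (good_mult gv) (good_mult matrixA_good).
Qed.

Section GoodIso.
Context (G H : zmodType) (v : 'I_4 -> G) (w : 'I_4 -> H) (phi : 'I_4 -> 'F_5).
Hypotheses (gv : good v phi) (gw : good w phi).

(** By [good_div], the combinations that are divisible by 5 are the same in both groups. *)
Lemma good_lift (g : G) : exists h : H, forall c, g *~ 5 = lincomb v c -> h *~ 5 = lincomb w c.
Proof.
have [h hE] := (good_div gw _).2 (good_orth gv (kapE gv g)).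
exists h => c gc; rewrite hE -(good_shift gw _ (kap gv g o0 - c o0)).
apply: eq_bigr => e _; congr (_ *~ _).
have := good_eq gv (etrans (esym (kapE gv g)) gc) e o0 => <-.
by rewrite opprB addrC subrK.
Qed.

Lemma good_iso : exists f : {additive G -> H}, bijective f /\ forall e, f (v e) = w e.
Proof.
have [f fE] := choice good_lift.
have fB : zmod_morphism f.
  move=> g h; apply: (good_inj gw (n := 5)) => //.
  rewrite mulrzBl (fE g _ (kapE gv g)) (fE h _ (kapE gv h)) -lincombB.
  by apply: fE; rewrite lincombB mulrzBl -!(kapE gv).
pose fA : {additive G -> H} := HB.pack f (GRing.isZmodMorphism.Build _ _ f fB).
exists fA; split; last first.
  move=> e; apply: (good_inj gw (n := 5)) => //.
  rewrite -(lincomb_gen w) -lincombZ; apply: fE.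
  by rewrite lincombZ lincomb_gen.
apply: inj_surj_bijective => [g h /= fgh|h].
  apply: (good_inj gv (n := 5)) => //.
  have := fE g _ (kapE gv g); rewrite fgh (fE h _ (kapE gv h)) => /(good_eq gw) kE.
  rewrite !(kapE gv) -[RHS](good_shift gv _ (kap gv h o0 - kap gv g o0)).
  apply: eq_bigr => e _; congr (_ *~ _).
  by rewrite -(kE e o0) opprB addrC subrK.
have [g gE] := (good_div gv _).2 (good_orth gw (kapE gw h)).
exists g; apply: (good_inj gw (n := 5)) => //=.
by rewrite (fE _ _ gE) -(kapE gw).
Qed.

End GoodIso.

Section SpanAndMultiplicity.
Context (E : finType) (G : zmodType).
Implicit Types (v : E -> G).
Local Open Scope classical_set_scope.

Lemma zspan1P v e g : reflect (exists n : int, g = v e *~ n) (g \in zspan v [set e]%SET).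
Proof.
apply: (iffP (zspanP _ _ _)) => [[c ->]|[n ->]]; first by exists (c e); rewrite big_set1.
by exists (fun=> n); rewrite big_set1.
Qed.

Lemma zspan_sign v (eps : E -> int) X : (forall e, eps e * eps e = 1) ->
  zspan (fun e => v e *~ eps e) X =i zspan v X.
Proof.
move=> eps2 g; apply/zspanP/zspanP => -[c ->]; exists (fun e => eps e * c e).
  by apply: eq_bigr => e _; rewrite mulrzA.
by apply: eq_bigr => e _; rewrite -mulrzA mulrA eps2 mul1r.
Qed.

(** The quotients of the common saturation by the two spans have the same finite order, so
    the surjection between them is injective. *)
Lemma am_mult_zspan v (X Y : {set E}) n : (0 < n)%N -> X \subset Y -> sat v X = sat v Y ->
  am_mult (arith_matroid_of v) X = n -> am_mult (arith_matroid_of v) Y = n ->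
  forall g, g \in zspan v Y -> g \in zspan v X.
Proof.
move=> n0 XY satXY /(am_mult_gt0 n0)[r [rsat rinj rsurj]].
move=> /(am_mult_gt0 n0)[s [ssat sinj ssurj]] g gY.
have /choice[f fP] : forall i, exists j, s i - r j \in zspan v X.
  by move=> i; apply: rsurj; rewrite satXY; exact: ssat.
have finj : injective f.
  move=> i j fij; apply: sinj; apply: (zspan_mono XY).
  rewrite (_ : s i - s j = (s i - r (f i)) - (s j - r (f j))); first by rewrite rpredB.
  by rewrite fij opprB addrA subrK.
have covers h : sat v X h -> exists i, h - s i \in zspan v X.
  move=> /rsurj[j hj]; exists (invF finj j).
  have := fP (invF finj j); rewrite f_invF => sj.
  by rewrite -[h](subrK (r j)) -addrA rpredD// -opprB rpredN.
have gsat : sat v X g by rewrite satXY; exists 1%N.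
have [i gi] := covers _ gsat.
have [|j j0] := covers 0; first by exists 1%N => //; rewrite mulr1n rpred0.
suff ij : i = j by move: j0; rewrite -ij sub0r rpredN => si; rewrite -[g](subrK (s i)) rpredD.
apply: sinj; have -> : s i - s j = (0 - s j) - (g - s i) + g by rewrite sub0r opprB addrA subrK addrC.
by rewrite rpredD// rpredB// (zspan_mono XY).
Qed.

(** The order of a finite group kills its elements: translation by [g] permutes the classes of
    the transversal, and the sum of all classes is unchanged. *)
Lemma am_mult_expn v (X : {set E}) n : (0 < n)%N -> am_mult (arith_matroid_of v) X = n ->
  forall g, sat v X g -> g *+ n \in zspan v X.
Proof.
move=> n0 /(am_mult_gt0 n0)[r [rsat rinj rsurj]] g gX.
have /choice[f fP] : forall i, exists j, r i + g - r j \in zspan v X.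
  move=> i; apply: rsurj; rewrite -[g]opprK; apply: sat_sub => //.
  by have [m m0 gm] := gX; exists m; rewrite // mulNrn rpredN.
have finj : injective f.
  move=> i j fij; apply: rinj.
  rewrite (_ : r i - r j = (r i + g - r (f i)) - (r j + g - r (f j))); first by rewrite rpredB.
  by rewrite fij opprB addrA subrK opprD addrACA subrr addr0.
have : \sum_i (r i + g - r (f i)) \in zspan v X by apply: rpred_sum => i _; exact: fP.
have rf : \sum_i r (f i) = \sum_i r i by rewrite [RHS](reindex_inj finj).
by rewrite sumrB big_split /= rf sumr_const card_ord addrAC subrr add0r.
Qed.

End SpanAndMultiplicity.

(** * Essential representations are good configurations up to signs *)

Section EssentialRepresentation.
Context (G : zmodType) (v : 'I_4 -> G).
Hypotheses (vM : arith_matroid_of v = arith_matroidA) (vG : zrank [set: G]%classic = 3%N).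
Implicit Types (c d : 'I_4 -> int) (g : G) (X : {set 'I_4}).

Lemma rep_rk X : zrank [set` zspan v X]%classic = minn #|X| 3.
Proof. by rewrite -[LHS]/(am_rk (arith_matroid_of v) X) vM (good_rk matrixA_good). Qed.

Lemma rep_mult X : am_mult (arith_matroid_of v) X =
  if #|X| == 0%N then 1%N else (5 ^ (minn #|X| 3).-1)%N.
Proof. by rewrite vM (good_mult matrixA_good). Qed.

(** The multiplicities of the empty set and of the singletons are 1. *)
Lemma rep_sat_small X g : (#|X| <= 1)%N -> sat v X g -> g \in zspan v X.
Proof.
move=> X1 gX; rewrite -[g]mulr1n; apply: am_mult_expn gX => //.
by rewrite rep_mult; case: #|X| X1 => [|[]].
Qed.

Lemma satZ X g (n : int) : n != 0 -> g *~ n \in zspan v X -> sat v X g.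
Proof.
case: n => n n0 gn; first by exists n; rewrite // lt0n.
by exists n.+1 => //; move: gn; rewrite NegzE mulrNz rpredN.
Qed.

(** A torsion element lies in the saturation of the trivial group, whose multiplicity
    is 1. *)
Lemma rep_tf g (n : int) : n != 0 -> g *~ n = 0 -> g = 0.
Proof.
move=> n0 gn.
have /zspanP[c ->] : g \in zspan v (finset.set0 : {set 'I_4}).
  apply: rep_sat_small; first by rewrite cards0.
  by apply: (satZ n0); rewrite gn rpred0.
by rewrite big_set0.
Qed.

Lemma rep_indep l c : lincomb v c = 0 -> c l = 0 -> forall e, c e = 0.
Proof.
move=> cv cl e; have [->//|el] := eqVneq e l.
apply: (zrank_indep (X := [set~ l])) => //; last by rewrite !inE.
  by apply: etrans (rep_rk _) _; rewrite cardsC1 card_ord.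
rewrite -lincomb_set// => a; rewrite !inE negbK => /eqP -> //.
Qed.

(** Three of the vectors are independent and the rank of [G] is 3, so every element
    satisfies a relation with them. *)
Lemma rep_satT l g : sat v [set~ l] g.
Proof.
have [_ le3] := zrank_gt0 (isT : (0 < 3)%N) vG.
have /existsNP[c /not_implyP[c0 /existsNP[i ci]]] :
    ~ zindep (fun e : 'I_4 => if e == l then g else v e).
  by move=> xind; have := le3 4; apply/not_implyP; split=> //; exists (fun e => if e == l then g else v e).
pose d e := if e == l then 0 else c e.
have rel : g *~ c l = - lincomb v d.
  apply/eqP; rewrite -addr_eq0 -c0 (bigD1 l)//= eqxx; apply/eqP.
  congr (_ + _); rewrite /lincomb (bigD1 l)//= /d eqxx mulr0z add0r.
  by apply: eq_bigr => e /negPf->.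
have cl : c l != 0.
  apply/eqP => cl; apply: ci.
  have /(rep_indep (l := l)) : lincomb v d = 0.
    by apply/eqP; rewrite -oppr_eq0 -rel cl mulr0z.
  by rewrite /d eqxx => /(_ erefl i); case: eqP => [->|].
apply: (satZ cl); rewrite rel rpredN; apply/zspan_lincombP; exists d => // e.
by rewrite !inE negbK /d => ->.
Qed.

(** Removing a vector changes neither the multiplicity nor the saturation, so it
    does not change the span. *)
Lemma rep_unit_relation l : exists2 d, lincomb v d = 0 & d l = 1.
Proof.
(* For three and for four vectors the multiplicity is 25. *)
have satE : sat v [set~ l] = sat v [set: 'I_4]%SET.
  apply/seteqP; split=> g [n n0 gn]; last by exact: rep_satT.
  by exists n => //; apply: zspan_mono gn; exact: finset.subsetT.
have /zspan_lincombP[c c0 vl] : v l \in zspan v [set~ l].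
  apply: (am_mult_zspan (n := 25) _ _ satE) => //.
  - by rewrite rep_mult cardsC1 card_ord.
  - by rewrite rep_mult cardsT card_ord.
  - by rewrite zspan_gen.
exists (fun e => (e == l)%:Z - c e).
  by rewrite lincombB lincomb_gen -vl subrr.
by rewrite eqxx c0 ?subr0// !inE negbK.
Qed.

(** All relations are proportional, and for every index there is one with
    coefficient 1, so the coefficients of a primitive relation are signs. *)
Lemma rep_signs : exists2 eps, (forall e, eps e * eps e = 1) & lincomb v eps = 0.
Proof.
have [d dv d0] := rep_unit_relation o0; exists d => // l.
have [d' d'v d'l] := rep_unit_relation l.
have prop e : d e * d' o0 - d' e = 0.
  apply: (rep_indep (l := o0) (c := fun e => d e * d' o0 - d' e)).
    by rewrite lincombB lincombZ dv d'v mul0rz subrr.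
  by rewrite d0 mul1r subrr.
have := prop l; rewrite d'l => /eqP; rewrite subr_eq0 => /eqP dd'.
have : (d l %| 1)%Z by apply/dvdzP; exists (d' o0); rewrite mulrC dd'.
rewrite dvdz1 => dl1.
have [->|->] : d l = 1 \/ d l = -1 by lia.
  by [].
by [].
Qed.

Section Signed.
Variable eps : 'I_4 -> int.
Hypotheses (eps2 : forall e, eps e * eps e = 1) (eps_rel : lincomb v eps = 0).
Let u e : G := v e *~ eps e.

Lemma signed_sum : \sum_e u e = 0. Proof. exact: eps_rel. Qed.

Lemma signed_shift c (n : int) : lincomb u (fun e => c e - n) = lincomb u c.
Proof.
by rewrite lincombB [X in _ - X]/lincomb -mulrz_suml signed_sum mul0rz subr0.
Qed.

Lemma signed_rel c : lincomb u c = 0 -> forall i j, c i = c j.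
Proof.
move=> cu; suff h i : c i = c o0 by move=> i j; rewrite !h.
have e0 : (c i - c o0) * eps i = 0.
  apply: (rep_indep (l := o0) (c := fun e => (c e - c o0) * eps e)); last first.
    by rewrite subrr mul0r.
  rewrite -[RHS]cu -(signed_shift c (c o0)).
  by apply: eq_bigr => e _; rewrite mulrC mulrzA.
by apply/eqP; rewrite -subr_eq0 -[_ - _]mulr1 -(eps2 i) mulrA e0 mul0r.
Qed.

(** The subgroup spanned by [u e] is saturated and [u e] has infinite order. *)
Lemma signed_sat1 e g (n : int) : g *~ 5 = u e *~ n -> exists k, n = k * 5 /\ g = u e *~ k.
Proof.
move=> gn; have : g \in zspan v [set e]%SET.
  apply: rep_sat_small; first by rewrite cards1.
  apply: (@satZ _ _ 5) => //; rewrite -(zspan_sign _ _ eps2) gn.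
  by apply/zspan1P; exists n.
rewrite -(zspan_sign _ _ eps2) => /zspan1P[k gk]; exists k; split=> //.
apply/eqP; rewrite -subr_eq0; apply/eqP.
have [l le] : exists l : 'I_4, l != e.
  by exists (if e == o0 then o1 else o0); case: (eqVneq e o0) => [->|]; rewrite // eq_sym.
have := signed_rel (c := fun a => (a == e)%:Z * (n - k * 5)).
rewrite lincombZ lincomb_gen mulrzBr mulrzA -[v e *~ eps e *~ k]gk -gn subrr.
by move=> /(_ erefl e l); rewrite eqxx (negPf le) mul1r mul0r.
Qed.

(** The multiplicity 5 of a pair provides an element [g] of the saturation outside the
    span.  If one of the coefficients of [5 g] were divisible by 5, then so would be the
    other one, and [g] would lie in the span. *)
Lemma signed_pair j : j != o0 -> exists g (a b : int),
  [/\ g *~ 5 = u o0 *~ a + u j *~ b, a%:~R != 0 :> 'F_5 & b%:~R != 0 :> 'F_5].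
Proof.
move=> j0; pose X : {set 'I_4} := [set o0; j]%SET.
have mX : am_mult (arith_matroid_of v) X = 5%N by rewrite rep_mult cards2 (eq_sym o0) j0.
have [r [rsat rinj _]] := am_mult_gt0 (isT : (0 < 5)%N) mX.
pose g := r (inord 0) - r (inord 1).
have gX : g \notin zspan v X.
  apply/negP => /rinj/(congr1 val) /=; rewrite !inordK//.
have gsat : sat v X g by exact: sat_sub.
have /zspanP[c gc] : g *+ 5 \in zspan (fun e => v e *~ eps e) X.
  by rewrite zspan_sign//; exact: am_mult_expn gsat.
have gE : g *~ 5 = u o0 *~ c o0 + u j *~ c j.
  by rewrite -pmulrn gc (big_setD1 o0) ?inE ?eqxx//= setU1K ?inE 1?eq_sym// big_set1.
exists g, (c o0), (c j); split=> //; rewrite F5_intr_eq0; apply: contra gX => /dvdzP[k ck].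
  have /signed_sat1[m [_ gm]] : (g - u o0 *~ k) *~ 5 = u j *~ c j.
    by rewrite mulrzBl -mulrzA -ck gE addrC addKr.
  rewrite -(zspan_sign _ _ eps2) -[g](subrK (u o0 *~ k)) gm.
  by rewrite rpredD// rpredMz// zspan_gen// !inE eqxx ?orbT.
have /signed_sat1[m [_ gm]] : (g - u j *~ k) *~ 5 = u o0 *~ c o0.
  by rewrite mulrzBl -mulrzA -ck gE addrK.
rewrite -(zspan_sign _ _ eps2) -[g](subrK (u j *~ k)) gm.
by rewrite rpredD// rpredMz// zspan_gen// !inE eqxx ?orbT.
Qed.

(** The pairs containing the first index give elements [x1], [x2] with
    [5 x1 = a1 u0 + b1 u1] and [5 x2 = a2 u0 + b2 u2], hence a candidate [phi].
    The 25 combinations of [x1] and [x2] are distinct modulo the span, whose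
    multiplicity is 25, so they represent all classes. *)
Lemma signed_good : exists2 phi, phi o0 = 1 & good u phi.
Proof.
have [x1 [a1 [b1 [x1E a10 b10]]]] := signed_pair (isT : o1 != o0).
have [x2 [a2 [b2 [x2E a20 b20]]]] := signed_pair (isT : o2 != o0).
(* The coefficients of [5 x1] and [5 x2] are orthogonal to [phi]. *)
pose p1 : 'F_5 := - (a1%:~R / b1%:~R); pose p2 : 'F_5 := - (a2%:~R / b2%:~R).
pose phi (e : 'I_4) : 'F_5 := nth 0 [:: 1; p1; p2; - (1 + p1 + p2)] e.
have phiE c : \sum_e phi e * (c e)%:~R =
    (c o0 - c o3)%:~R + p1 * (c o1 - c o3)%:~R + p2 * (c o2 - c o3)%:~R.
  by rewrite sum_I4 /phi /= !rmorphB /=; ring.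
pose T (k0 k1 k2 : int) : G := u o0 *~ k0 + u o1 *~ k1 + u o2 *~ k2.
have TD k0 k1 k2 m0 m1 m2 : T k0 k1 k2 + T m0 m1 m2 = T (k0 + m0) (k1 + m1) (k2 + m2).
  by rewrite /T !mulrzDr addrACA; congr (_ + _); rewrite addrACA.
have TZ k0 k1 k2 m : T k0 k1 k2 *~ m = T (k0 * m) (k1 * m) (k2 * m).
  by rewrite /T !mulrzDl !mulrzA.
have T0 m : u o0 *~ m = T m 0 0 by rewrite /T !mulr0z !addr0.
have T1 m : u o1 *~ m = T 0 m 0 by rewrite /T !mulr0z addr0 add0r.
have T2 m : u o2 *~ m = T 0 0 m by rewrite /T !mulr0z !add0r.
have linT c : lincomb u c = T (c o0 - c o3) (c o1 - c o3) (c o2 - c o3).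
  by rewrite -(signed_shift c (c o3)) /lincomb sum_I4 subrr mulr0z addr0 addrA.
have Tinj k0 k1 k2 m : T k0 k1 k2 = u o0 *~ m -> [/\ k0 = m, k1 = 0 & k2 = 0].
  move=> E; have R := signed_rel (c := fun e : 'I_4 => nth 0 [:: k0 - m; k1; k2; 0] e).
  have /R R' : lincomb u (fun e : 'I_4 => nth 0 [:: k0 - m; k1; k2; 0] e) = 0.
    rewrite linT /= !subr0; transitivity (T k0 k1 k2 - u o0 *~ m); last by rewrite E subrr.
    by rewrite -mulrNz T0 TD !addr0.
  have /= := R' o0 o3; have /= := R' o1 o3; have /= := R' o2 o3.
  by move=> -> -> /eqP; rewrite subr_eq0 => /eqP->.
rewrite T0 T1 in x1E; rewrite T0 T2 in x2E; rewrite !TD !addr0 ?add0r in x1E x2E.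
have red c : exists g (m : int), lincomb u c = g *~ 5 + u o0 *~ m /\
    m%:~R = \sum_e phi e * (c e)%:~R.
  set c0 := c o0 - c o3; set c1 := c o1 - c o3; set c2 := c o2 - c o3.
  pose n1 : int := val (c1%:~R / b1%:~R : 'F_5); pose n2 : int := val (c2%:~R / b2%:~R : 'F_5).
  have n1E : n1%:~R = c1%:~R / b1%:~R :> 'F_5 by exact: F5_lift.
  have n2E : n2%:~R = c2%:~R / b2%:~R :> 'F_5 by exact: F5_lift.
  have /dvdzP[k1 k1E] : (5 %| c1 - n1 * b1)%Z.
    by rewrite -F5_intr_eq0 rmorphB rmorphM /= n1E divfK// subrr.
  have /dvdzP[k2 k2E] : (5 %| c2 - n2 * b2)%Z.
    by rewrite -F5_intr_eq0 rmorphB rmorphM /= n2E divfK// subrr.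
  exists (x1 *~ n1 + x2 *~ n2 + u o1 *~ k1 + u o2 *~ k2), (c0 - n1 * a1 - n2 * a2).
  split; last first.
    rewrite phiE !rmorphB !rmorphM /= n1E n2E /c0 /c1 /c2 /p1 /p2 !rmorphB /=; field; exact/andP.
  rewrite linT -/c0 -/c1 -/c2 !mulrzDl [x1 *~ _ *~ _]mulrzAC [x2 *~ _ *~ _]mulrzAC x1E x2E.
  rewrite T0 T1 T2 !TZ !TD; congr (T _ _ _); lia.
have phi_div c : (exists g : G, g *~ 5 = lincomb u c) <-> \sum_e phi e * (c e)%:~R = 0.
  have [g [m [cE <-]]] := red c.
  split=> [[h hc]|/eqP]; last first.
    rewrite F5_intr_eq0 => /dvdzP[k mk]; exists (g + u o0 *~ k).
    by rewrite mulrzDl -mulrzA -mk -cE.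
  have /signed_sat1[k [-> _]] : (h - g) *~ 5 = u o0 *~ m by rewrite mulrzBl hc cE addrAC subrr add0r.
  by apply/eqP; rewrite F5_intr_eq0 dvdz_mull.
exists phi => //; split=> //; [exact: rep_tf|exact: signed_rel| |].
- move=> e; apply/eqP => pe.
  have [g] : exists g : G, g *~ 5 = lincomb u (fun a => (a == e)%:Z).
    apply/phi_div; rewrite (bigD1 e)//= pe mul0r add0r big1// => a /negPf->.
    by rewrite mulr0.
  by rewrite lincomb_gen -[u e]mulr1z => /signed_sat1[k [k5 _]]; lia.
- pose y (ij : 'F_5 * 'F_5) : G := x1 *~ val ij.1 + x2 *~ val ij.2.
  have yE ij : y ij *~ 5 = T (a1 * val ij.1 + a2 * val ij.2) (b1 * val ij.1) (b2 * val ij.2).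
    rewrite mulrzDl [x1 *~ _ *~ _]mulrzAC [x2 *~ _ *~ _]mulrzAC x1E x2E !TZ TD.
    by rewrite !mul0r addr0 add0r.
  pose E4 := [set: 'I_4]%SET.
  have [r [_ _ rsurj]] : exists r : 'I_25 -> G, [/\ forall i, sat v E4 (r i),
      forall i j, r i - r j \in zspan v E4 -> i = j & forall g, sat v E4 g -> exists i, g - r i \in zspan v E4].
    by apply: am_mult_gt0 => //; rewrite rep_mult cardsT card_ord.
  have satT g : sat v E4 g.
    by have [n n0 gn] := rep_satT o0 g; exists n => //; apply: zspan_mono gn; exact: finset.subsetT.
  have /choice[f fP] : forall ij, exists k, y ij - r k \in zspan v E4 by move=> ij; exact: rsurj.
  have finj : injective f.
    move=> p q fpq.
    have : y p - y q \in zspan u E4.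
      rewrite zspan_sign// (_ : y p - y q = (y p - r (f p)) - (y q - r (f q))); first by rewrite rpredB.
      by rewrite fpq opprB addrA subrK.
    move=> /zspan_lincombP[c _ yc].
    have : y p *~ 5 - y q *~ 5 = lincomb u c *~ 5 by rewrite -mulrzBl yc.
    rewrite !yE linT TZ -mulrN1z TZ TD => /eqP; rewrite -subr_eq0 -mulrN1z TZ TD => /eqP.
    rewrite -[RHS](mulr0z (u o0)) => /Tinj[_ e1 e2].
    have F5_eq (x y' : 'F_5) (b k : int) : b%:~R != 0 :> 'F_5 ->
        b * val x + b * val y' * -1 + k * 5 * -1 = 0 -> x = y'.
      move=> b0 E; have /(mulfI b0) : b%:~R * ((val x)%:Z)%:~R = b%:~R * ((val y')%:Z)%:~R :> 'F_5.
        apply/eqP; rewrite -subr_eq0 -!rmorphM -rmorphB /= F5_intr_eq0.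
        by apply/dvdzP; exists k; move: E; rewrite !mulrN1 => /eqP; rewrite subr_eq0 => /eqP.
      by rewrite !F5_lift.
    by apply/pair_eqP; rewrite /pair_eq /= (F5_eq _ _ _ _ b10 e1) (F5_eq _ _ _ _ b20 e2) !eqxx.
  have [f' ff'] : exists f', cancel f' f.
    by have [|f' _ ff'] := inj_card_bij finj; [rewrite card_prod !card_Fp// card_ord|exists f'].
  move=> g; have [k gk] := rsurj g (satT g).
  have : g - y (f' k) \in zspan u E4.
    rewrite zspan_sign// (_ : g - _ = (g - r k) - (y (f' k) - r k)); last by rewrite opprB addrA subrK.
    by rewrite rpredB// -{2}(ff' k).
  move=> /zspan_lincombP[c _ gc].
  have -> : g *~ 5 = lincomb u c *~ 5 + y (f' k) *~ 5 by rewrite -gc -mulrzDl subrK.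
  exists (fun e => c e * 5 + nth 0 [:: a1 * val (f' k).1 + a2 * val (f' k).2;
                        b1 * val (f' k).1; b2 * val (f' k).2; 0] e).
  by rewrite lincombD lincombZ yE; congr (_ + _); rewrite linT /= !subr0.
Qed.

End Signed.

Lemma essential_good : exists2 eps, (forall e, eps e * eps e = 1) &
  exists2 phi, phi o0 = 1 & good (fun e => v e *~ eps e) phi.
Proof. by have [eps eps2 eps_rel] := rep_signs; exists eps => //; exact: signed_good. Qed.

End EssentialRepresentation.

(** * The thirteen equivalence classes *)

Section EquivalentGood.
Context (G H : zmodType) (v : 'I_4 -> G) (w : 'I_4 -> H) (phi psi : 'I_4 -> 'F_5).
Hypotheses (gv : good v phi) (gw : good w psi).
Local Open Scope classical_set_scope.

Lemma good_gen_neq0 e n : w e *~ n = 0 -> n = 0.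
Proof.
have [l le] : exists l : 'I_4, l != e.
  by exists (if e == o0 then o1 else o0); case: (eqVneq e o0) => [->|]; rewrite // eq_sym.
move=> wn; have := good_rel gw (c := fun a => (a == e)%:Z * n).
by rewrite lincombZ lincomb_gen wn => /(_ erefl e l); rewrite eqxx (negPf le) mul1r mul0r.
Qed.

(** An equivalence sends each vector to plus or minus its counterpart, with the same sign
    throughout, because the vectors sum up to 0.  It preserves divisibility by 5, and hence
    the hyperplane orthogonal to [phi]. *)
Lemma equivalent_phi (f : {additive G -> H}) :
  (forall e, f @` [set` zspan v [set e]%SET] = [set` zspan w [set e]%SET]) ->
  phi o0 = 1 -> psi o0 = 1 -> phi =1 psi.
Proof.
move=> fvw phi0 psi0.
have /choice[n nE] : forall e, exists n : int, f (v e) = w e *~ n.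
  move=> e; apply/zspan1P.
  have : [set` zspan w [set e]%SET] (f (v e)).
    by rewrite -fvw; exists (v e) => //=; apply/zspan1P; exists 1.
  by [].
have n1 e : exists m, n e * m = 1.
  have : (f @` [set` zspan v [set e]%SET]) (w e).
    by rewrite fvw /=; apply/zspan1P; exists 1.
  move=> [_ /= /zspan1P[m ->] fm]; exists m.
  apply/eqP; rewrite -subr_eq0; apply/eqP/(@good_gen_neq0 e).
  by rewrite mulrzBr mulrzA -nE -raddfMz fm subrr.
have nn e : n e = n o0.
  apply: (good_rel gw); rewrite -[RHS](raddf0 f) -(good_sum gv) raddf_sum.
  by apply: eq_bigr => a _; rewrite nE.
have n0 : (n o0)%:~R != 0 :> 'F_5.
  have [m nm] := n1 o0; apply/eqP => n0.
  have /eqP : (n o0 * m)%:~R = 1 :> 'F_5 by rewrite nm.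
  by rewrite rmorphM /= n0 mul0r eq_sym oner_eq0.
have transfer c : \sum_e phi e * (c e)%:~R = 0 -> \sum_e psi e * (c e)%:~R = 0.
  move=> /(good_div gv)[g gc].
  have : f g *~ 5 = lincomb w (fun e => c e * n o0).
    rewrite -raddfMz gc raddf_sum; apply: eq_bigr => e _.
    by rewrite /= raddfMz nE nn -mulrzA mulrC.
  move=> /(good_orth gw) h; apply: (mulIf n0); rewrite mul0r mulr_suml -[RHS]h.
  by apply: eq_bigr => e _; rewrite rmorphM mulrA.
move=> e; have [->|e0] := eqVneq e o0; first by rewrite phi0 psi0.
(* These coefficients are orthogonal to [phi] modulo 5. *)
pose c (a : 'I_4) : int := if a == o0 then - (val (phi e))%:Z else (a == e)%:Z.
have cE (chi : 'I_4 -> 'F_5) : chi o0 = 1 -> \sum_a chi a * (c a)%:~R = chi e - phi e.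
  move=> chi0; rewrite (bigD1 o0)//= (bigD1 e)//= big1 => [|a /andP[a0 ae]].
    by rewrite /c eqxx (negPf e0) eqxx chi0 mul1r mulr1 addr0 rmorphN /= F5_lift addrC.
  by rewrite /c (negPf a0) (negPf ae) mulr0.
apply/esym/eqP; rewrite -subr_eq0 -cE//; apply/eqP/transfer.
by rewrite cE// subrr.
Qed.

End EquivalentGood.

(** [phi] is normalised by [phi 0 = 1]; its nonzero entries [b], [c] at 1 and 2 have
    representatives in [1, 4], and the entry at 3 is nonzero unless [b + c = 4]. *)
Definition config_index : seq (nat * nat) :=
  [seq p <- [seq (b, c) | b <- iota 1 4, c <- iota 1 4] | (p.1 + p.2 != 4)%N].

Lemma config_indexP p : p \in config_index ->
  [/\ (0 < p.1 < 5)%N, (0 < p.2 < 5)%N & (p.1 + p.2 != 4)%N].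
Proof.
rewrite mem_filter => /andP[bc /allpairsP[[b c] [b1 c1 pE]]].
by move: b1 c1 bc; rewrite !mem_iota pE.
Qed.

Lemma mem_config_index b c : (0 < b < 5)%N -> (0 < c < 5)%N -> (b + c != 4)%N ->
  (b, c) \in config_index.
Proof.
move=> b5 c5 bc; rewrite mem_filter; apply/andP; split=> //.
by apply/allpairsP; exists (b, c); rewrite !mem_iota.
Qed.

Definition config (p : nat * nat) : vector_config 'I_4 :=
  VectorConfig (config_vec p.1%:Z p.2%:Z) config_fg.

Lemma config_index_good p : p \in config_index ->
  good (@vc_vec _ (config p)) (config_phi p.1%:Z p.2%:Z).
Proof.
case: p => b c /config_indexP[/= b5 c5 bc]; apply: config_good.
by rewrite !F5_intr_eq0; apply/and3P; split; apply/negP => /dvdzP[k]; lia.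
Qed.

Lemma good_essential (s : vector_config 'I_4) phi : good (@vc_vec _ s) phi ->
  essential_representation arith_matroidA s.
Proof.
move=> gs; split; first exact: good_arith_matroid gs.
by rewrite (good_zrankT gs) (good_rk matrixA_good) cardsT card_ord.
Qed.

Lemma essential_signed_good (s : vector_config 'I_4) :
  essential_representation arith_matroidA s ->
  exists2 eps, (forall e, eps e * eps e = 1) &
  exists2 phi, phi o0 = 1 & good (fun e => @vc_vec _ s e *~ eps e) phi.
Proof.
move=> [sM sr]; apply: essential_good => //.
by rewrite sr (good_rk matrixA_good) cardsT card_ord.
Qed.

Lemma config_phi0 b c : config_phi b c o0 = 1. Proof. by []. Qed.

Lemma config_inj p q : p \in config_index -> q \in config_index ->
  equivalent_representations (config p) (config q) -> p = q.
Proof.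
move=> pI qI [f [_ fvw]].
have pq := equivalent_phi (config_index_good pI) (config_index_good qI) fvw
  (config_phi0 _ _) (config_phi0 _ _).
have F5_eq (m n : nat) : (0 < m < 5)%N -> (0 < n < 5)%N ->
    (m%:Z)%:~R = (n%:Z)%:~R :> 'F_5 -> m = n.
  move=> m5 n5 /eqP; rewrite -subr_eq0 -rmorphB /= F5_intr_eq0 => /dvdzP[k].
  lia.
have [p1 p2 _] := config_indexP pI; have [q1 q2 _] := config_indexP qI.
have := pq o1; have := pq o2; rewrite /config_phi /= => /(F5_eq _ _ p2 q2) e2 /(F5_eq _ _ p1 q1) e1.
by case: p q e1 e2 {pI qI fvw pq p1 p2 q1 q2 f} => b c [b' c'] /= -> ->.
Qed.

(** The vector [phi] of an essential representation is that of some configuration, and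
    good configurations with the same [phi] are isomorphic. *)
Lemma config_surj (s : vector_config 'I_4) : essential_representation arith_matroidA s ->
  exists2 p, p \in config_index & equivalent_representations s (config p).
Proof.
move=> /essential_signed_good[eps eps2 [phi phi0 gs]].
have sum0 : \sum_e phi e * (1%:Z)%:~R = 0.
  apply/(good_div gs); exists 0; rewrite mul0rz.
  by rewrite /lincomb -mulrz_suml (good_sum gs) mul0rz.
rewrite sum_I4 !mulr1 phi0 in sum0.
pose p : nat * nat := (val (phi o1), val (phi o2)).
have phiE : phi = config_phi p.1%:Z p.2%:Z.
  apply/funext; apply: I4_ind => //; rewrite /config_phi /= ?F5_lift//.
  rewrite rmorphN !rmorphD /= !F5_lift; apply/eqP; rewrite -addr_eq0 addrC.
  by rewrite -[X in _ == X]sum0 !addrA.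
have val0 (x : 'F_5) : x != 0 -> (0 < val x < 5)%N.
  by move=> x0; rewrite ltn_ord lt0n andbT; apply: contra x0.
have pI : p \in config_index.
  apply: mem_config_index; [exact: val0 (good_phi0 gs _)|exact: val0 (good_phi0 gs _)|].
  apply/eqP => bc; have := good_phi0 gs o3; rewrite phiE /config_phi /= => /negP[].
  rewrite F5_intr_eq0; apply/dvdzP; exists (-1).
  move: bc; rewrite /p /=; move: (nat_of_ord _) (nat_of_ord _) => x y; lia.
have gp := config_index_good pI; rewrite -phiE in gp.
have [f [fbij fE]] := good_iso gs gp.
exists p => //; exists f; split=> // e; apply/seteqP; split=> [_ [g /= + <-]|h /=].
  rewrite -(zspan_sign _ _ eps2) => /zspan1P[n ->]; apply/zspan1P; exists n.
  by rewrite raddfMz fE.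
move=> /zspan1P[n ->]; exists (@vc_vec _ s e *~ eps e *~ n).
  by rewrite /= -(zspan_sign _ _ eps2); apply/zspan1P; exists n.
by rewrite raddfMz fE.
Qed.

Lemma thirteen_classes : exists r : 'I_13 -> vector_config 'I_4,
  [/\ forall i, essential_representation arith_matroidA (r i),
      forall i j, equivalent_representations (r i) (r j) -> i = j &
      forall s, essential_representation arith_matroidA s ->
        exists i, equivalent_representations s (r i)].
Proof.
have rI (i : 'I_13) : nth (0%N, 0%N) config_index i \in config_index by exact: mem_nth.
exists (fun i => config (nth (0%N, 0%N) config_index i)); split.
- by move=> i; apply: good_essential (config_index_good (rI i)).
- move=> i j /(config_inj (rI i) (rI j))/eqP.
  by rewrite nth_uniq// => /eqP/val_inj.
- move=> s /config_surj[p pI sp].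
  have p13 : (index p config_index < 13)%N by rewrite -[13%N]/(size config_index) index_mem.
  by exists (Ordinal p13); rewrite nth_index.
Qed.

(** * A finite model of the arithmetic independence posets *)

(** Labels on [I] are considered modulo constants; they are normalised to vanish at a
    selected element of [I]. *)
Definition sel (I : {set 'I_4}) : 'I_4 := odflt o0 [pick i in I].

Lemma selP (I : {set 'I_4}) i : i \in I -> sel I \in I.
Proof.
by move=> iI; rewrite /sel; case: pickP => [//|/(_ i)]; rewrite iI.
Qed.

Definition model_pred (x : {set 'I_4} * {ffun 'I_4 -> 'F_5}) : bool :=
  (#|x.1| <= 3)%N && (x.2 \in pffun_on 0 (mem (x.1 :\ sel x.1)) predT).

Record model := Model {
  model_val :> {set 'I_4} * {ffun 'I_4 -> 'F_5};
  _ : model_pred model_val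
}.

HB.instance Definition _ := [isSub for model_val].
HB.instance Definition _ := [Finite of model by <:].

Definition supp (x : model) : {set 'I_4} := (val x).1.
Definition label (x : model) : 'I_4 -> 'F_5 := (val x).2.

Definition model_le (x y : model) : bool :=
  (supp x \subset supp y) &&
  [forall i in supp x, label x i == label y i - label y (sel (supp x))].

Lemma supp_le3 x : (#|supp x| <= 3)%N.
Proof. by have /andP[] := valP x. Qed.

Lemma label_out x e : e \notin supp x -> label x e = 0.
Proof.
have /andP[_ /pffun_onP[/supportP h _]] := valP x => eI.
by apply: h; rewrite inE negb_and eI orbT.
Qed.

Lemma label_sel x : label x (sel (supp x)) = 0.
Proof.
have /andP[_ /pffun_onP[/supportP h _]] := valP x.
by apply: h; rewrite !inE eqxx.
Qed.

Lemma model_eq x y : supp x = supp y -> label x =1 label y -> x = y.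
Proof.
move=> sxy lxy; apply: val_inj; move: sxy lxy; rewrite /supp /label.
by case: (val x) (val y) => [I z] [J z'] /= -> /ffunP->.
Qed.

Lemma model_leP x y : reflect (supp x \subset supp y /\
    {in supp x &, forall i j, label x i - label x j = label y i - label y j})
  (model_le x y).
Proof.
apply: (iffP andP) => -[xy h]; split=> //.
  move=> i j ix jx.
  by rewrite (eqP (forall_inP h i ix)) (eqP (forall_inP h j jx)) opprB addrA subrK.
apply/forall_inP => i ix; rewrite -(h i _ ix (selP ix)).
by rewrite label_sel subr0.
Qed.

Lemma model_le_refl : reflexive model_le.
Proof. by move=> x; apply/model_leP. Qed.

Lemma model_le_anti : antisymmetric model_le.
Proof.
move=> x y /andP[/model_leP[xy h] /model_leP[yx _]].
have sxy : supp x = supp y by apply/eqP; rewrite finset.eqEsubset xy.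
apply: model_eq => // e; have [ex|ex] := boolP (e \in supp x).
  by have := h e _ ex (selP ex); rewrite label_sel sxy label_sel !subr0.
by rewrite !label_out -?sxy.
Qed.

Lemma model_le_trans : transitive model_le.
Proof.
move=> y x z /model_leP[xy h] /model_leP[yz k]; apply/model_leP; split.
  exact: fintype.subset_trans xy yz.
by move=> i j ix jx; rewrite h// k// (fintype.subsetP xy).
Qed.

HB.instance Definition _ := Order.Le_isPOrder.Build Order.default_display
  model model_le_refl model_le_anti model_le_trans.

Lemma le_modelP (x y : model) : reflect (supp x \subset supp y /\
    {in supp x &, forall i j, label x i - label x j = label y i - label y j})
  (x <= y)%O.
Proof. exact: model_leP. Qed.

Lemma model_norm_subproof (I : {set 'I_4}) (z : 'I_4 -> 'F_5) : (#|I| <= 3)%N ->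
  model_pred (I, [ffun e => if e \in I then z e - z (sel I) else 0]).
Proof.
move=> I3; apply/andP; split=> //; apply/pffun_onP; split=> //.
apply/supportP => e eI; rewrite ffunE; case: ifP => // iI.
by move: eI; rewrite !inE iI andbT negbK => /eqP ->; exact: subrr.
Qed.

Definition mk (I : {set 'I_4}) (z : 'I_4 -> 'F_5) (I3 : (#|I| <= 3)%N) : model :=
  Model (model_norm_subproof z I3).

Lemma supp_mk (I : {set 'I_4}) z (I3 : (#|I| <= 3)%N) : supp (mk z I3) = I. Proof. by []. Qed.

Lemma label_mk (I : {set 'I_4}) z (I3 : (#|I| <= 3)%N) :
  {in I &, forall i j, label (mk z I3) i - label (mk z I3) j = z i - z j}.
Proof.
move=> i j iI jI; rewrite /label /= !ffunE iI jI opprB addrA subrK //.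
Qed.

Lemma mk_supp x : x = mk (label x) (supp_le3 x).
Proof.
apply: model_eq => // e; rewrite {2}/label /= ffunE label_sel subr0.
by case: ifP => // /negbT /label_out.
Qed.

Lemma mk_le (I J : {set 'I_4}) z y (I3 : (#|I| <= 3)%N) (J3 : (#|J| <= 3)%N) :
  reflect (I \subset J /\ {in I &, forall i j, z i - z j = y i - y j})
          (mk z I3 <= mk y J3)%O.
Proof.
apply: (iffP (le_modelP _ _)); rewrite !supp_mk => -[IJ h]; split=> // i j iI jI;
  have IJ' := fintype.subsetP IJ.
  by rewrite -(label_mk z I3 iI jI) h// label_mk ?IJ'.
by rewrite !label_mk ?IJ'// h.
Qed.

(** * Labels of the components *)

(** A root of [1 + X + X^2 + X^3 + X^4] has order 5, because it is not 1. *)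
Lemma closed_prim5 (F : closedFieldType) : 5%:R != 0 :> F -> exists z : F, 5.-primitive_root z.
Proof.
move=> F5; pose p : {poly F} := \poly_(i < 5) 1.
have /closed_rootP[z /rootP pz] : size p != 1%N by rewrite size_poly_eq ?oner_eq0.
have zE : \sum_(i < 5) z ^+ i = 0.
  rewrite -[RHS]pz horner_poly; apply: eq_bigr => i _; by rewrite mul1r.
have z5 : z ^+ 5 = 1.
  by apply/eqP; rewrite -subr_eq0 subrX1 zE mulr0.
have [m mz m5] := prim_order_exists (isT : (0 < 5)%N) z5.
have [mE|mE] : m = 1%N \/ m = 5%N.
- by move: m5 => /(primeP (isT : prime 5)).2 /orP[]/eqP; [left|right].
- move: mz F5; rewrite mE => /prim_expr_order; rewrite expr1 => z1.
  by move: zE; rewrite z1 (eq_bigr (fun=> 1)) => [|i _];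
    rewrite ?expr1n// sumr_const card_ord => ->; rewrite eqxx.
by exists z; rewrite -mE.
Qed.

Section FifthRoots.
Context (R : realType).

Lemma zeta_subproof : exists z : R[i], 5.-primitive_root z.
Proof. by apply: closed_prim5; rewrite pnatr_eq0. Qed.

Definition zeta : R[i] := projT1 (cid zeta_subproof).
Definition zpow (x : 'F_5) : R[i] := zeta ^+ val x.

Lemma zeta_prim : 5.-primitive_root zeta.
Proof. exact: projT2 (cid zeta_subproof). Qed.

Lemma zpow_nat n : zpow n%:R = zeta ^+ n.
Proof. by rewrite /zpow -[val _]/(nat_of_ord _) val_Fp_nat// (prim_expr_mod zeta_prim). Qed.

Lemma zpowD x y : zpow (x + y) = zpow x * zpow y.
Proof. by rewrite -{1}[x]natr_Zp -{1}[y]natr_Zp -natrD zpow_nat exprD. Qed.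

Lemma zpow0 : zpow 0 = 1. Proof. by []. Qed.

Lemma zpow_neq0 x : zpow x != 0.
Proof.
by apply/eqP => x0; have := zpowD x (- x); rewrite subrr zpow0 x0 mul0r => /eqP; rewrite oner_eq0.
Qed.

Lemma zpowN x : zpow (- x) = (zpow x)^-1.
Proof.
by apply: (mulfI (zpow_neq0 x)); rewrite -zpowD subrr zpow0 mulfV// zpow_neq0.
Qed.

Lemma zpowZ x (n : int) : zpow (x * n%:~R) = zpow x ^ n.
Proof.
have nat_case (k : nat) : zpow (x * k%:R) = zpow x ^+ k.
  by elim: k => [|k IH]; [rewrite mulr0|rewrite -natr1 mulrDr mulr1 zpowD IH exprSr].
case: n => k; first exact: nat_case.
by rewrite NegzE rmorphN /= mulrN zpowN nat_case.
Qed.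

Lemma zpow_inj : injective zpow.
Proof.
move=> x y /eqP; rewrite (eq_prim_root_expr zeta_prim) => /eqP xy; apply: val_inj.
by move: xy; rewrite !modn_small//; exact: ltn_ord.
Qed.

Lemma zpow_root (w : R[i]) : w ^+ 5 = 1 -> exists x, w = zpow x.
Proof.
move=> /(prim_rootP zeta_prim)[i ->].
by exists i.
Qed.

End FifthRoots.

Section ToricComponents.
Local Open Scope classical_set_scope.
Context (R : realType).
Local Notation C := (R[i]^o).
Context (G : zmodType) (v : 'I_4 -> G) (phi : 'I_4 -> 'F_5).
Hypothesis gv : good v phi.
Local Notation cap := (@hypertori_cap R _ G v).
Implicit Types (t : {ptws G -> C}) (I J : {set 'I_4}) (z : 'I_4 -> 'F_5) (c : 'I_4 -> int) (g : G).

Section TorusHom.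
Variable t : {ptws G -> C}.
Hypothesis tT : torus t.

Lemma torus_neq0 g : t g != 0. Proof. exact: tT.1. Qed.
Lemma torusD g h : t (g + h) = t g * t h. Proof. exact: tT.2. Qed.

Lemma torus0 : t 0 = 1.
Proof.
by apply: (mulfI (torus_neq0 0)); rewrite -torusD addr0 mulr1.
Qed.

Lemma torusN g : t (- g) = (t g)^-1.
Proof.
by apply: (mulfI (torus_neq0 g)); rewrite -torusD subrr torus0 mulfV// torus_neq0.
Qed.

Lemma torusZ g (n : int) : t (g *~ n) = t g ^ n.
Proof.
have nat_case k : t (g *+ k) = t g ^+ k.
  by elim: k => [|k IH]; rewrite ?mulr0n ?torus0// mulrS torusD IH exprS.
by case: n => k; rewrite ?NegzE ?mulrNz ?torusN nat_case.
Qed.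

Lemma torus_sum (J : finType) (P : pred J) (F : J -> G) :
  t (\sum_(j | P j) F j) = \prod_(j | P j) t (F j).
Proof. exact: (big_morph t torusD torus0). Qed.

End TorusHom.

Lemma cap_torus I t : cap I t -> torus t. Proof. by case. Qed.

Lemma cap_vec I t e : cap I t -> e \in I -> t (v e) = 1.
Proof. by move=> [_ tI] eI; exact: (tI e eI).2. Qed.

Lemma cap_sub I J : I \subset J -> cap J `<=` cap I.
Proof. by move=> /fintype.subsetP IJ t [tT tJ]; split=> // e /= /IJ eJ; exact: tJ. Qed.

Lemma cap_lincomb I t c : cap I t -> (forall e, e \notin I -> c e = 0) ->
  t (lincomb v c) = 1.
Proof.
move=> tI c0; rewrite torus_sum; last exact: cap_torus tI.
apply: big1 => e _; rewrite torusZ; last exact: cap_torus tI.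
have [eI|eI] := boolP (e \in I); first by rewrite (cap_vec tI)// exp1rz.
by rewrite c0.
Qed.

(** On the saturation of the span of [I], a point [t] of the intersection takes values in the
    fifth roots of unity, which are encoded by [z].  As [c] is orthogonal to [phi], only the
    differences of the values of [z] on [I] matter. *)
Definition labels t I z := forall g c, (forall e, e \notin I -> c e = 0) ->
  g *~ 5 = lincomb v c -> t g = zpow R (\sum_e phi e * (c e)%:~R * z e).

(** The coefficients [c] lift [1 / phi i] at [i] and [- 1 / phi j] at [j]; the value of a
    character at [g] then gives the difference of two labels. *)
Lemma pair_element (i j : 'I_4) : exists g c,
  [/\ g *~ 5 = lincomb v c, forall e, e != i -> e != j -> c e = 0 &
      forall z, \sum_e phi e * (c e)%:~R * z e = z i - z j].
Proof.
pose a (e : 'I_4) : int := val ((phi e)^-1).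
have aE e : (a e)%:~R = (phi e)^-1 :> 'F_5 by exact: F5_lift.
pose c (e : 'I_4) : int := (e == i)%:Z * a i - (e == j)%:Z * a j.
have cE z : \sum_e phi e * (c e)%:~R * z e = z i - z j.
  have d (k : 'I_4) : \sum_e (phi e * ((e == k)%:Z * a k)%:~R * z e) = z k.
    rewrite (bigD1 k)//= eqxx mul1r aE mulfV ?(good_phi0 gv)// mul1r big1 ?addr0// => e /negPf->.
    by rewrite mul0r mulr0 mul0r.
  apply: etrans (congr2 (fun x y => x - y) (d i) (d j)).
  by rewrite -sumrB; apply: eq_bigr => e _; rewrite rmorphB /=; ring.
have [|g gc] := (good_div gv c).2.
  rewrite -[RHS](subrr (1 : 'F_5)) -(cE (fun=> 1)).
  by apply: eq_bigr => e _; rewrite mulr1.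
exists g, c; split=> // e /negPf ei /negPf ej.
by rewrite /c ei ej !mul0r subrr.
Qed.

Lemma labels_inj t I z y : labels t I z -> labels t I y ->
  {in I &, forall i j, z i - z j = y i - y j}.
Proof.
move=> tz ty i j iI jI; have [g [c [gc c0 cE]]] := pair_element i j.
have cI e : e \notin I -> c e = 0.
  by move=> eI; apply: c0; apply: contraNneq eI => ->.
by apply: (@zpow_inj R); rewrite -!cE -(tz g c)// -(ty g c).
Qed.

Lemma labels_shift t I z (k : 'F_5) : labels t I z -> labels t I (fun e => z e - k).
Proof.
move=> tz g c c0 gc; rewrite (tz g c)//; congr (zpow R _).
have k0 : \sum_e phi e * (c e)%:~R * k = 0 by rewrite -mulr_suml (good_orth gv gc) mul0r.
by rewrite -[LHS]subr0 -[X in _ - X]k0 -sumrB; apply: eq_bigr => e _; ring.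
Qed.

Lemma labels_sub t I J z : I \subset J -> labels t J z -> labels t I z.
Proof.
move=> /fintype.subsetP IJ tz g c c0; apply: tz => e eJ.
by apply: c0; apply: contra eJ => /IJ.
Qed.

Lemma labels_eq t I z y : {in I &, forall i j, z i - z j = y i - y j} ->
  labels t I z -> labels t I y.
Proof.
move=> zy tz.
have [I0|[p pI]] := set_0Vmem I.
  move=> g c c0 gc; rewrite (tz g c)//; congr (zpow R _).
  by apply: eq_bigr => e _; rewrite c0 ?mulr0 ?mul0r// I0 inE.
have tz' := labels_shift (z p - y p) tz.
move=> g c c0 gc; rewrite (tz' g c)//; congr (zpow R _); apply: eq_bigr => e _.
have [eI|eI] := boolP (e \in I); last by rewrite c0// mulr0 !mul0r.
by rewrite opprB addrA addrAC (zy e p)// subrK.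
Qed.

(** The values of [t] at the elements of [pair_element] are fifth roots of unity and define
    [z].  A general [g] differs from a combination of these elements by an [r] such that
    all coefficients of [5 r] are divisible by 5; then [r] is in the span of [I], where [t]
    is 1. *)
Lemma labels_exist t I : cap I t -> exists z, labels t I z.
Proof.
move=> tI; have tT := cap_torus tI.
have [I0|[p pI]] := set_0Vmem I.
  exists (fun=> 0) => g c c0 gc.
  have cE e : c e = 0 by apply: c0; rewrite I0 inE.
  rewrite big1 => [|e _]; last by rewrite mulr0.
  have -> : g = 0; last exact: torus0.
  apply: (good_tf gv (n := 5)) => //; rewrite gc /lincomb big1// => e _.
  by rewrite cE mulr0z.
have /choice[gg] := fun i => pair_element i p.
move=> /choice[d dP].
have dI i e : i \in I -> e \notin I -> d i e = 0.
  move=> iI eI; have [_ d0 _] := dP i; apply: d0; apply: contraNneq eI => ->//.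
have /choice[z zP] : forall i, exists x, i \in I -> t (gg i) = zpow R x.
  move=> i; have [iI|_] := boolP (i \in I); last by exists 0.
  have [x xE] : exists x, t (gg i) = zpow R x; last by exists x.
  apply: zpow_root; have [gd _ _] := dP i.
  rewrite -[t _ ^+ 5]/(t (gg i) ^ 5) -torusZ// gd.
  by apply: (cap_lincomb tI) => e; exact: dI.
exists z => g c c0 gc.
pose m (i : 'I_4) : int := (val (phi i))%:Z * c i.
have mE i : (m i)%:~R = phi i * (c i)%:~R :> 'F_5 by rewrite rmorphM /= F5_lift.
have m0 i : i \notin I -> m i = 0 by move=> iI; rewrite /m c0// mulr0.
(* Since the integers [m i] sum up to 0 modulo 5, removing the combination of the [gg i] with
   these coefficients leaves coefficients [cr] divisible by 5. *)
pose r := g - \sum_i gg i *~ m i.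
pose cr e := c e - \sum_i d i e * m i.
have rE : r *~ 5 = lincomb v cr.
  rewrite lincombB mulrzBl gc; congr (_ - _).
  rewrite mulrz_suml; apply: esym; rewrite /lincomb (eq_bigr (fun e => \sum_i v e *~ (d i e * m i))) => [|e _].
    rewrite exchange_big /=; apply: eq_bigr => i _; apply: esym.
    by rewrite mulrzAC (_ : gg i *~ 5 = lincomb v (d i)) -?lincombZ//; case: (dP i).
  by rewrite mulrz_sumr.
have cr0 e : e \notin I -> cr e = 0.
  move=> eI; rewrite /cr c0// big1 ?subrr// => i _.
  have [iI|/m0->] := boolP (i \in I); last by rewrite mulr0.
  by rewrite dI// mul0r.
have crE z' : \sum_e phi e * (cr e)%:~R * z' e = \sum_e phi e * (c e)%:~R * z' e - \sum_i (m i)%:~R * (z' i - z' p).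
  rewrite (eq_bigr (fun e => phi e * (c e)%:~R * z' e - \sum_i (m i)%:~R * (phi e * (d i e)%:~R * z' e))) => [|e _].
    rewrite sumrB; congr (_ - _); rewrite exchange_big /=; apply: eq_bigr => i _.
    by rewrite -mulr_sumr; case: (dP i) => _ _ ->.
  rewrite rmorphB rmorph_sum /= mulrBr mulrBl; congr (_ - _).
  by rewrite mulr_sumr mulr_suml; apply: eq_bigr => i _; rewrite rmorphM /=; ring.
have sum_m0 : \sum_i (m i)%:~R = 0 :> 'F_5.
  by rewrite -[RHS](good_orth gv gc); apply: eq_bigr => i _.
have cr5 e : (5 %| cr e)%Z.
  rewrite -F5_intr_eq0; have := crE (fun a => (a == e)%:R).
  rewrite (bigD1 e)//= eqxx mulr1 big1 => [|a /negPf->]; last by rewrite mulr0.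
  rewrite (bigD1 e)//= eqxx mulr1 big1 => [|a /negPf->]; last by rewrite mulr0.
  rewrite !addr0 => E; apply/eqP; apply: (mulfI (good_phi0 gv e)); rewrite mulr0 E.
  have -> : \sum_i (m i)%:~R * ((i == e)%:R - (p == e)%:R) = (m e)%:~R :> 'F_5.
    rewrite (eq_bigr (fun i => (m i)%:~R * (i == e)%:R - (m i)%:~R * (p == e)%:R)) => [|i _].
      rewrite sumrB -mulr_suml sum_m0 mul0r subr0.
      by rewrite (bigD1 e)//= eqxx mulr1 big1 ?addr0// => i /negPf->; rewrite mulr0.
    by rewrite mulrBr.
  by rewrite mE subrr.
have tr : t r = 1.
  have -> : r = lincomb v (fun e => (cr e %/ 5)%Z).
    apply: (good_inj gv (n := 5)) => //; rewrite -lincombZ rE.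
    by apply: eq_bigr => e _; rewrite divzK.
  by apply: (cap_lincomb tI) => e eI; rewrite cr0.
have -> : g = r + \sum_i gg i *~ m i by rewrite subrK.
rewrite torusD// tr mul1r torus_sum//.
rewrite (eq_bigr (fun i => zpow R (z i * (m i)%:~R))) => [|i _]; last first.
  rewrite torusZ// zpowZ; have [iI|/m0->] := boolP (i \in I); last by [].
  by rewrite zP.
rewrite -(big_morph _ (@zpowD R) (zpow0 R)); congr (zpow R _).
by apply: eq_bigr => i _; rewrite mE mulrC.
Qed.

Lemma I4_out I : (#|I| <= 3)%N -> exists l, l \notin I.
Proof.
move=> I3; have [l lI|IT] := pickP (fun l => l \notin I); first by exists l.
suff : (4 <= #|I|)%N by rewrite leqNgt ltnS I3.
rewrite -[X in (X <= _)%N](card_ord 4); apply: subset_leq_card.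
by apply/fintype.subsetP => e _; have := IT e => /negbFE.
Qed.

(** Adjust [z] outside [I] so that it is orthogonal to [phi]; then it defines a
    character on all of [G]. *)
Lemma labels_realize I z : (#|I| <= 3)%N -> exists2 t, cap I t & labels t I z.
Proof.
move=> /I4_out[l lI].
pose y e := if e == l then - (\sum_(a | a != l) phi a * z a) / phi l else z e.
have yl : \sum_e phi e * y e = 0.
  rewrite (bigD1 l)//= {1}/y eqxx mulrC divfK ?(good_phi0 gv)//.
  rewrite -[X in - X + _](_ : \sum_(e | e != l) phi e * y e = _) ?addNr//.
  by apply: eq_bigr => e /negPf el; rewrite /y el.
pose pairing c := \sum_e phi e * (c e)%:~R * y e.
have pairing_eq c d : lincomb v c = lincomb v d -> pairing c = pairing d.
  move=> /(good_eq gv) cd; apply/eqP; rewrite -subr_eq0 -sumrB.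
  rewrite (eq_bigr (fun e => (c l - d l)%:~R * (phi e * y e))) => [|e _].
    by rewrite -mulr_sumr yl mulr0.
  by rewrite -(cd e l) rmorphB /=; ring.
pose t : {ptws G -> C} := fun g => zpow R (pairing (kap gv g)).
have tE g c : g *~ 5 = lincomb v c -> t g = zpow R (pairing c).
  by move=> gc; rewrite /t (pairing_eq _ c)// -gc -kapE.
have tT : torus t.
  split=> [g|g h]; first exact: zpow_neq0.
  rewrite (tE (g + h) (fun e => kap gv g e + kap gv h e)); last first.
    by rewrite lincombD mulrzDl -!kapE.
  rewrite /t -zpowD; congr (zpow R _); rewrite -big_split; apply: eq_bigr => e _.
  by rewrite rmorphD /=; ring.
exists t.
  split=> // e _; split=> //; rewrite (tE _ (fun a => (a == e)%:Z * 5)).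
    rewrite -[RHS](zpow0 R); congr (zpow R _); apply: big1 => a _.
    by rewrite rmorphM /= (_ : 5%:~R = 0 :> 'F_5) ?mulr0 ?mul0r//; apply/eqP; rewrite F5_intr_eq0.
  by rewrite lincombZ lincomb_gen.
move=> g c c0 gc; rewrite (tE g c)//; congr (zpow R _); apply: eq_bigr => e _.
by rewrite /y; case: eqP => // ->; rewrite c0// mulr0 !mul0r.
Qed.

(** Labels are read off from evaluations, which take finitely many values on the
    intersection. *)
Lemma component_labels t t' I z : cap I t -> connected_component (cap I) t t' ->
  labels t I z -> labels t' I z.
Proof.
move=> tI tt' tz g c c0 gc; rewrite -(tz g c)//.
apply: (component_eval (S := [seq zpow R x | x : 'F_5])) tt' => s sI.
have [y sy] := labels_exist sI.
by rewrite (sy g c)//; apply: codom_f.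
Qed.

(** Orthogonality to [phi] makes [n] divisible by 5. *)
Lemma good_multiple p g (n : int) : g *~ 5 = v p *~ n -> exists k, g = v p *~ k.
Proof.
move=> gn; have : g *~ 5 = lincomb v (fun a => (a == p)%:Z * n) by rewrite lincombZ lincomb_gen.
move=> /(good_orth gv); rewrite (bigD1 p)//= eqxx mul1r big1 => [|a /negPf->]; last first.
  by rewrite mul0r mulr0.
rewrite addr0 => /eqP; rewrite mulf_eq0 (negPf (good_phi0 gv p)) F5_intr_eq0 /=.
move=> /dvdzP[k kE]; exists k; apply: (good_inj gv (n := 5)) => //.
by rewrite gn kE mulrzA.
Qed.

(** The coordinate morphisms of the indices outside [I] give one-parameter subgroups that
    are constant on the hypertori of [I]. *)
Lemma torus_multi t I l (r : seq 'I_4) (rho : 'I_4 -> C) : cap I t -> l \notin I ->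
  (forall e, e \in r -> e \notin I) -> (forall e, rho e != 0) ->
  connected_component (cap I) t (fun g => t g * \prod_(e <- r) rho e ^ coord gv l e g).
Proof.
move=> tI lI + rho0; elim: r => [|a r IH] rI.
  rewrite (_ : (fun g => _) = t); first exact: connected_component_refl.
  by apply/funext => g; rewrite big_nil mulr1.
have := IH (fun e er => rI e (mem_behead (s := a :: r) er)) => step.
apply: (connected_component_trans step).
have [t1 t1E] : exists t1 : {ptws G -> C}, t1 = (fun g => t g * \prod_(e <- r) rho e ^ coord gv l e g) by eexists.
rewrite -t1E in step *.
have := @torus_subgroup R _ _ v I t1 (coord gv l a) (rho a).
rewrite (_ : (fun g => t1 g * _) = (fun g => t g * \prod_(e <- a :: r) rho e ^ coord gv l e g)).
  apply=> //; first exact: connected_component_sub step.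
  move=> e eI; rewrite /= coord_gen; last by apply: contraNneq lI => <-.
  by case: eqP => [ae|]; rewrite ?mul0r//; have := rI a (mem_head _ _); rewrite ae eI.
by apply/funext => g; rewrite t1E big_cons -mulrA; congr (_ * _); rewrite mulrC.
Qed.

(** When [l] is left out, [v p] and the [x e] for the two other indices form a
    basis of [G]. *)
Lemma basis_component t t' I l p (x : 'I_4 -> G) (k : 'I_4 -> int) :
  cap I t -> cap I t' -> l \notin I -> p != l ->
  (forall e, x e *~ 5 = lincomb v (fun a => (a == e)%:Z + (a == p)%:Z * k e)) ->
  t (v p) = t' (v p) -> (forall e, e \in I -> e != p -> t (x e) = t' (x e)) ->
  connected_component (cap I) t t'.
Proof.
move=> tI t'I lI pl xE tp tx.
have [tT t'T] := (cap_torus tI, cap_torus t'I).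
pose Q e := (e != p) && (e != l).
pose rho e : C := t' (x e) / t (x e).
have rho0 e : rho e != 0 by rewrite mulf_neq0 ?invr_neq0 ?torus_neq0.
pose r := [seq e <- index_enum 'I_4 | Q e && (e \notin I)].
have rI e : e \in r -> e \notin I by rewrite mem_filter => /andP[/andP[]].
suff -> : t' = (fun g => t g * \prod_(e <- r) rho e ^ coord gv l e g).
  exact: torus_multi.
apply/funext => g.
pose n e := coord gv l e g.
pose h := g - \sum_(e | Q e) x e *~ n e.
have hE : h *~ 5 = v p *~ (n p - \sum_(e | Q e) k e * n e).
  rewrite mulrzBl (coordE gv l) mulrz_suml.
  rewrite (eq_bigr (fun e => v e *~ n e + v p *~ (k e * n e))) => [|e _].
    rewrite big_split /= /lincomb (bigD1 p)//= (bigD1 l)//=; last by rewrite eq_sym.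
    rewrite coordll mulr0z add0r mulrzBr mulrz_sumr -/(n p) opprD addrA.
    by congr (_ - _); rewrite addrK.
  rewrite mulrzAC xE lincombD mulrzDl lincomb_gen lincombZ lincomb_gen.
  by rewrite -mulrzA.
have [m hm] := good_multiple hE.
have gE : g = h + \sum_(e | Q e) x e *~ n e by rewrite subrK.
have tgE (s : {ptws G -> C}) : torus s -> s g = s h * \prod_(e | Q e) s (x e) ^ n e.
  move=> sT; rewrite {1}gE (torusD sT) (torus_sum sT); congr (_ * _).
  by apply: eq_bigr => e _; rewrite (torusZ sT).
rewrite (tgE t tT) (tgE t' t'T) hm (torusZ tT) (torusZ t'T) -tp -mulrA; congr (_ * _).
rewrite big_filter [X in _ = _ * X]big_mkcondr -big_split; apply: eq_bigr => e /andP[ep _] /=.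
case: ifPn => [_|/negbNE eI]; last by rewrite mulr1 tx.
by rewrite -expfzMl /rho mulrCA mulfV ?mulr1// torus_neq0.
Qed.

(** Two points with the same labels agree on [x e] for [e] in [I]; if [p] is in [I], both
    take the value 1 at [v p].  If [I] is empty, a one-parameter subgroup first adjusts
    the value at [v p]. *)
Lemma labels_component t t' I z : (#|I| <= 3)%N -> cap I t -> cap I t' ->
  labels t I z -> labels t' I z -> connected_component (cap I) t t'.
Proof.
move=> /I4_out[l lI] tI t'I tz t'z.
have basis p : exists k : 'I_4 -> int, exists x : 'I_4 -> G,
    forall e, x e *~ 5 = lincomb v (fun a => (a == e)%:Z + (a == p)%:Z * k e).
  pose k e : int := val (- (phi e / phi p)); exists k.
  have /choice[x xE] : forall e, exists g : G,
      g *~ 5 = lincomb v (fun a => (a == e)%:Z + (a == p)%:Z * k e); last by exists x.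
  move=> e; apply/(good_div gv).
  rewrite (eq_bigr (fun a => phi a * ((a == e)%:R) - phi a * ((a == p)%:R * (phi e / phi p)))) => [|a _].
    rewrite sumrB (bigD1 e)//= eqxx mulr1 big1 => [|a /negPf->]; last by rewrite mulr0.
    rewrite (bigD1 p)//= eqxx mul1r big1 => [|a /negPf->]; last by rewrite mul0r mulr0.
    by rewrite !addr0 mulrCA mulfV ?(good_phi0 gv)// mulr1 subrr.
  by rewrite rmorphD rmorphM /= F5_lift mulrN -mulrBr.
have [I0|[p pI]] := set_0Vmem I.
  have [p pl] : exists p : 'I_4, p != l.
    by exists (if l == o0 then o1 else o0); case: (eqVneq l o0) => [->|]; rewrite // eq_sym.
  have [k [x xE]] := basis p.
  pose rho : C := 5.-root (t' (v p) / t (v p) : R[i]).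
  have rho5 : rho ^ 5 = t' (v p) / t (v p) by rewrite -[_ ^ 5]/(rho ^+ 5) rootCK.
  have rho0 : rho != 0.
    apply: contra_eq_neq rho5 => ->; rewrite exp0rz eq_sym mulf_neq0//.
      exact: torus_neq0 (cap_torus t'I) _.
    by rewrite invr_neq0//; exact: torus_neq0 (cap_torus tI) _.
  have := @torus_subgroup R _ _ v I t (coord gv l p) rho tI.
  move=> /(_ _ rho0) []//; first by move=> e; rewrite I0 inE.
  move=> D [Dt DI Dc] Dt1.
  have step : connected_component (cap I) t (fun g => t g * rho ^ coord gv l p g) by exists D.
  apply: (connected_component_trans step).
  apply: (basis_component (l := l) (p := p) _ _ _ _ xE) => //.
  - exact: connected_component_sub step.
  - rewrite coord_gen// eqxx mul1r rho5 mulrC divfK//.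
    exact: torus_neq0 (cap_torus tI) _.
  - by move=> e; rewrite I0 inE.
have pl : p != l by apply: contraNneq lI => <-.
have [k [x xE]] := basis p.
apply: (basis_component (l := l) (p := p) _ _ _ _ xE) => //.
  by rewrite !(cap_vec _ pI).
move=> e eI ep.
have c0 a : a \notin I -> (a == e)%:Z + (a == p)%:Z * k e = 0.
  move=> aI; rewrite (_ : (a == e) = false); last by apply: contraNF aI => /eqP->.
  by rewrite (_ : (a == p) = false) ?mul0r//; apply: contraNF aI => /eqP->.
by rewrite (tz (x e) _ c0)// (t'z (x e) _ c0).
Qed.

End ToricComponents.

(** * The posets of the essential representations are isomorphic to the model *)

Section PosetIso.
Local Open Scope classical_set_scope.
Context (R : realType).
Local Notation C := (R[i]^o).
Context (G : zmodType) (v : 'I_4 -> G) (eps : 'I_4 -> int) (phi : 'I_4 -> 'F_5).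
Hypothesis eps2 : forall e, eps e * eps e = 1.
Let u e := v e *~ eps e.
Hypothesis gu : good u phi.
Implicit Types (I J : {set 'I_4}).

Lemma cap_sign I : hypertori_cap v I = hypertori_cap u I :> set {ptws G -> C}.
Proof.
apply/seteqP; split=> t [tT tI]; split=> // e eI; split=> //; have [_ te] := tI e eI.
  by rewrite torusZ// te exp1rz.
by rewrite -[v e]mulr1z -(eps2 e) mulrzA torusZ// te exp1rz.
Qed.

Lemma am_indep_sign I : am_indep (arith_matroid_of v) I <-> (#|I| <= 3)%N.
Proof.
rewrite /am_indep /= (_ : [set` zspan v I] = [set` zspan u I]); last first.
  by apply/seteqP; split=> g /=; rewrite zspan_sign.
rewrite -[zrank _]/(am_rk (arith_matroid_of u) I) (good_rk gu).
by split=> [<-|/minn_idPl//]; exact: geq_minr.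
Qed.

Lemma ai_posetP (x : ai_poset R v) : exists t z, [/\ (#|(val x).1| <= 3)%N,
  hypertori_cap u (val x).1 t, (val x).2 = connected_component (hypertori_cap u (val x).1) t &
  labels u phi t (val x).1 z].
Proof.
have /asboolP[/am_indep_sign I3 [t tI WE]] := valP x.
rewrite cap_sign in tI WE; have [z tz] := labels_exist gu tI.
by exists t, z.
Qed.

(** An element [(I, W)] is sent to the labels on [I] of a point of [W]: all points of [W]
    have the same labels, each choice of labels occurs, and points with the same labels are
    in the same component.  Inclusion of components then becomes restriction of labels. *)
Lemma ai_poset_model : poset_isomorphic (ai_poset R v) model.
Proof.
have /choice[t] := ai_posetP; move=> /choice[z P].
have I3 (x : ai_poset R v) : (#|(val x).1| <= 3)%N by case: (P x).
have tI (x : ai_poset R v) : hypertori_cap u (val x).1 (t x) by case: (P x).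
have WE (x : ai_poset R v) : (val x).2 = connected_component (hypertori_cap u (val x).1) (t x) by case: (P x).
have tz (x : ai_poset R v) : labels u phi (t x) (val x).1 (z x) by case: (P x).
pose f x : model := mk (z x) (I3 x).
have fmono : {mono f : x y / (x <= y)%O}.
  move=> x y; apply/mk_le/andP => -[IJ h].
    split=> //; apply/asboolP; rewrite !WE.
    have tyI : hypertori_cap u (val x).1 (t y) by apply: cap_sub (tI y).
    have tyz : labels u phi (t y) (val x).1 (z x).
      apply: (labels_eq gu) (labels_sub IJ (tz y)) => i j iI jI; rewrite h//.
    have xy := labels_component gu (I3 x) (tI x) tyI (tz x) tyz.
    rewrite (same_connected_component xy).
    apply: connected_component_max; last exact: component_connected.
      exact: connected_component_refl.
    by move=> s /connected_component_sub; apply: cap_sub.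
  split=> //; move/asboolP: h; rewrite !WE => yx.
  have xy : connected_component (hypertori_cap u (val x).1) (t x) (t y).
    by apply: yx; apply: connected_component_refl.
  apply: (labels_inj gu (t := t y)) (labels_sub IJ (tz y)).
  exact: component_labels (tI x) xy (tz x).
exists f; split=> //; apply: inj_surj_bijective.
  by move=> x y xy; apply/Order.POrderTheory.le_anti; rewrite -!fmono xy !lexx.
move=> m; have [s sI sm] := labels_realize R gu (label m) (supp_le3 m).
have sP : ai_pred v (supp m, connected_component (hypertori_cap v (supp m)) s).
  apply/asboolP; split; first exact/am_indep_sign/supp_le3.
  by exists s; rewrite ?cap_sign.
have [x xE] : exists x : ai_poset R v,
    val x = (supp m, connected_component (hypertori_cap v (supp m)) s) by exists (AIPoset sP).
have xI : (val x).1 = supp m by rewrite xE.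
have xs : labels u phi (t x) (supp m) (label m).
  apply: component_labels sm => //.
  have := WE x; rewrite xI xE /= cap_sign => ->.
  by apply: connected_component_refl; rewrite -xI.
have := tz x; rewrite xI => /(labels_inj gu)/(_ xs) zm.
exists x; rewrite [RHS]mk_supp; apply: Order.POrderTheory.le_anti.
by apply/andP; split; apply/mk_le; rewrite xI; split=> // i j iI jI; rewrite zm.
Qed.

End PosetIso.

Lemma poset_iso_sym d1 d2 (P : porderType d1) (Q : porderType d2) :
  poset_isomorphic P Q -> poset_isomorphic Q P.
Proof.
move=> [f [[g fg gf] fm]]; exists g; split; first by exists f.
by move=> x y; rewrite -fm !gf.
Qed.

Lemma poset_iso_trans d1 d2 d3 (P : porderType d1) (Q : porderType d2) (S : porderType d3) :
  poset_isomorphic P Q -> poset_isomorphic Q S -> poset_isomorphic P S.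
Proof.
move=> [f [fb fm]] [g [gb gm]]; exists (g \o f); split; first exact: bij_comp.
by move=> x y; rewrite /= gm fm.
Qed.

Lemma essential_model (R : realType) (r : vector_config 'I_4) :
  essential_representation arith_matroidA r ->
  poset_isomorphic (arithmetic_independence_poset R r) model.
Proof.
move=> /essential_signed_good[eps eps2 [phi _ gr]].
exact: ai_poset_model eps2 gr.
Qed.

(** * Homology and isomorphisms of posets *)

Lemma quot_eq0P (V : zmodType) (I : zmodClosed V) (x : V) :
  reflect (\pi_(Quotient.quot I) x = 0) (x \in I).
Proof.
apply: (iffP idP) => [xI|x0].
  by rewrite -(raddf0 \pi_(Quotient.quot I)); apply/quot_eqP; rewrite subr0.
by rewrite -[x]subr0; apply/quot_eqP; rewrite raddf0.
Qed.

Section Transport.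
Local Open Scope classical_set_scope.
Context (d1 d2 : Order.disp_t) (P : porderType d1) (Q : porderType d2) (g : Q -> P) (f : P -> Q).
Hypotheses (fK : cancel f g) (gK : cancel g f) (gm : {mono g : x y / (x <= y)%O}).
Context (A : set P) (B : set Q).
Hypothesis AB : forall y, B y <-> A (g y).
Implicit Types (s : {fset Q}).

Let ginj : injective g := can_inj gK.

Lemma mem_gfset s y : (g y \in (g @` s)%fset) = (y \in s).
Proof. by rewrite mem_imfset. Qed.

Lemma gfsetE s x : (x \in (g @` s)%fset) = (f x \in s).
Proof. by rewrite -{1}[x]fK mem_gfset. Qed.

Lemma card_gfset s : #|` (g @` s)%fset| = #|` s|.
Proof. by rewrite card_imfset. Qed.

Lemma gfset_inj : injective (fun s => (g @` s)%fset).
Proof. by move=> s t st; apply/fsetP => y; rewrite -!mem_gfset st. Qed.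

Lemma gfset_surj (t : {fset P}) : exists s, t = (g @` s)%fset.
Proof. by exists (f @` t)%fset; apply/fsetP => x; rewrite gfsetE mem_imfset//; exact: can_inj fK. Qed.

Lemma order_complex_transport s : order_complex B s <-> order_complex A (g @` s)%fset.
Proof.
split=> -[sB sc]; split.
- by move=> x; rewrite /= gfsetE => /sB /AB; rewrite fK.
- move=> x y; rewrite !gfsetE => xs ys; have := sc _ _ xs ys.
  by rewrite /Order.comparable -!gm !fK.
- by move=> y ys; apply/AB/sB; rewrite /= mem_gfset.
- move=> x y xs ys; have := sc (g x) (g y); rewrite !mem_gfset => /(_ xs ys).
  by rewrite /Order.comparable !gm.
Qed.

Context (R : pzRingType).
Implicit Types (c : {fset P} -> R).

Definition transport c : {fset Q} -> R := fun s => c (g @` s)%fset.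

Lemma transport_chain n c :
  simplicial_chain (order_complex A) n c -> simplicial_chain (order_complex B) n (transport c).
Proof.
move=> [cfin cs]; split.
  apply: (@sub_finite_set _ _ ((fun t : {fset P} => f @` t)%fset @` [set t | c t != 0])); last first.
    exact: finite_image.
  move=> s /= cs0; exists (g @` s)%fset => //.
  by apply/fsetP => y; rewrite -{1}[y]gK mem_imfset ?mem_gfset//; exact: can_inj fK.
by move=> s /cs[sA sn]; split; [exact/order_complex_transport|rewrite -card_gfset].
Qed.

Lemma transport_boundary c : boundary (transport c) = transport (boundary c).
Proof.
apply/funext => s; rewrite /boundary /transport.
rewrite (reindex_fsbig g [set y | y \notin s]); last first.
  split=> [y /=|x y _ _ /ginj//|x /=]; first by rewrite mem_gfset.
  by rewrite gfsetE => xs; exists (f x).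
apply: eq_fsbigr => y _; congr ((-1) ^+ _ * c _).
  rewrite -card_gfset; congr (#|` _|); apply/fsetP => x.
  by rewrite gfsetE !inE /= gfsetE -(leW_mono gm) fK.
apply/fsetP => x; rewrite gfsetE !inE /= gfsetE; congr (_ || _).
by rewrite -(inj_eq ginj) fK.
Qed.

End Transport.

Section HomologyTransport.
Local Open Scope classical_set_scope.
Context (d1 d2 : Order.disp_t) (P : porderType d1) (Q : porderType d2) (g : Q -> P) (f : P -> Q).
Hypotheses (fK : cancel f g) (gK : cancel g f) (gm : {mono g : x y / (x <= y)%O}).
Context (A : set P) (B : set Q).
Hypothesis AB : forall y, B y <-> A (g y).
Context (R : pzRingType) (n : nat).
Local Notation KA := (order_complex A).
Local Notation KB := (order_complex B).

Let fm : {mono f : x y / (x <= y)%O}.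
Proof. by move=> x y; rewrite -gm !fK. Qed.

Let BA x : A x <-> B (f x).
Proof. by rewrite AB fK. Qed.

Lemma transportK (c : {fset Q} -> R) : transport g (transport f c) = c.
Proof.
apply/funext => s; congr (c _); apply/fsetP => y.
by rewrite (gfsetE gK fK) (mem_gfset gK).
Qed.

Lemma transportK' (c : {fset P} -> R) : transport f (transport g c) = c.
Proof.
apply/funext => s; congr (c _); apply/fsetP => y.
by rewrite (gfsetE fK gK) (mem_gfset fK).
Qed.

Lemma transport_cycle (z : Defs.cycle R KA n) : is_cycle KB n (transport g (val z)).
Proof.
have /asboolP[zc z0] := valP z; apply/asboolP; split.
  exact: transport_chain zc.
by rewrite (transport_boundary fK gK gm) z0.
Qed.

Definition cycle_transport (z : Defs.cycle R KA n) : Defs.cycle R KB n := Cycle (transport_cycle z).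

Lemma cycle_transport_zmod : zmod_morphism cycle_transport.
Proof. by move=> x y; apply: val_inj; rewrite raddfB. Qed.

HB.instance Definition _ := GRing.isZmodMorphism.Build
  (Defs.cycle R KA n) (Defs.cycle R KB n) cycle_transport cycle_transport_zmod.

End HomologyTransport.

Section HomologyIso.
Local Open Scope classical_set_scope.
Context (d1 d2 : Order.disp_t) (P : porderType d1) (Q : porderType d2) (g : Q -> P) (f : P -> Q).
Hypotheses (fK : cancel f g) (gK : cancel g f) (gm : {mono g : x y / (x <= y)%O}).
Context (A : set P) (B : set Q).
Hypothesis AB : forall y, B y <-> A (g y).
Context (R : pzRingType) (n : nat).
Local Notation KA := (order_complex A).
Local Notation KB := (order_complex B).

Let fm : {mono f : x y / (x <= y)%O}.
Proof. by move=> x y; rewrite -gm !fK. Qed.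

Let BA x : A x <-> B (f x).
Proof. by rewrite AB fK. Qed.

Lemma homology_transport :
  zmod_isomorphic (reduced_homology R KA n) (reduced_homology R KB n).
Proof.
pose h : {additive Defs.cycle R KA n -> reduced_homology R KB n} :=
  \pi_(reduced_homology R KB n) \o cycle_transport fK gK gm AB (R:=R) (n:=n).
apply: (quot_isomorphic (f := h)).
  move=> w; have [z ->] := quot_surj w.
  exists (cycle_transport gK fK fm BA z); congr (\pi _); apply: val_inj => /=.
  exact: transportK.
move=> z; have hz : h z = 0 <-> cycle_transport fK gK gm AB z \in @is_boundary R _ Q KB n.
  by split=> /quot_eq0P.
rewrite hz; split=> /asboolP[b bc bz]; apply/asboolP.
  exists (transport g b); first exact: transport_chain bc.
  by rewrite (transport_boundary fK gK gm) bz.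
exists (transport f b); first exact: transport_chain bc.
by rewrite (transport_boundary gK fK fm) bz /= (transportK' fK gK).
Qed.

End HomologyIso.

Section PosetIsoConsequences.
Local Open Scope classical_set_scope.
Context (d1 d2 : Order.disp_t) (P : porderType d1) (Q : porderType d2) (f : P -> Q).
Hypotheses (fbij : bijective f) (fm : {mono f : x y / (x <= y)%O}).

Lemma without_bottom_iso x : without_bottom P x <-> without_bottom Q (f x).
Proof.
have [g fK gK] := fbij.
split=> xb fxb; apply: xb => y; first by rewrite -fm.
by rewrite -(gK y) fm.
Qed.

Lemma homology_iso (R : pzRingType) n :
  zmod_isomorphic (reduced_homology R (order_complex (without_bottom P)) n)
                  (reduced_homology R (order_complex (without_bottom Q)) n).
Proof.
have [g fK gK] := fbij.
apply: (homology_transport fK gK) => [x y|y]; first by rewrite -fm !gK.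
by rewrite without_bottom_iso gK.
Qed.

End PosetIsoConsequences.

Lemma zmod_iso_trans (A B C : zmodType) :
  zmod_isomorphic A B -> zmod_isomorphic B C -> zmod_isomorphic A C.
Proof. by move=> [f fb] [g gb]; exists (g \o f); exact: bij_comp. Qed.

(** * One-cocycles of the model with arbitrary coefficients *)

(** The 1-cocycle generating the cohomology of the model with values in Z/5; it
    reads off the label of the larger element at the selected index of the smaller one. *)
Definition model_cocycle (x y : model) : 'F_5 := label y (sel (supp x)).

Lemma card1_le3 (i : 'I_4) : (#|[set i]%SET| <= 3)%N.
Proof. by rewrite cards1. Qed.

Lemma card2_le3 (i j : 'I_4) : (#|[set i; j]%SET| <= 3)%N.
Proof. by rewrite cards2; case: (_ != _). Qed.

Lemma card3_le3 (i j k : 'I_4) : (#|[set i; j; k]%SET| <= 3)%N.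
Proof.
apply: leq_trans (leq_card_setU _ _) _.
by rewrite cards1 cards2; case: (_ != _).
Qed.

Definition vertex (i : 'I_4) : model := mk (fun=> 0) (card1_le3 i).

Definition edge (i j : 'I_4) (a : 'F_5) : model :=
  mk (fun e => if e == i then a else 0) (card2_le3 i j).

Lemma vertex_le i (x : model) : i \in supp x -> (vertex i <= x)%O.
Proof.
move=> ix; apply/le_modelP; rewrite supp_mk finset.sub1set; split=> // a b.
by rewrite !inE => /eqP-> /eqP->; rewrite !subrr.
Qed.

Lemma supp_vertex_neq0 i : supp (vertex i) != finset.set0.
Proof. by rewrite supp_mk; apply/set0Pn; exists i; rewrite inE. Qed.

Section Classification.
Context (A : zmodType) (w : model -> model -> A).
Hypothesis wD : forall x y z, supp x != finset.set0 -> (x < y)%O -> (y < z)%O ->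
  w x z = w x y + w y z.
Implicit Types (x y : model) (i j k : 'I_4) (a b : 'F_5).

Let w' x y := if x == y then 0 else w x y.

Let w'D x y z : supp x != finset.set0 -> (x <= y)%O -> (y <= z)%O -> w' x z = w' x y + w' y z.
Proof.
rewrite /w' => x0; rewrite !le_eqVlt => /orP[/eqP->|xy].
  by rewrite eqxx add0r.
move=> /orP[/eqP->|yz]; first by rewrite eqxx addr0.
by rewrite !lt_eqF ?(lt_trans xy yz)//; exact: wD.
Qed.

Let r i x := w' (vertex i) x.

Let rD i x y : i \in supp x -> (x <= y)%O -> r i y = r i x + w' x y.
Proof. by move=> ix xy; apply: w'D => //; [exact: supp_vertex_neq0|exact: vertex_le]. Qed.

Let addrKr_ (a b c : A) : (a + c) - (b + c) = a - b.
Proof. by rewrite opprD addrACA subrr addr0. Qed.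

Let addrKl_ (a b c : A) : (c + a) - (c + b) = a - b.
Proof. by rewrite opprD addrACA subrr add0r. Qed.

Let addrBD_ (a b c d : A) : (a + b) - (c + d) = (a - c) + (b - d).
Proof. by rewrite opprD addrACA. Qed.

Let solve_ (a b c d e x : A) : a + (c - b) + e = d + x -> x = (a - b) - (d - c) + e.
Proof.
move=> E; apply: (addrI d); rewrite -E opprB [RHS]addrC -[RHS]addrA [e + d]addrC.
by rewrite !addrA subrK [a + c - b]addrAC.
Qed.

Let W i j x := r i x - r j x.

Let W_le i j x y : i \in supp x -> j \in supp x -> (x <= y)%O -> W i j y = W i j x.
Proof. by move=> ix jx xy; rewrite /W (rD ix xy) (rD jx xy) addrKr_. Qed.

Let H i j a := W i j (edge i j a).

Let in2 i j : (i \in [set i; j]%SET) * (j \in [set i; j]%SET).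
Proof. by rewrite !inE !eqxx orbT. Qed.

Let WH i j x : i != j -> i \in supp x -> j \in supp x ->
  W i j x = H i j (label x i - label x j).
Proof.
move=> ij ix jx; apply: W_le; rewrite ?supp_mk ?in2//.
apply/le_modelP; rewrite supp_mk; split.
  by apply/fintype.subsetP => e; rewrite !inE => /orP[]/eqP->.
have ji : (j == i) = false by rewrite eq_sym; exact: negbTE.
move=> e e' eI e'I; rewrite label_mk//; move: eI e'I; rewrite !inE.
by move=> /orP[]/eqP-> /orP[]/eqP->; rewrite ?eqxx ?ji ?subrr ?subr0// sub0r opprB.
Qed.

Let HD i j k a b : i != j -> j != k -> i != k -> H i j a + H j k b = H i k (a + b).
Proof.
move=> ij jk ik.
pose T := mk (fun e => if e == i then a + b else if e == j then b else 0) (card3_le3 i j k).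
have [iT jT kT] : [/\ i \in supp T, j \in supp T & k \in supp T].
  by rewrite supp_mk !inE !eqxx !orbT.
have ji : (j == i) = false by rewrite eq_sym; exact: negbTE.
have ki : (k == i) = false by rewrite eq_sym; exact: negbTE.
have kj : (k == j) = false by rewrite eq_sym; exact: negbTE.
have := WH ij iT jT; have := WH jk jT kT; have := WH ik iT kT.
rewrite !label_mk// !eqxx ji ki kj subr0 addrK subr0 => <- <- <-.
by rewrite /W addrA subrK.
Qed.

Let HN i j a : i != j -> H i j a = - H j i (- a).
Proof.
move=> ij; have ji : (j == i) = false by rewrite eq_sym; exact: negbTE.
have := WH (x := edge i j a) (negbT ji); rewrite !supp_mk !in2 => /(_ isT isT).
by rewrite label_mk ?in2// ji eqxx sub0r => <-; rewrite /H /W opprB.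
Qed.

Let U i j a := H i j a - H i j 0.

Let Ul i j k a : i != j -> j != k -> i != k -> U i j a = U i k a.
Proof.
move=> ij jk ik; have e1 := HD a 0 ij jk ik; have e0 := HD 0 0 ij jk ik.
by rewrite !addr0 in e0 e1; rewrite /U -e1 -e0; exact/esym/addrKr_.
Qed.

Let Ur i j k a : i != j -> j != k -> i != k -> U j k a = U i k a.
Proof.
move=> ij jk ik; have e1 := HD 0 a ij jk ik; have e0 := HD 0 0 ij jk ik.
by rewrite !add0r in e0 e1; rewrite /U -e1 -e0; exact/esym/addrKl_.
Qed.

Let U01 i j a : i != j -> U i j a = U o0 o1 a.
Proof.
have U0 k : k != o0 -> U o0 k a = U o0 o1 a.
  by move=> k0; have [->//|k1] := eqVneq k o1; apply: Ul; rewrite // eq_sym.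
have U1 k l : k != l -> l != o0 -> U k l a = U o0 o1 a.
  move=> kl l0; rewrite -(U0 _ l0); have [->//|k0] := eqVneq k o0.
  by apply: Ur; rewrite // eq_sym.
move=> ij; have [j0|/(U1 _ _ ij)//] := eqVneq j o0.
have [k [ki k0]] : exists k, k != i /\ k != o0.
  by exists (if i == o1 then o2 else o1); case: (eqVneq i o1) => [->|]; rewrite // eq_sym.
have ik : i != k by rewrite eq_sym.
have jk : j != k by rewrite j0 eq_sym.
by apply: etrans (U1 _ _ ik k0); exact: Ul.
Qed.

Let u := U o0 o1 1.

Let UD a b : U o0 o1 (a + b) = U o0 o1 a + U o0 o1 b.
Proof.
have e1 := HD a b (isT : o0 != o1) (isT : o1 != o2) isT.
have e0 := HD 0 0 (isT : o0 != o1) (isT : o1 != o2) isT.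
rewrite addr0 in e0.
transitivity (U o0 o2 (a + b)); first exact/esym/U01.
transitivity (U o0 o1 a + U o1 o2 b); last by congr (_ + _); exact: U01.
rewrite /U -e1 -e0; exact: addrBD_.
Qed.

Let UE a : U o0 o1 a = u *+ val a.
Proof.
have nat_case n : U o0 o1 n%:R = u *+ n.
  elim: n => [|n IH]; first by rewrite /U subrr.
  by rewrite mulrSr UD IH mulrSr.
by rewrite -{1}[a]natr_Zp nat_case.
Qed.

Let u5 : u *+ 5 = 0.
Proof.
have : u *+ val (4%:R + 1 : 'F_5) = u *+ val (4%:R : 'F_5) + u *+ val (1 : 'F_5).
  by rewrite -!UE UD.
by rewrite /= -mulrnDr => /= <-.
Qed.

Let h i := if i == o0 then 0 else H i o0 0.

Let Hh i j : i != j -> H i j 0 = h i - h j.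
Proof.
move=> ij; rewrite /h.
have [i0|i0] := eqVneq i o0.
  have [j0|j0] := eqVneq j o0; first by rewrite i0 j0 eqxx in ij.
  by rewrite HN// oppr0 i0 sub0r.
have [->|j0] := eqVneq j o0; first by rewrite subr0.
by rewrite -{1}[0]addr0 -[X in H i o0 X](addr0 0) -(HD 0 0 ij j0 i0) addr0 addrK.
Qed.

Let rE i j x : i \in supp x -> j \in supp x ->
  r i x = r j x + (h i - h j) + u *+ val (label x i - label x j).
Proof.
move=> ix jx; have [->|ij] := eqVneq i j; first by rewrite !subrr mulr0n !addr0.
have := WH ij ix jx; rewrite -[H _ _ _](subrK (H i j 0)) -/(U i j _) U01// UE Hh//.
by move=> /eqP; rewrite subr_eq => /eqP->; rewrite addrC [X in _ + X]addrC addrA.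
Qed.

(** With [r i x] the value of the cocycle from the vertex [i] to [x], the difference
    [r i x - r j x] does not change when [x] is replaced by its restriction to [i] and [j], so
    it is a function [H i j] of the difference of the labels at [i] and [j].  Elements with
    three labels show that [H i j a + H j k b = H i k (a + b)]; hence [H i j] is affine, and
    its linear part [u], an image of Z/5, does not depend on [i] and [j].  The constant parts
    form a coboundary. *)
Lemma cocycle_classification : exists (u : A) (g : model -> A), u *+ 5 = 0 /\
  forall x y, supp x != finset.set0 -> (x < y)%O ->
    w x y = g y - g x + u *+ val (model_cocycle x y).
Proof.
exists u, (fun x => r (sel (supp x)) x - h (sel (supp x))); split=> // x y x0 xy.
have [i ix] := set0Pn _ x0.
have /le_modelP[sxy _] := ltW xy.
have px := selP ix; have py := fintype.subsetP sxy _ px.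
have := rD px (ltW xy); rewrite (rE py (selP py)) label_sel subr0 /w' lt_eqF//.
exact: solve_.
Qed.

End Classification.

Lemma model_cocycleD x y z : supp x != finset.set0 -> (x < y)%O -> (y < z)%O ->
  model_cocycle x z = model_cocycle x y + model_cocycle y z.
Proof.
move=> /set0Pn[i ix] /ltW/le_modelP[sxy _] /ltW/le_modelP[_ lyz].
have px := fintype.subsetP sxy _ (selP ix); have py := selP px.
by have := lyz _ _ px py; rewrite label_sel subr0 /model_cocycle => ->; rewrite subrK.
Qed.

Lemma without_bottom_model x : without_bottom model x <-> supp x != finset.set0.
Proof.
have I0 : (#|finset.set0 : {set 'I_4}| <= 3)%N by rewrite cards0.
split=> [xb|x0 /(_ (mk (fun=> 0) I0))/le_modelP[]]; last first.
  by rewrite supp_mk finset.subset0 (negPf x0).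
apply/eqP => x0; apply: xb => y; apply/le_modelP; rewrite x0 finset.sub0set.
by split=> // i j; rewrite inE.
Qed.

(** * Chains and cochains of a finite poset *)

Section FinitePosetHomology.
Local Open Scope classical_set_scope.
Context (d : Order.disp_t) (Q : finPOrderType d).
Implicit Types (s t : {fset Q}) (x y z : Q).

(** Sign of the vertex [x] in the boundary of the face obtained by adding [x] to [s]. *)
Definition vsign (R : pzRingType) s x : R := (-1) ^+ #|` [fset y in s | (y < x)%O]%fset|.

Lemma vsign_add (R : pzRingType) s x : vsign R (x |` s)%fset x = vsign R s x.
Proof.
congr (_ ^+ #|` _|); apply/fsetP => y; rewrite !inE /=.
by case: eqVneq => [->|//]; rewrite ltxx !andbF.
Qed.

Lemma boundary_finE (R : pzRingType) (c : {fset Q} -> R) s :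
  boundary c s = \sum_(x | x \notin s) vsign R s x * c (x |` s)%fset.
Proof.
by rewrite /boundary [RHS]bigfs ?index_enum_uniq//; last by move=> x _; rewrite mem_index_enum.
Qed.

Section Pairing.
Context (R : comNzRingType) (M : lmodType R).
Implicit Types (c : {fset Q} -> R) (F : {fset Q} -> M).

(** Coefficients of chains are in [R] and those of cochains in a module, so that one
    pairing serves for cochains with values in any abelian group. *)
Definition pairing F c : M := \sum_s c s *: F s.

Definition coboundary F : {fset Q} -> M :=
  fun t => \sum_(x | x \in t) vsign R t x *: F (t `\ x)%fset.

(** Both sides are sums over the pairs of a face and one of its vertices. *)
Lemma pairing_boundary F c : pairing F (boundary c) = pairing (coboundary F) c.
Proof.
rewrite /pairing (eq_bigr (fun s => \sum_(x | x \notin s) (vsign R s x * c (x |` s)%fset) *: F s)) => [|s _]; last first.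
  by rewrite boundary_finE scaler_suml.
rewrite (exchange_big_dep xpredT)//= (eq_bigr (fun t => \sum_(x | x \in t) c t *: (vsign R t x *: F (t `\ x)%fset))) => [|t _]; last first.
  by rewrite scaler_sumr.
rewrite [RHS](exchange_big_dep xpredT)//=; apply: eq_bigr => x _.
rewrite (reindex_onto (fun t => t `\ x)%fset (fun s => x |` s)%fset) => [|s xs]; last by rewrite fsetU1K.
apply: eq_big => [t|t xt].
  rewrite !inE eqxx /=; apply/eqP/idP => [<-|/fsetD1K//]; exact: fset1U1.
by have /andP[_ /eqP tE] := xt; rewrite -vsign_add tE scalerA mulrC.
Qed.

Lemma pairing_eq F F' c K n : simplicial_chain K n c ->
  (forall s, K s -> #|` s| = n -> F s = F' s) -> pairing F c = pairing F' c.
Proof.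
move=> [_ cK] FF'; apply: eq_bigr => s _; have [->|/cK[Ks sn]] := eqVneq (c s) 0.
  by rewrite !scale0r.
by rewrite FF'.
Qed.

Lemma pairing0 c F K n : simplicial_chain K n c ->
  (forall s, K s -> #|` s| = n -> F s = 0) -> pairing F c = 0.
Proof.
move=> cK F0; rewrite (pairing_eq (F' := fun=> 0) cK)//.
by rewrite /pairing big1// => s _; rewrite scaler0.
Qed.

Lemma pairingB F c c' : pairing F (c - c') = pairing F c - pairing F c'.
Proof. by rewrite -sumrB; apply: eq_bigr => s _; rewrite -scalerBl. Qed.

Lemma pairingD F c c' : pairing F (c + c') = pairing F c + pairing F c'.
Proof. by rewrite -big_split; apply: eq_bigr => s _; rewrite /= -scalerDl. Qed.

End Pairing.

Section Deltas.
Context (R : comNzRingType).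

Definition delta t : {fset Q} -> R := fun s => (s == t)%:R.

Lemma chain_finite (c : {fset Q} -> R) : finite_set [set s | c s != 0].
Proof. exact: finite_finset. Qed.

Lemma delta_chain (K : set {fset Q}) n t : K t -> #|` t| = n -> simplicial_chain K n (delta t).
Proof.
move=> Kt tn; split=> [|s]; first exact: chain_finite.
by rewrite /delta; case: (eqVneq s t) => [-> //|_]; rewrite eqxx.
Qed.

Lemma pairing_delta (M : lmodType R) (F : {fset Q} -> M) t : pairing F (delta t) = F t.
Proof.
rewrite /pairing (bigD1 t)//= /delta eqxx scale1r big1 ?addr0// => s /negPf->.
by rewrite scale0r.
Qed.

End Deltas.

Section LowDegreeCoboundary.
Context (R : comNzRingType) (M : lmodType R).
Implicit Types (F : {fset Q} -> M).

(** Removing the least vertex has sign 1, and it reverses the signs of the other vertices. *)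
Lemma coboundary_cons F x s : (forall y, y \in s -> (x < y)%O) ->
  coboundary F (x |` s)%fset = F s - coboundary (fun u => F (x |` u)%fset) s.
Proof.
move=> xs; have xNs : x \notin s by apply/negP => /xs; rewrite ltxx.
rewrite /coboundary (bigD1 x) ?fset1U1//= fsetU1K// vsign_add; congr (_ + _).
  rewrite /vsign (_ : [fset y in s | (y < x)%O]%fset = fset0) ?scale1r//.
  apply/fsetP => y; rewrite !inE /=; apply/negP => /andP[/xs xy yx].
  by have := lt_trans xy yx; rewrite ltxx.
rewrite -sumrN; apply: eq_big => [y|y].
  rewrite !inE; case: (eqVneq y x) => [->|_] /=; last by rewrite andbT.
  by rewrite (negPf xNs).
rewrite !inE => /andP[/orP[/eqP->|ys]]; first by rewrite eqxx.
move=> yx; rewrite -scaleNr; congr (_ *: F _); last first.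
  apply/fsetP => w; rewrite !inE; case: (eqVneq w x) => [->|_] //=.
  by rewrite eq_sym yx.
rewrite /vsign -[RHS]mulN1r -exprS; congr (_ ^+ _).
rewrite (_ : [fset w in (x |` s)%fset | (w < y)%O]%fset = (x |` [fset w in s | (w < y)%O])%fset).
  by rewrite cardfsU1 !inE /= (negPf xNs) add1n.
apply/fsetP => w; rewrite !inE /=; case: (eqVneq w x) => [->|_] //=.
exact: xs.
Qed.

Lemma coboundary_fset0 F : coboundary F fset0 = 0.
Proof. by rewrite /coboundary big1// => x; rewrite inE. Qed.

Lemma coboundary1 F x : coboundary F [fset x]%fset = F fset0.
Proof. by rewrite -[[fset x]%fset]fsetU0 coboundary_cons// coboundary_fset0 subr0. Qed.

Lemma coboundary2 F x y : (x < y)%O ->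
  coboundary F [fset x; y]%fset = F [fset y]%fset - F [fset x]%fset.
Proof.
by move=> xy; rewrite coboundary_cons ?coboundary1 ?fsetU0// => w; rewrite inE => /eqP->.
Qed.

Lemma coboundary3 F x y z : (x < y)%O -> (y < z)%O ->
  coboundary F (x |` [fset y; z])%fset =
  F [fset y; z]%fset - (F [fset x; z]%fset - F [fset x; y]%fset).
Proof.
move=> xy yz; rewrite coboundary_cons ?coboundary2// => w.
by rewrite !inE => /orP[]/eqP-> //; exact: lt_trans yz.
Qed.

End LowDegreeCoboundary.

Section Faces.
Context (A : set Q).
Local Notation K := (order_complex A).

Lemma order_complex_sub s t : (t `<=` s)%fset -> K s -> K t.
Proof.
move=> /fsubsetP ts [sA sc]; split=> [x /ts /sA//|x y /ts xs /ts ys].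
exact: sc.
Qed.

(** A nonempty chain has a least element: take one with the fewest elements below. *)
Lemma chain_split s n : K s -> #|` s| = n.+1 -> exists x t,
  [/\ s = (x |` t)%fset, A x, K t, #|` t| = n & forall y, y \in t -> (x < y)%O].
Proof.
move=> Ks sn; have [x0 x0s] : exists x, x \in s.
  by apply/fset0Pn; rewrite -cardfs_gt0 sn.
case: (arg_minnP (fun x => #|` [fset y in s | (y < x)%O]%fset|) x0s) => x xs' xmin.
have xs : x \in s by exact: xs'.
exists x, (s `\ x)%fset; split.
- by rewrite fsetD1K.
- by case: Ks => sA _; exact: sA.
- by apply: order_complex_sub Ks; exact: fsubD1set.
- by have := cardfsD1 x s; rewrite xs sn add1n => -[].
- move=> y; rewrite !inE => /andP[yx ys].
  have : (x >=< y)%O by case: Ks => _; apply.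
  rewrite /Order.comparable => /orP[xy|yx']; first by rewrite lt_neqAle eq_sym yx.
  have {yx'} yx' : (y < x)%O by rewrite lt_neqAle yx.
  have := xmin _ ys; rewrite leqNgt => /negP[]; apply: fproper_ltn_card.
  rewrite fproperE; apply/andP; split.
    by apply/fsubsetP => w; rewrite !inE /= => /andP[-> /lt_trans->].
  by apply/fsubsetPn; exists y; rewrite !inE /= ?ys ?ltxx.
Qed.

Lemma face1 s : K s -> #|` s| = 1%N -> exists2 x, A x & s = [fset x]%fset.
Proof.
move=> Ks /(chain_split Ks)[x [t [-> Ax _ /cardfs0_eq-> _]]].
by exists x => //; rewrite fsetU0.
Qed.

Lemma face2 s : K s -> #|` s| = 2%N -> exists x y,
  [/\ s = [fset x; y]%fset, A x, A y & (x < y)%O].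
Proof.
move=> Ks /(chain_split Ks)[x [t [-> Ax /face1 + + xt]]] => /[apply] -[y Ay tE].
by exists x, y; rewrite tE; split=> //; apply: xt; rewrite tE inE.
Qed.

Lemma face3 s : K s -> #|` s| = 3%N -> exists x y z,
  [/\ s = (x |` [fset y; z])%fset, [/\ A x, A y & A z], (x < y)%O & (y < z)%O].
Proof.
move=> Ks /(chain_split Ks)[x [t [-> Ax /face2 + + xt]]] => /[apply] -[y [z [tE Ay Az yz]]].
by exists x, y, z; rewrite tE; split=> //; apply: xt; rewrite tE !inE eqxx.
Qed.

Lemma face_fset1 x : A x -> K [fset x]%fset.
Proof.
move=> Ax; split=> [y /=|y z]; first by rewrite inE => /eqP->.
by rewrite !inE => /eqP-> /eqP->; rewrite /Order.comparable lexx.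
Qed.

Lemma face_cons x s : A x -> K s -> (forall y, y \in s -> (x < y)%O) -> K (x |` s)%fset.
Proof.
move=> Ax [sA sc] xs; split=> [y /=|y z].
  by rewrite !inE => /orP[/eqP->//|]; exact: sA.
rewrite !inE => /orP[/eqP->|ys] /orP[/eqP->|zs]; rewrite /Order.comparable ?lexx//.
- by rewrite ltW// xs.
- by rewrite orbC ltW// xs.
- exact: sc.
Qed.

Lemma face_fset2 x y : A x -> A y -> (x < y)%O -> K [fset x; y]%fset.
Proof.
move=> Ax Ay xy; apply: face_cons => //; first exact: face_fset1.
by move=> z; rewrite inE => /eqP->.
Qed.

Lemma face_fset3 x y z : A x -> A y -> A z -> (x < y)%O -> (y < z)%O ->
  K (x |` [fset y; z])%fset.
Proof.
move=> Ax Ay Az xy yz; apply: face_cons => //; first exact: face_fset2.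
by move=> w; rewrite !inE => /orP[]/eqP->//; exact: lt_trans yz.
Qed.

Lemma card_face2 x y : (x < y)%O -> #|` [fset x; y]%fset| = 2%N.
Proof. by move=> xy; rewrite cardfs2 lt_eqF. Qed.

Lemma card_face3 x y z : (x < y)%O -> (y < z)%O -> #|` (x |` [fset y; z])%fset| = 3%N.
Proof.
by move=> xy yz; rewrite cardfsU1 card_face2// !inE !lt_eqF// (lt_trans xy).
Qed.

End Faces.

End FinitePosetHomology.

(** * Reduced homology in degree 0 *)

Section BoundaryClasses.
Local Open Scope classical_set_scope.
Context (d : Order.disp_t) (Q : finPOrderType d) (A : set Q) (n : nat).
Local Notation K := (order_complex A).
Implicit Types (c : {fset Q} -> int).

(** Boundaries in the group of all functions, not only among cycles, so that single faces
    have classes. *)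
Definition boundaries : {pred {fset Q} -> int} :=
  fun c => `[< exists2 b, simplicial_chain K n.+2 b & boundary b = c >].

Lemma boundaries_zmod_closed : zmod_closed boundaries.
Proof.
split; first by apply/asboolP; exists 0; [exact: simplicial_chain0|exact: boundary0].
move=> _ _ /asboolP[b bK <-] /asboolP[b' b'K <-]; apply/asboolP.
exists (b - b'); first exact: simplicial_chainB.
by rewrite boundaryB//; exact: finite_finset.
Qed.

HB.instance Definition _ :=
  GRing.isZmodClosed.Build ({fset Q} -> int) boundaries boundaries_zmod_closed.

Definition chain_classes : zmodType := Quotient.quot boundaries.

(** The universal cocycle: its coboundary vanishes because boundaries have class 0, and its
    pairing with a cycle is the homology class.  Statements about all cocycles apply to it. *)
Definition class_cochain (s : {fset Q}) : zmodule chain_classes := \pi_chain_classes (delta int s).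

Lemma pairing_class_cochain c : pairing class_cochain c = \pi_chain_classes c.
Proof.
have {2}-> : c = \sum_s delta int s *~ c s.
  apply/funext => t; have ev : zmod_morphism (fun f : {fset Q} -> int => f t) by [].
  pose evA : {additive ({fset Q} -> int) -> int} :=
    HB.pack (fun f : {fset Q} -> int => f t) (GRing.isZmodMorphism.Build _ _ _ ev).
  rewrite -[RHS]/(evA _) raddf_sum (bigD1 t)// big1 => [|s st].
    by rewrite Monoid.mulm1 (raddfMz evA) /= /delta eqxx mulrzz mul1r.
  by rewrite (raddfMz evA) /= /delta eq_sym (negPf st) mul0rz.
rewrite raddf_sum; apply: eq_bigr => s _.
by rewrite raddfMz.
Qed.

Lemma coboundary_class_cochain t : K t -> #|` t| = n.+2 -> coboundary class_cochain t = 0.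
Proof.
move=> Kt tn; rewrite -(pairing_delta (R := int)) -pairing_boundary pairing_class_cochain.
by apply/quot_eq0P/asboolP; exists (delta int t) => //; exact: delta_chain.
Qed.

Lemma homology_boundaryP (z : Defs.cycle int K n) :
  z \in @is_boundary int _ _ K n <-> pairing class_cochain (val z) = 0.
Proof.
rewrite pairing_class_cochain; split=> [/asboolP zb|/quot_eq0P zb].
  by apply/quot_eq0P/asboolP.
by have /asboolP zb' := zb; apply/asboolP.
Qed.

Lemma homology_eq0 :
  (forall z, simplicial_chain K n.+1 z -> boundary z = 0 -> pairing class_cochain z = 0) ->
  forall x : reduced_homology int K n, x = 0.
Proof.
move=> h x; have [z ->] := quot_surj x; apply/quot_eq0P/homology_boundaryP.
by have /asboolP[zK z0] := valP z; exact: h.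
Qed.

End BoundaryClasses.

Section ConnectedHomology.
Local Open Scope classical_set_scope.
Context (d : Order.disp_t) (Q : finPOrderType d) (A : set Q).
Local Notation K := (order_complex A).

(** The universal cochain has the same value [c] at all vertices, so it is the coboundary of
    the constant [c] on the empty face, and its pairing with a cycle vanishes. *)
Lemma connected_homology0 :
  (forall (C : zmodType) (g : Q -> C),
    (forall x y, A x -> A y -> (x < y)%O -> g x = g y) -> exists c, forall x, A x -> g x = c) ->
  forall x : reduced_homology int K 0, x = 0.
Proof.
move=> conn; apply: homology_eq0 => z zK z0.
pose W := class_cochain A 0.
have [|c Wc] := conn _ (fun x => W [fset x]%fset).
  move=> x y Ax Ay xy; apply/esym/eqP; rewrite -subr_eq0.
  rewrite -(@coboundary2 _ _ int _ W)//; apply/eqP/coboundary_class_cochain.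
    exact: face_fset2.
  exact: card_face2.
rewrite (pairing_eq (F' := coboundary (fun=> c : zmodule _)) zK); last first.
  by move=> s Ks /(face1 Ks)[x Ax ->]; rewrite coboundary1; exact: Wc.
rewrite -pairing_boundary z0; apply: big1 => s _; exact: scale0r.
Qed.

End ConnectedHomology.

(** The sums have at most one term and extend a function of vertices, respectively of pairs
    [x < y], to all finite sets. *)
Definition cochain0 d (Q : finPOrderType d) (C : nmodType) (g : Q -> C) : {fset Q} -> C :=
  fun s => \sum_(x | s == [fset x]%fset) g x.

Definition cochain1 d (Q : finPOrderType d) (C : nmodType) (w : Q -> Q -> C) : {fset Q} -> C :=
  fun s => \sum_(p : Q * Q | (p.1 < p.2)%O && (s == [fset p.1; p.2]%fset)) w p.1 p.2.

Lemma cochain0E d (Q : finPOrderType d) (C : nmodType) (g : Q -> C) x :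
  cochain0 g [fset x]%fset = g x.
Proof.
rewrite /cochain0 (bigD1 x)//= big1 ?addr0// => y /andP[/eqP/fsetP/(_ y)].
by rewrite !inE eqxx => /eqP->; rewrite eqxx.
Qed.

Lemma fset2_inj d (Q : porderType d) (x y x' y' : Q) : (x < y)%O -> (x' < y')%O ->
  [fset x; y]%fset = [fset x'; y']%fset -> x = x' /\ y = y'.
Proof.
move=> xy xy' E.
have x'y' : x' \in [fset x; y]%fset /\ y' \in [fset x; y]%fset by rewrite E !inE !eqxx orbT.
have [] : x \in [fset x'; y']%fset /\ y \in [fset x'; y']%fset by rewrite -E !inE !eqxx orbT.
have absurd (a b : Q) : (a < b)%O -> (b < a)%O -> False.
  by move=> ab ba; have := lt_trans ab ba; rewrite ltxx.
rewrite !inE => /orP[]/eqP ex /orP[]/eqP ey //; exfalso;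
  move: x'y' xy xy'; rewrite !inE ex ey ?ltxx// => _; exact: absurd.
Qed.

Lemma cochain1E d (Q : finPOrderType d) (C : nmodType) (w : Q -> Q -> C) x y :
  (x < y)%O -> cochain1 w [fset x; y]%fset = w x y.
Proof.
move=> xy; rewrite /cochain1 (bigD1 (x, y)) /= ?xy ?eqxx// big1 ?addr0// => -[x' y'] /=.
move=> /andP[/andP[xy' /eqP E]]; have [-> ->] := fset2_inj xy xy' E.
by rewrite eqxx.
Qed.

Section Squares.
Local Open Scope classical_set_scope.
Context (d : Order.disp_t) (Q : finPOrderType d) (R : comNzRingType).
Implicit Types (x y z a b p q : Q) (w : Q -> Q -> int).

Lemma coboundary2_cochain0 (M : lmodType R) (g : Q -> M) x y : (x < y)%O ->
  coboundary (cochain0 g) [fset x; y]%fset = g y - g x.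
Proof. by move=> xy; rewrite (coboundary2 _ xy) !cochain0E. Qed.

Lemma coboundary3_cochain1 (M : lmodType R) (e : M) w x y z : (x < y)%O -> (y < z)%O ->
  coboundary (fun s => e *~ cochain1 w s) (x |` [fset y; z])%fset =
  e *~ (w y z - (w x z - w x y)).
Proof.
move=> xy yz; have xz := lt_trans xy yz.
by rewrite (coboundary3 _ xy yz) (cochain1E _ xy) (cochain1E _ yz) (cochain1E _ xz) !mulrzBr.
Qed.

(** The 1-cycle running through [a], [p], [b], [q] when [p] and [q] lie above [a] and [b]. *)
Definition square_chain a b p q : {fset Q} -> R :=
  (delta R [fset a; p]%fset - delta R [fset b; p]%fset) +
  (delta R [fset b; q]%fset - delta R [fset a; q]%fset).

Lemma pairing_square (M : lmodType R) (F : {fset Q} -> M) a b p q :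
  pairing F (square_chain a b p q) =
  (F [fset a; p]%fset - F [fset b; p]%fset) + (F [fset b; q]%fset - F [fset a; q]%fset).
Proof. by rewrite pairingD !pairingB !pairing_delta. Qed.

Lemma pairing_square_cochain1 (M : lmodType R) (e : M) w a b p q :
  (a < p)%O -> (b < p)%O -> (b < q)%O -> (a < q)%O ->
  pairing (fun s => e *~ cochain1 w s) (square_chain a b p q) =
  e *~ ((w a p - w b p) + (w b q - w a q)).
Proof.
move=> ap bp bq aq; rewrite pairing_square.
by rewrite (cochain1E _ ap) (cochain1E _ bp) (cochain1E _ bq) (cochain1E _ aq) -!mulrzBr -mulrzDr.
Qed.

Lemma boundary_square a b p q : (a < p)%O -> (b < p)%O -> (b < q)%O -> (a < q)%O ->
  boundary (square_chain a b p q) = 0.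
Proof.
move=> ap bp bq aq; apply/funext => s; pose F (t : {fset Q}) : R^o := (t == s)%:R.
have FE (c : {fset Q} -> R) : pairing F c = c s.
  rewrite /pairing (bigD1 s)//= /F eqxx big1 ?addr0 => [|t /negPf->]; last exact: mulr0.
  exact: mulr1.
rewrite -FE pairing_boundary pairing_square.
rewrite (coboundary2 _ ap) (coboundary2 _ bp) (coboundary2 _ bq) (coboundary2 _ aq).
have aux (f g h : R^o) : (h - f) - (h - g) = g - f by rewrite opprB addrC addrA subrK.
by rewrite !aux addrA subrK subrr.
Qed.

Lemma chain_square (A : set Q) a b p q : A a -> A b -> A p -> A q ->
  (a < p)%O -> (b < p)%O -> (b < q)%O -> (a < q)%O ->
  simplicial_chain (order_complex A) 2 (square_chain a b p q).
Proof.
move=> Aa Ab Ap Aq ap bp bq aq.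
have dK x y : A x -> A y -> (x < y)%O -> simplicial_chain (order_complex A) 2 (delta R [fset x; y]%fset).
  by move=> Ax Ay xy; apply: delta_chain; [exact: face_fset2|exact: card_face2].
have chainD c c' : simplicial_chain (order_complex A) 2 c -> simplicial_chain (order_complex A) 2 c' ->
    simplicial_chain (order_complex A) 2 (c + c' : {fset Q} -> R).
  move=> cL c'L; have -> : c + c' = c - (0 - c') by rewrite sub0r opprK.
  apply: simplicial_chainB => //.
  by apply: simplicial_chainB => //; exact: simplicial_chain0.
by apply: chainD; apply: simplicial_chainB; exact: dK.
Qed.

End Squares.

Section ModelHomology.
Local Open Scope classical_set_scope.
Local Notation A := (without_bottom model).
Local Notation K := (order_complex A).

Lemma model_connected (C : Type) (g : model -> C) :
  (forall x y, A x -> A y -> (x < y)%O -> g x = g y) -> forall x, A x -> g x = g (vertex o0).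
Proof.
move=> gE.
have le_g x y : A x -> (x <= y)%O -> g x = g y.
  move=> Ax; rewrite le_eqVlt => /orP[/eqP->//|xy]; apply: gE => //.
  apply/without_bottom_model; have /set0Pn[i ix] := (without_bottom_model x).1 Ax.
  have /le_modelP[sxy _] := ltW xy.
  by apply/set0Pn; exists i; exact: fintype.subsetP sxy _ ix.
have AV i : A (vertex i) by apply/without_bottom_model/supp_vertex_neq0.
move=> x /without_bottom_model/set0Pn[i ix].
rewrite -(le_g _ _ (AV i) (vertex_le ix)).
have i_e : i \in supp (edge i o0 0) by rewrite supp_mk !inE eqxx.
have o_e : o0 \in supp (edge i o0 0) by rewrite supp_mk !inE eqxx orbT.
by rewrite (le_g _ _ (AV i) (vertex_le i_e)) (le_g _ _ (AV o0) (vertex_le o_e)).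
Qed.

Lemma model_homology0 : forall x : reduced_homology int K 0, x = 0.
Proof.
apply: connected_homology0 => C g gE; exists (g (vertex o0)).
exact: model_connected.
Qed.

End ModelHomology.

(** * Homology of the model in degree 1 *)

Section FirstHomology.
Local Open Scope classical_set_scope.
Local Notation A := (without_bottom model).
Local Notation K := (order_complex A).

(** Integral lift of [model_cocycle]; it is a cocycle modulo 5 only. *)
Definition std_cochain : {fset model} -> int :=
  cochain1 (fun x y => (val (model_cocycle x y))%:Z).

Lemma F5_mulrz_eq0 (M : zmodType) (e : M) (n : int) : e *+ 5 = 0 -> (5 %| n)%Z -> e *~ n = 0.
Proof. by move=> e5 /dvdzP[k ->]; rewrite mulrC mulrzA -pmulrn e5 mul0rz. Qed.

Lemma std_coboundary (R : comNzRingType) (M : lmodType R) (e : M) t : e *+ 5 = 0 ->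
  K t -> #|` t| = 3%N -> coboundary (fun s => e *~ std_cochain s) t = 0.
Proof.
move=> e5 Kt /(face3 Kt)[x [y [z [-> [/without_bottom_model Ax _ _] xy yz]]]].
rewrite (coboundary3_cochain1 _ _ xy yz); apply: (F5_mulrz_eq0 e5).
rewrite -F5_intr_eq0 !rmorphB /= !F5_lift (model_cocycleD Ax xy yz).
by rewrite [X in _ - X]addrAC subrr add0r subrr.
Qed.

Lemma vertex_lt_edge i j a e : i != j -> e \in [set i; j]%SET -> (vertex e < edge i j a)%O.
Proof.
move=> ij eij; rewrite lt_neqAle vertex_le// andbT; apply/eqP => /(congr1 supp).
rewrite !supp_mk => E; have := cards1 e; rewrite E cards2 ij//.
Qed.

Let lt0 a : (vertex o0 < edge o0 o1 a)%O.
Proof. by apply: vertex_lt_edge; rewrite // !inE. Qed.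

Let lt1 a : (vertex o1 < edge o0 o1 a)%O.
Proof. by apply: vertex_lt_edge; rewrite // !inE. Qed.

(** The two edges [edge o0 o1 1] and [edge o0 o1 0] between the same two vertices. *)
Definition loop_chain (R : comNzRingType) : {fset model} -> R :=
  square_chain R (vertex o0) (vertex o1) (edge o0 o1 1) (edge o0 o1 0).

Lemma chain_loop (R : comNzRingType) : simplicial_chain K 2 (loop_chain R).
Proof.
have AV i : A (vertex i) by apply/without_bottom_model/supp_vertex_neq0.
have AE a : A (edge o0 o1 a).
  by apply/without_bottom_model/set0Pn; exists o0; rewrite supp_mk !inE.
by apply: chain_square; rewrite ?lt0 ?lt1.
Qed.

Lemma boundary_loop (R : comNzRingType) : boundary (loop_chain R) = 0.
Proof. by apply: boundary_square; rewrite ?lt0 ?lt1. Qed.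

Lemma sel1 i : sel [set i]%SET = i.
Proof. by have /selP := finset.set11 i; rewrite inE => /eqP. Qed.

Lemma pairing_std_loop (R : comNzRingType) (M : lmodType R) (e : M) : e *+ 5 = 0 ->
  pairing (fun s => e *~ std_cochain s) (loop_chain R) = e.
Proof.
move=> e5; rewrite (pairing_square_cochain1 _ _ (lt0 1) (lt1 1) (lt1 0) (lt0 0)).
rewrite -[RHS]mulr1z; apply/eqP; rewrite -subr_eq0 -mulrzBr.
apply/eqP/(F5_mulrz_eq0 e5); rewrite -F5_intr_eq0 rmorphB rmorphD !rmorphB /= !F5_lift.
rewrite /model_cocycle !supp_mk !sel1 /edge !label_mk ?inE ?eqxx ?orbT//=.
Qed.

(** The universal cochain is a cocycle, hence classified. *)
Lemma class_cochain_std : exists (u : zmodule (chain_classes A 1)) (g : model -> zmodule (chain_classes A 1)),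
  u *+ 5 = 0 /\ forall s, K s -> #|` s| = 2%N ->
    class_cochain A 1 s = coboundary (R := int) (cochain0 g) s + u *~ std_cochain s.
Proof.
pose W := class_cochain A 1; pose w x y := W [fset x; y]%fset.
have [|u [g [u5 wE]]] := cocycle_classification (w := w).
  move=> x y z x0 xy yz.
  have Ax : A x by apply/without_bottom_model.
  have A_up x' y' : A x' -> (x' < y')%O -> A y'.
    move=> /without_bottom_model/set0Pn[i ix] /ltW/le_modelP[sxy _].
    by apply/without_bottom_model/set0Pn; exists i; exact: fintype.subsetP sxy _ ix.
  have Ay := A_up _ _ Ax xy; have Az := A_up _ _ Ay yz.
  have := coboundary_class_cochain (face_fset3 Ax Ay Az xy yz) (card_face3 xy yz).
  rewrite (coboundary3 _ xy yz) => /eqP; rewrite subr_eq0 => /eqP yzE.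
  have aux (a b c : chain_classes A 1) : a = b - c -> b = c + a by move=> ->; rewrite addrC subrK.
  exact: aux yzE.
exists u, g; split=> // s Ks /(face2 Ks)[x [y [-> /without_bottom_model x0 _ xy]]].
by rewrite (coboundary2_cochain0 _ xy) /std_cochain (cochain1E _ xy) -pmulrn -(wE _ _ x0 xy).
Qed.

Lemma pairing_std (M : zmodType) (e : M) (c : {fset model} -> int) :
  pairing (fun s => e *~ std_cochain s : zmodule M) c = e *~ \sum_s c s * std_cochain s.
Proof.
rewrite mulrz_sumr; apply: eq_bigr => s _.
by rewrite scalezrE -mulrzA mulrC.
Qed.

(** Evaluation of [model_cocycle] on cycles is the isomorphism: by [class_cochain_std], the
    class of a cycle is a multiple, by its evaluation, of an element killed by 5. *)
Lemma model_homology1 : zmod_isomorphic (reduced_homology int K 1) 'Z_5.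
Proof.
pose F s : zmodule 'F_5 := (1 : 'F_5) *~ std_cochain s.
have one5 : (1 : 'F_5) *+ 5 = 0 by apply/val_inj.
pose f (z : Defs.cycle int K 1) : 'F_5 := pairing F (val z).
have fB : zmod_morphism f by move=> z z'; rewrite /f raddfB pairingB.
pose fA : {additive Defs.cycle int K 1 -> 'F_5} :=
  HB.pack f (GRing.isZmodMorphism.Build _ _ f fB).
apply: (quot_isomorphic (W := 'F_5) (f := fA)).
  have loopP : is_cycle K 1 (loop_chain int).
    by apply/asboolP; split; [exact: chain_loop|exact: boundary_loop].
  move=> a; exists (Cycle loopP *+ val a).
  by rewrite raddfMn /= /f pairing_std_loop// natr_Zp.
move=> z; have /asboolP[zK z0] := valP z.
have [u [g [u5 WE]]] := class_cochain_std.
have zW : pairing (class_cochain A 1) (val z) = u *~ \sum_s val z s * std_cochain s.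
  rewrite -pairing_std (pairing_eq zK WE).
  transitivity (pairing (coboundary (R := int) (cochain0 g)) (val z) +
                pairing (fun s => u *~ std_cochain s : zmodule _) (val z)).
    by rewrite -big_split; apply: eq_bigr => s _; rewrite scalerDr.
  rewrite -pairing_boundary z0 (_ : pairing _ 0 = 0) ?add0r//.
  by apply: big1 => s _; rewrite scale0r.
have fE : f z = (\sum_s val z s * std_cochain s)%:~R by rewrite -pairing_std.
split=> [/asboolP[b bK bz]|f0].
  rewrite -[fA z]/(f z) /f -bz pairing_boundary.
  apply: (@pairing0 _ _ int (zmodule 'F_5) b (coboundary F) K 3 bK) => t Kt t3.
  exact: std_coboundary.
apply/homology_boundaryP; rewrite zW; apply: F5_mulrz_eq0 => //.
by rewrite -F5_intr_eq0 -fE; apply/eqP.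
Qed.

(** The same evaluation shows that the loop is not a boundary in characteristic 5. *)
Lemma model_homology1_char5 (k : fieldType) : (5 \in [pchar k])%N ->
  exists x : reduced_homology k K 1, x != 0.
Proof.
move=> k5; have one5 : (1 : k^o) *+ 5 = 0 by exact: pcharf0 k5.
have loopP : is_cycle K 1 (loop_chain k).
  by apply/asboolP; split; [exact: chain_loop|exact: boundary_loop].
exists (\pi_(reduced_homology k K 1) (Cycle loopP)); apply/eqP => /quot_eq0P/asboolP[b bK /= bE].
have := pairing_std_loop one5; rewrite -bE pairing_boundary (pairing0 bK) => [/eqP|t Kt t3].
  by rewrite eq_sym oner_eq0.
exact: std_coboundary.
Qed.

End FirstHomology.

(** * Homology in the top degree *)

(** Smith normal form turns the kernel into a coordinate sublattice. *)
Lemma int_kernel_free m n (M : 'M[int]_(m, n)) :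
  exists p : {additive 'rV[int]_m -> 'rV[int]_(m - \rank (map_mx intr M : 'M[rat]_(m, n)))},
    (forall w, exists2 u, u *m M = 0 & p u = w) /\
    (forall u, u *m M = 0 -> p u = 0 -> u = 0).
Proof.
have [L Lu [N Nu [d _ ME]]] := int_Smith_normal_form M.
pose D (F : nzRingType) : 'M[F]_(m, n) := \matrix_(i, j) ((d`_i)%:~R *+ (i == j :> nat)).
(* The coordinates that are unconstrained on the kernel of the Smith normal form. *)
pose S := [set i : 'I_m | row i (D rat) == 0]%SET.
have row_D (F : nzRingType) (u : 'rV[F]_m) j : (u *m D F) 0 j = \sum_(i : 'I_m | i == j :> nat) u 0 i * (d`_i)%:~R.
  rewrite mxE [RHS]big_mkcond; apply: eq_bigr => i _.
  by rewrite !mxE; case: eqP; rewrite ?mulr1n ?mulr0n ?mulr0.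
have S_out i : i \notin S -> d`_i != 0 /\ (i < n)%N.
  rewrite inE => /rV0Pn[j]; rewrite !mxE; case: (eqVneq (i : nat) j) => [ij|_]; last by rewrite mulr0n eqxx.
  by rewrite mulr1n intr_eq0 ij => ->.
have S_in i (j : 'I_n) : i \in S -> i = j :> nat -> d`_i = 0.
  rewrite inE => /eqP/rowP/(_ j); rewrite !mxE => + ij; rewrite ij eqxx mulr1n => /eqP.
  by rewrite intr_eq0 => /eqP.
have DE (F : numDomainType) (u : 'rV[F]_m) : u *m D F = 0 <-> forall i, i \notin S -> u 0 i = 0.
  split=> [uD i iS|u0].
    have [di lt_in] := S_out i iS.
    have /rowP/(_ (Ordinal lt_in)) := uD; rewrite row_D mxE (bigD1 i)//= big1 => [|k /andP[/eqP ki]].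
      by rewrite addr0 => /eqP; rewrite mulf_eq0 intr_eq0 (negPf di) orbF => /eqP.
    by rewrite -(inj_eq val_inj) /= ki eqxx.
  apply/rowP => j; rewrite row_D mxE big1// => i /eqP ij.
  have [iS|/u0->] := boolP (i \in S); last by rewrite mul0r.
  by rewrite (S_in i j)// mulr0.
have {}ME : M = L *m D int *m N.
  rewrite ME; congr (_ *m _ *m _); apply/matrixP => i j; rewrite !mxE.
  by rewrite intz.
have rankM : (m - \rank (map_mx intr M : 'M[rat]_(m, n)) = #|S|)%N.
  have mapu k (B : 'M[int]_k) : B \in unitmx -> (map_mx intr B : 'M[rat]_k) \in unitmx.
    rewrite !unitmxE det_map_mx; exact: rmorph_unit.
  have -> : \rank (map_mx intr M : 'M[rat]_(m, n)) = \rank (D rat).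
    rewrite ME !map_mxM mxrankMfree ?row_free_unit ?mapu//.
    rewrite (_ : map_mx intr (D int) = D rat); last first.
      by apply/matrixP => i j; rewrite !mxE; case: eqP => _; rewrite ?mulr1n ?mulr0n ?intz.
    by rewrite -mxrank_tr trmx_mul mxrankMfree ?row_free_unit ?unitmx_tr ?mapu// mxrank_tr.
  pose B : 'M[rat]_(#|S|, m) := \matrix_(i, j) (enum_val i == j)%:R.
  have BBt : B *m B^T = 1%:M.
    apply/matrixP => i j; rewrite !mxE (bigD1 (enum_val i))//= !mxE eqxx mul1r big1.
      by rewrite addr0 (inj_eq enum_val_inj) eq_sym.
    by move=> k /negPf ki; rewrite !mxE eq_sym ki mul0r.
  have rankB : \rank B = #|S|.
    by apply/eqP; rewrite -/(row_free B); apply/row_freeP; exists B^T.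
  have kerE : (kermx (D rat) :=: B)%MS.
    apply/eqmxP/andP; split.
      apply/rV_subP => u /sub_kermxP/DE u0; apply/submxP; exists (u *m B^T).
      have uB k : (u *m B^T) 0 k = u 0 (enum_val k).
        rewrite mxE (bigD1 (enum_val k))//= !mxE eqxx mulr1 big1 ?addr0// => i /negPf ik.
        by rewrite !mxE eq_sym ik mulr0.
      apply/rowP => j; rewrite [RHS]mxE (eq_bigr (fun k => u 0 (enum_val k) * (enum_val k == j)%:R)); last first.
        by move=> k _; rewrite uB mxE.
      have [jS|jS] := boolP (j \in S); last first.
        rewrite u0// big1// => k _; rewrite (_ : (enum_val k == j) = false) ?mulr0//.
        by apply: contraNF jS => /eqP<-; exact: enum_valP.
      rewrite (bigD1 (enum_rank_in jS j))//= enum_rankK_in// eqxx mulr1 big1 ?addr0// => k kj.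
      rewrite (_ : (enum_val k == j) = false) ?mulr0//.
      by apply: contraNF kj => /eqP jk; apply/eqP/enum_val_inj; rewrite enum_rankK_in.
    apply/sub_kermxP/row_matrixP => k; rewrite row_mul row0; apply/DE => i iS.
    rewrite !mxE (_ : (enum_val k == i) = false)//.
    by apply: contraNF iS => /eqP<-; exact: enum_valP.
  by rewrite -rankB -kerE mxrank_ker.
rewrite rankM.
have kerM (u : 'rV[int]_m) : u *m M = 0 <-> forall i, i \notin S -> (u *m L) 0 i = 0.
  rewrite -DE ME !mulmxA; split=> [uN|->]; last by rewrite mul0mx.
  by rewrite -[LHS](mulmxK Nu) uN mul0mx.
pose p (u : 'rV[int]_m) : 'rV[int]_#|S| := \row_j (u *m L) 0 (enum_val j).
have pB : zmod_morphism p by move=> u v; apply/rowP => j; rewrite !mxE -sumrB; apply: eq_bigr => k _; rewrite !mxE mulrBl.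
pose pA : {additive 'rV[int]_m -> 'rV[int]_#|S|} := HB.pack p (GRing.isZmodMorphism.Build _ _ p pB).
exists pA; split=> [w|u /kerM u0 /= pu].
  pose x : 'rV[int]_m := \row_i \sum_(j | enum_val j == i) w 0 j.
  have xE j : x 0 (enum_val j) = w 0 j.
    by rewrite mxE (eq_bigl (pred1 j)) ?big_pred1_eq// => k; rewrite (inj_eq enum_val_inj).
  exists (x *m invmx L); last by apply/rowP => j; rewrite mxE mulmxKV.
  apply/kerM => i iS; rewrite mulmxKV// mxE big_pred0// => k.
  by apply: contraNF iS => /eqP<-; exact: enum_valP.
suff uL : u *m L = 0 by rewrite -[u](mulmxK Lu) uL mul0mx.
apply/rowP => i; rewrite [RHS]mxE; have [iS|/u0//] := boolP (i \in S).
by have /rowP/(_ (enum_rank_in iS i)) := pu; rewrite !mxE enum_rankK_in.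
Qed.

Section TopHomology.
Local Open Scope classical_set_scope.
Context (d : Order.disp_t) (Q : finPOrderType d) (A : set Q).
Local Notation K := (order_complex A).

Definition faces n : {set {fset Q}} := [set s | `[< K s >] && (#|` s| == n)]%SET.

Lemma facesP n s : reflect (K s /\ #|` s| = n) (s \in faces n).
Proof.
rewrite inE; apply: (iffP andP) => [[/asboolP Ks /eqP]//|[Ks sn]].
by split; [exact/asboolP|exact/eqP].
Qed.

Section Extension.
Context (R : comNzRingType) (n : nat).

Definition extend (u : 'rV[R]_#|faces n|) : {fset Q} -> R :=
  fun s => \sum_j u 0 j * delta R (enum_val j) s.

Lemma extend_val u j : extend u (enum_val j) = u 0 j.
Proof.
rewrite /extend (bigD1 j)//= /delta eqxx mulr1 big1 ?addr0// => i ij.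
by rewrite (inj_eq enum_val_inj) eq_sym (negPf ij) mulr0.
Qed.

Lemma extend_out u s : s \notin faces n -> extend u s = 0.
Proof.
move=> sn; apply: big1 => j _; rewrite /delta (_ : (s == _) = false) ?mulr0//.
by apply: contraNF sn => /eqP->; exact: enum_valP.
Qed.

Lemma extend_chain u : simplicial_chain K n (extend u).
Proof.
split=> [|s]; first exact: finite_finset.
by move=> s0; apply/facesP; apply: contraNT s0 => /extend_out->.
Qed.

Definition restrict (c : {fset Q} -> R) : 'rV[R]_#|faces n| := \row_j c (enum_val j).

Lemma extendK u : restrict (extend u) = u.
Proof. by apply/rowP => j; rewrite mxE extend_val. Qed.

Lemma restrictK c : simplicial_chain K n c -> extend (restrict c) = c.
Proof.
move=> [_ cK]; apply/funext => s; have [sn|sn] := boolP (s \in faces n).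
  by rewrite -(enum_rankK_in sn sn) extend_val mxE.
by rewrite extend_out//; apply/esym/eqP; apply: contraNT sn => /cK/facesP.
Qed.

End Extension.

Definition boundary_mx (R : comNzRingType) n : 'M[R]_(#|faces n.+1|, #|faces n|) :=
  \matrix_(i, j) boundary (delta R (enum_val i)) (enum_val j).

Lemma boundary_mx_intr (F : comNzRingType) n : map_mx intr (boundary_mx int n) = boundary_mx F n.
Proof.
apply/matrixP => i j; rewrite !mxE !boundary_finE rmorph_sum; apply: eq_bigr => x _ /=.
by rewrite rmorphM rmorphXn /= rmorphN1 rmorph_nat.
Qed.

Lemma mul_boundary_mx (R : comNzRingType) n (u : 'rV[R]_#|faces n.+1|) j :
  (u *m boundary_mx R n) 0 j = boundary (extend u) (enum_val j).
Proof.
rewrite mxE boundary_finE (eq_bigr (fun i => \sum_(x | x \notin enum_val j)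
    u 0 i * (vsign R (enum_val j) x * delta R (enum_val i) (x |` enum_val j)%fset))) => [|i _].
  rewrite exchange_big; apply: eq_bigr => x _; rewrite mulr_sumr.
  by apply: eq_bigr => i _; rewrite mulrCA.
by rewrite mxE boundary_finE mulr_sumr.
Qed.

Lemma boundary_mx_cochain (R : comNzRingType) n (w : 'rV[R]_#|faces n|) i :
  (w *m (boundary_mx R n)^T) 0 i = coboundary (R := R) (extend w : {fset Q} -> R^o) (enum_val i).
Proof.
rewrite -(pairing_delta (R := R) (M := R^o)) -pairing_boundary mxE /pairing.
rewrite [RHS](bigID [in faces n])/= [X in _ = _ + X]big1 ?addr0 => [|s sn]; last first.
  by rewrite extend_out// scaler0.
rewrite [RHS]big_enum_val /=; apply: eq_bigr => j _.
by rewrite extend_val !mxE mulrC.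
Qed.

(** Without faces of the next dimension there are no boundaries, so the homology is the
    kernel of the boundary matrix. *)
Lemma top_homology n : (forall s, K s -> #|` s| != n.+3) ->
  zmod_isomorphic (reduced_homology int K n.+1)
    'rV[int]_(#|faces n.+2| - \rank (boundary_mx rat n.+1)).
Proof.
move=> top; rewrite -boundary_mx_intr.
have [p [psurj pinj]] := int_kernel_free (boundary_mx int n.+1).
pose f (z : Defs.cycle int K n.+1) := p (restrict n.+2 (val z)).
have fB : zmod_morphism f.
  by move=> z z'; rewrite /f -raddfB; congr (p _); apply/rowP => j; rewrite !mxE.
pose fA : {additive Defs.cycle int K n.+1 -> _} := HB.pack f (GRing.isZmodMorphism.Build _ _ f fB).
have bdry0 (z : Defs.cycle int K n.+1) : z \in @is_boundary int _ _ K n.+1 <-> val z = 0.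
  split=> [/asboolP[b [_ bK] bz]|z0]; last first.
    by apply/asboolP; exists 0; [exact: simplicial_chain0|rewrite boundary0 z0].
  rewrite -bz (_ : b = 0) ?boundary0//; apply/funext => s.
  apply/eqP/negPn/negP => /bK[Ks sn]; have := top _ Ks.
  by rewrite sn eqxx.
apply: (quot_isomorphic (f := fA)) => [w|z].
  have [u uM <-] := psurj w.
  have uz : is_cycle K n.+1 (extend u).
    apply/asboolP; split; first exact: extend_chain.
    apply/funext => s; have [sn|sn] := boolP (s \in faces n.+1).
      by rewrite -(enum_rankK_in sn sn) -mul_boundary_mx uM mxE.
    rewrite boundary_finE big1// => x xs; rewrite extend_out ?mulr0//.
    apply: contra sn => /facesP[Kxs xsn]; apply/facesP; split.
      by apply: order_complex_sub Kxs; exact: fsubsetU1.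
    by move: xsn; rewrite cardfsU1 xs => -[].
  by exists (Cycle uz); rewrite /= /f /= extendK.
rewrite bdry0; have /asboolP[zK z0] := valP z; split=> [zE|fz0].
  by rewrite /= /f zE -[RHS](raddf0 p); congr (p _); apply/rowP => j; rewrite !mxE.
rewrite -(restrictK zK) (pinj (restrict n.+2 (val z)))//.
  by apply/funext => s; apply: big1 => j _; rewrite mxE mul0r.
by apply/rowP => j; rewrite mul_boundary_mx restrictK// z0 mxE.
Qed.

End TopHomology.

(** * The rank of the boundary matrix *)

Section CoboundaryRank.
Local Open Scope classical_set_scope.
Context (d : Order.disp_t) (Q : finPOrderType d) (A : set Q).
Local Notation K := (order_complex A).

Hypothesis cocycle_exact : forall w : Q -> Q -> rat,
  (forall x y z, A x -> A y -> A z -> (x < y)%O -> (y < z)%O -> w x z = w x y + w y z) ->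
  exists g : Q -> rat, forall x y, A x -> A y -> (x < y)%O -> w x y = g y - g x.
Hypothesis connected : exists x0, A x0 /\ forall g : Q -> rat,
  (forall x y, A x -> A y -> (x < y)%O -> g x = g y) -> forall x, A x -> g x = g x0.

Definition vertices : {set Q} := [set x | `[< A x >]]%SET.

Lemma verticesP x : reflect (A x) (x \in vertices).
Proof. by rewrite inE; exact: asboolP. Qed.

Let cochain_of (g : 'rV[rat]_#|vertices|) (x : Q) : rat := \sum_(j | enum_val j == x) g 0 j.

Let cochain_of_val g j : cochain_of g (enum_val j) = g 0 j.
Proof.
by rewrite /cochain_of (eq_bigl (pred1 j)) ?big_pred1_eq// => k; rewrite (inj_eq enum_val_inj).
Qed.

Let cob (g : Q -> rat) (s : {fset Q}) : rat := coboundary (R := rat) (cochain0 g : {fset Q} -> rat^o) s.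

(** The matrix of the coboundary from vertices to edges. *)
Let N : 'M[rat]_(#|vertices|, #|faces A 2%N|) :=
  \matrix_(i, j) cob (fun x => (x == enum_val i)%:R) (enum_val j).

Let face_edge s : s \in faces A 2%N -> exists x y, [/\ s = [fset x; y]%fset, A x, A y & (x < y)%O].
Proof. by move=> /facesP[Ks /(face2 Ks)]. Qed.

Let edge_face x y : A x -> A y -> (x < y)%O -> [fset x; y]%fset \in faces A 2%N.
Proof. by move=> Ax Ay xy; apply/facesP; split; [exact: face_fset2|exact: card_face2]. Qed.

Let cobE (g : Q -> rat) x y : (x < y)%O -> cob g [fset x; y]%fset = g y - g x.
Proof. exact: (@coboundary2_cochain0 _ _ rat (rat : comNzRingType)^o g x y). Qed.

Let mulN (g : 'rV[rat]_#|vertices|) j : (g *m N) 0 j = cob (cochain_of g) (enum_val j).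
Proof.
have [x [y [E Ax Ay xy]]] := face_edge (enum_valP j).
rewrite E cobE// mxE /cochain_of [in RHS]big_mkcond [X in _ - X]big_mkcond -sumrB.
apply: eq_bigr => i _; rewrite mxE E cobE// ![_ == enum_val i]eq_sym.
by case: eqP => _; case: eqP => _; rewrite ?subrr ?subr0 ?sub0r ?mulrN ?mulr0 ?mulr1.
Qed.

Let cochain_of_row (g : Q -> rat) x : A x -> cochain_of (\row_i g (enum_val i)) x = g x.
Proof.
move=> /verticesP xV; have := cochain_of_val (\row_i g (enum_val i)) (enum_rank_in xV x).
by rewrite mxE enum_rankK_in.
Qed.

Let rankN : \rank N = (#|vertices| - 1)%N.
Proof.
have [x0 [Ax0 conn]] := connected.
have V0 : (0 < #|vertices|)%N by apply/card_gt0P; exists x0; exact/verticesP.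
have kerN : (kermx N :=: (const_mx 1 : 'rV[rat]_#|vertices|))%MS.
  apply/eqmxP/andP; split.
    apply/rV_subP => g /sub_kermxP gN; apply/submxP; exists (const_mx (cochain_of g x0)).
    apply/rowP => i; rewrite !mxE big_ord1 !mxE mulr1 -cochain_of_val.
    apply: conn; last by apply/verticesP/enum_valP.
    move=> x y Ax Ay xy; have eF := edge_face Ax Ay xy.
    have := mulN g (enum_rank_in eF [fset x; y]%fset).
    rewrite gN mxE enum_rankK_in// cobE// => /eqP.
    by rewrite eq_sym subr_eq0 => /eqP.
  apply/sub_kermxP/rowP => j; rewrite mulN mxE.
  have [x [y [-> Ax Ay xy]]] := face_edge (enum_valP j).
  rewrite cobE//; have cE z : A z -> cochain_of (const_mx 1) z = 1.
    move=> Az; apply: etrans (cochain_of_row (fun=> 1) Az).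
    by congr (cochain_of _ z); apply/rowP => i; rewrite !mxE.
  by rewrite !cE// subrr.
have := mxrank_ker N; rewrite kerN rank_rV.
have -> : (const_mx 1 : 'rV[rat]_#|vertices|) != 0.
  apply/eqP => /rowP/(_ (Ordinal V0)); rewrite !mxE => /eqP.
  by rewrite oner_eq0.
move=> E; transitivity (#|vertices| - (#|vertices| - \rank N))%N; last by rewrite -E.
by rewrite subKn// rank_leq_row.
Qed.

Let kerM : (kermx (boundary_mx A rat 2%N)^T :=: N)%MS.
Proof.
apply/eqmxP/andP; split.
  apply/rV_subP => u /sub_kermxP uM.
  have [|g gE] := cocycle_exact (w := fun x y => extend u [fset x; y]%fset).
    move=> x y z Ax Ay Az xy yz.
    have tF : (x |` [fset y; z])%fset \in faces A 3%N.
      by apply/facesP; split; [exact: face_fset3|exact: card_face3].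
    have := boundary_mx_cochain u (enum_rank_in tF (x |` [fset y; z])%fset).
    rewrite uM mxE enum_rankK_in// (coboundary3 _ xy yz) => /esym/eqP.
    by rewrite subr_eq0 => /eqP->; rewrite addrC subrK.
  apply/submxP; exists (\row_i g (enum_val i)); apply/rowP => j.
  rewrite mulN -(extend_val u j).
  have [x [y [-> Ax Ay xy]]] := face_edge (enum_valP j).
  by rewrite cobE// !cochain_of_row// gE.
apply/sub_kermxP/row_matrixP => i; rewrite row_mul rowE row0.
apply/rowP => k; rewrite boundary_mx_cochain [RHS]mxE.
set g := delta_mx 0 i; pose h := cochain_of g.
have eE x y : A x -> A y -> (x < y)%O -> extend (g *m N) [fset x; y]%fset = h y - h x.
  move=> Ax Ay xy; have eF := edge_face Ax Ay xy.
  by rewrite -(enum_rankK_in eF eF) extend_val mulN enum_rankK_in// cobE.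
have /facesP[Kt /(face3 Kt)[x [y [z [-> [Ax Ay Az] xy yz]]]]] := enum_valP k.
have xz := lt_trans xy yz.
rewrite (coboundary3 _ xy yz) (eE _ _ Ay Az yz) (eE _ _ Ax Az xz) (eE _ _ Ax Ay xy).
by ring.
Qed.

(** The kernel of the transpose of the boundary matrix consists of the 1-cocycles.  Their
    space is that of the coboundaries, isomorphic to functions on the vertices modulo
    constants. *)
Lemma boundary_mx_rank :
  \rank (boundary_mx A rat 2%N) = (#|faces A 2%N| - (#|vertices| - 1))%N.
Proof.
rewrite -rankN -kerM mxrank_ker mxrank_tr subKn//.
exact: rank_leq_col.
Qed.

End CoboundaryRank.

(** * Counting the chains of the model *)

Section FaceCount.
Local Open Scope classical_set_scope.
Context (d : Order.disp_t) (Q : finPOrderType d) (A : set Q).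

Definition below (y : Q) : {set Q} := [set x | (x \in vertices A) && (x < y)%O]%SET.

Lemma fset3_inj (x y z x' y' z' : Q) : (x < y)%O -> (y < z)%O -> (x' < y')%O -> (y' < z')%O ->
  (x |` [fset y; z])%fset = (x' |` [fset y'; z'])%fset -> [/\ x = x', y = y' & z = z'].
Proof.
move=> xy yz xy' yz' E.
have lower (a b c w : Q) : (a < b)%O -> (b < c)%O -> w \in (a |` [fset b; c])%fset -> (a <= w)%O.
  move=> ab bc; rewrite !inE => /or3P[]/eqP-> //; first exact: ltW.
  exact: ltW (lt_trans ab bc).
have xx' : x = x'.
  apply: Order.POrderTheory.le_anti; apply/andP; split.
    by apply: (lower _ _ _ _ xy yz); rewrite E !inE eqxx.
  by apply: (lower _ _ _ _ xy' yz'); rewrite -E !inE eqxx.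
have xN (a b c : Q) : (a < b)%O -> (b < c)%O -> a \notin [fset b; c]%fset.
  by move=> ab bc; rewrite !inE !lt_eqF// (lt_trans ab).
have : [fset y; z]%fset = [fset y'; z']%fset.
  by rewrite -(fsetU1K (xN _ _ _ xy yz)) E xx' fsetU1K// xN.
by move=> /(fset2_inj yz yz')[-> ->].
Qed.

Lemma card_faces2 : #|faces A 2%N| = (\sum_(y in vertices A) #|below y|)%N.
Proof.
pose P := [set p : Q * Q | (p.2 \in vertices A) && (p.1 \in below p.2)]%SET.
have -> : faces A 2%N = [set [fset p.1; p.2]%fset | p in P]%SET.
  apply/setP => s; apply/facesP/imsetP => [[Ks /(face2 Ks)[x [y [-> Ax Ay xy]]]]|].
    by exists (x, y); rewrite // !inE /= xy; do 2?[rewrite asboolT//].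
  move=> [[x y]]; rewrite !inE /= => /andP[/asboolP Ay /andP[/asboolP Ax xy]] ->.
  by split; [exact: face_fset2|exact: card_face2].
rewrite card_in_imset => [|[x y] [x' y']]; last first.
  rewrite !inE /= => /andP[_ /andP[_ xy]] /andP[_ /andP[_ xy']] /(fset2_inj xy xy')[-> ->].
  by [].
rewrite -sum1_card (eq_bigr (fun y => \sum_(x in below y) 1)%N) => [|y _]; last by rewrite sum1_card.
rewrite (exchange_big_dep xpredT)//= pair_big_dep /=.
by apply: eq_bigl => -[x y]; rewrite !inE.
Qed.

Lemma card_faces3 : #|faces A 3%N| = (\sum_(z in vertices A) \sum_(y in below z) #|below y|)%N.
Proof.
pose P := [set p : Q * Q * Q | [&& p.2 \in vertices A, p.1.2 \in below p.2 & p.1.1 \in below p.1.2]]%SET.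
have -> : faces A 3%N = [set (p.1.1 |` [fset p.1.2; p.2])%fset | p in P]%SET.
  apply/setP => s; apply/facesP/imsetP => [[Ks /(face3 Ks)[x [y [z [-> [Ax Ay Az] xy yz]]]]]|].
    by exists (x, y, z); rewrite // !inE /= xy yz; do 3?[rewrite asboolT//].
  move=> [[[x y] z]]; rewrite !inE /= => /and3P[/asboolP Az /andP[/asboolP Ay yz] /andP[/asboolP Ax xy]] ->.
  by split; [exact: face_fset3|exact: card_face3].
rewrite card_in_imset => [|[[x y] z] [[x' y'] z']]; last first.
  rewrite !inE /= => /and3P[_ /andP[_ yz] /andP[_ xy]] /and3P[_ /andP[_ yz'] /andP[_ xy']].
  by move=> /(fset3_inj xy yz xy' yz')[-> -> ->].
rewrite -sum1_card.
rewrite (eq_bigr (fun z => \sum_(p : Q * Q | (p.2 \in below z) && (p.1 \in below p.2)) 1)%N) => [|z _]; last first.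
  rewrite (eq_bigr (fun y => \sum_(x in below y) 1)%N) => [|y _]; last by rewrite sum1_card.
  rewrite (exchange_big_dep xpredT)//= pair_big_dep /=.
  by apply: eq_bigl => -[x y]; rewrite /=.
rewrite (exchange_big_dep xpredT)//= pair_big_dep /=.
by apply: eq_bigl => -[[x y] z]; rewrite !inE /= andbA.
Qed.

End FaceCount.

Lemma sum_subsets (T : finType) (J : {set T}) (h : nat -> nat) :
  (\sum_(I : {set T} | I \subset J) h #|I| = sumn [seq 'C(#|J|, k) * h k | k <- iota 0 #|J|.+1])%N.
Proof.
rewrite sumnE big_map -[X in iota _ X]subn0 -/(index_iota 0 _) big_mkord.
have IJ (I : {set T}) : I \subset J -> (#|I| < #|J|.+1)%N by move=> /subset_leq_card.
rewrite (partition_big (fun I : {set T} => inord #|I| : 'I_#|J|.+1) xpredT)//=.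
apply: eq_bigr => k _; rewrite -cards_draws -sum_nat_const.
apply: eq_big => [I|I /andP[/IJ I_lt /eqP <-]]; last by rewrite inordK.
rewrite inE; have [/IJ I_lt|//] := boolP (I \subset J).
by rewrite -(inj_eq val_inj) /= inordK.
Qed.

Section ModelCount.
Local Open Scope classical_set_scope.
Local Notation A := (without_bottom model).

Lemma mem_model_vertices x : (x \in vertices A) = (supp x != finset.set0).
Proof. by apply/verticesP/idP => /without_bottom_model. Qed.

(** The labels are free except at the selected index. *)
Lemma card_supp_fiber (I : {set 'I_4}) : (#|I| <= 3)%N ->
  #|[set x : model | supp x == I]%SET| = (5 ^ #|I :\ sel I|)%N.
Proof.
move=> I3; have -> : (5 ^ #|I :\ sel I|)%N = #|pffun_on 0 (mem (I :\ sel I)) (predT : pred 'F_5)|.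
  by rewrite card_pffun_on card_Fp.
rewrite -(@card_in_imset _ _ (fun x : model => (val x).2)) => [|x y]; last first.
  rewrite !inE => /eqP xI /eqP yI xy; apply: val_inj.
  by rewrite [val x]surjective_pairing [val y]surjective_pairing xy; congr pair; rewrite -/(supp x) xI -yI.
apply: eq_card => z; apply/imsetP/idP => [[x]|zI].
  rewrite inE => /eqP <- ->; by have /andP[] := valP x.
have xP : model_pred (I, z) by rewrite /model_pred I3.
by exists (Model xP); rewrite // inE.
Qed.

Lemma card_sel (I : {set 'I_4}) : I != finset.set0 -> #|I :\ sel I| = #|I|.-1.
Proof. by move=> /set0Pn[i /selP iI]; rewrite (cardsD1 (sel I) I) iI. Qed.

Definition size_weight (h : nat -> nat) k : nat := if (0 < k <= 3)%N then (5 ^ k.-1 * h k)%N else 0.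

(** A support [I] carries [5 ^ (#|I| - 1)] elements. *)
Lemma sum_model_vertices (h : nat -> nat) :
  (\sum_(x in vertices A) h #|supp x| = sumn [seq 'C(4, k) * size_weight h k | k <- iota 0 5])%N.
Proof.
have := sum_subsets [set: 'I_4]%SET (size_weight h); rewrite cardsT card_ord => <-.
rewrite (partition_big supp xpredT)//= [RHS](eq_bigl xpredT) => [|I]; last by rewrite finset.subsetT.
apply: eq_bigr => I _; rewrite /size_weight.
rewrite (eq_bigr (fun=> h #|I|)) => [|x /andP[_ /eqP->] //]; rewrite sum_nat_const.
have [I0|I0] := eqVneq I finset.set0.
  rewrite I0 cards0 /= eq_card0 ?mul0n// => x.
  by rewrite [LHS]/in_mem /= mem_model_vertices andNb.
rewrite card_gt0 I0 /=; case: ifP => [I3|/negbT I3].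
  congr (_ * _)%N; rewrite -card_sel// -card_supp_fiber//; apply: eq_card => x.
  by rewrite inE [LHS]/in_mem /= mem_model_vertices; case: (eqVneq (supp x) I) => [->|]; rewrite ?I0 ?andbF.
rewrite eq_card0 ?mul0n// => x; rewrite [LHS]/in_mem /=; apply/negP => /andP[_ /eqP xI].
by move: I3; rewrite -xI supp_le3.
Qed.

Definition proper_weight m (h : nat -> nat) k : nat := if (0 < k < m)%N then h k else 0.

(** Below [y] there is exactly one element for each nonempty proper subset of its support. *)
Lemma sum_model_below y (h : nat -> nat) :
  (\sum_(x in below A y) h #|supp x| =
   sumn [seq 'C(#|supp y|, k) * proper_weight #|supp y| h k | k <- iota 0 #|supp y|.+1])%N.
Proof.
rewrite -sum_subsets.
have le3 (I : {set 'I_4}) : (#|I :&: supp y| <= 3)%N by apply: leq_trans (subset_leq_card (finset.subsetIr _ _)) (supp_le3 y).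
pose face I := mk (label y) (le3 I).
have faceK x : x \in below A y -> face (supp x) = x.
  rewrite inE => /andP[_ /ltW/le_modelP[sxy lxy]].
  rewrite [RHS]mk_supp; apply: Order.POrderTheory.le_anti.
  have E : supp x :&: supp y = supp x by apply/finset.setIidPl.
  by apply/andP; split; apply/mk_le; rewrite E; split=> // i j ix jx; rewrite lxy.
rewrite (reindex_onto face supp) => [|x /faceK//].
rewrite [RHS]big_mkcond [LHS]big_mkcond; apply: eq_bigr => I _.
rewrite inE mem_model_vertices supp_mk.
have [IJ|IJ] := boolP (I \subset supp y); last first.
  by rewrite (_ : (I :&: supp y == I) = false) ?andbF//; apply/negbTE; apply: contra IJ => /eqP/finset.setIidPl.
have IE : I :&: supp y = I by apply/finset.setIidPl.
rewrite IE eqxx andbT /proper_weight -card_gt0; case: (0 < #|I|)%N => //=.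
have <- : (face I < y)%O = (#|I| < #|supp y|)%N; last by [].
have le_face : (face I <= y)%O.
  apply/le_modelP; rewrite supp_mk IE; split=> // i j iI jI.
  by rewrite label_mk// IE.
rewrite lt_neqAle le_face andbT ltn_neqAle subset_leq_card// andbT; congr (~~ _).
apply/eqP/eqP => [<-|cE]; first by rewrite supp_mk IE.
apply: Order.POrderTheory.le_anti; rewrite le_face; apply/le_modelP; rewrite supp_mk IE.
have -> : I = supp y by apply/eqP; rewrite eqEcard IJ cE leqnn.
by split=> // i j iy jy; rewrite label_mk ?finset.setIid//.
Qed.

End ModelCount.

(** * Homology of the model in degree 2 *)

Section SecondHomology.
Local Open Scope classical_set_scope.
Local Notation A := (without_bottom model).
Local Notation K := (order_complex A).

(** The sum over the elements below one with support of size [m] of [h] of the size of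
    their support; iterating it counts chains. *)
Definition below_weight (h : nat -> nat) m : nat :=
  sumn [seq 'C(m, k) * proper_weight m h k | k <- iota 0 m.+1]%N.

Lemma card_below y : #|below A y| = below_weight (fun=> 1%N) #|supp y|.
Proof. by rewrite -sum1_card (sum_model_below y (fun=> 1%N)). Qed.

Lemma card_model_vertices : #|vertices A| = 134%N.
Proof. by rewrite -sum1_card (sum_model_vertices (fun=> 1%N)). Qed.

Lemma card_model_faces2 : #|faces A 2%N| = 660%N.
Proof.
rewrite card_faces2 (eq_bigr (fun y => below_weight (fun=> 1%N) #|supp y|)) => [|y _]; last exact: card_below.
by rewrite sum_model_vertices.
Qed.

Lemma card_model_faces3 : #|faces A 3%N| = 600%N.
Proof.
rewrite card_faces3 (eq_bigr (fun z => below_weight (below_weight (fun=> 1%N)) #|supp z|)) => [|z _].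
  by rewrite sum_model_vertices.
rewrite (eq_bigr (fun y => below_weight (fun=> 1%N) #|supp y|)) => [|y _]; last exact: card_below.
by rewrite sum_model_below.
Qed.

Lemma model_lt_card (x y : model) : (x < y)%O -> (#|supp x| < #|supp y|)%N.
Proof.
move=> xy; have /le_modelP[sxy lxy] := ltW xy.
rewrite ltn_neqAle subset_leq_card// andbT; apply/negP => cE.
have E : supp x = supp y by apply/eqP; rewrite eqEcard sxy (eqP cE) leqnn.
have yx : (y <= x)%O.
  by apply/le_modelP; rewrite -E; split=> // i j ix jx; rewrite lxy.
by have := lt_le_trans xy yx; rewrite ltxx.
Qed.

Lemma model_face_card s : K s -> (#|` s| <= 3)%N.
Proof.
move=> Ks; rewrite leqNgt; apply/negP => s4.
have [n sn] : exists n, #|` s| = n.+4 by exists (#|` s| - 4)%N; lia.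
have [x [t [_ /without_bottom_model x0 Kt tn xt]]] := chain_split Ks sn.
have [y [t' [tE _ Kt' t'n yt']]] := chain_split Kt tn.
have [z [t'' [t'E _ Kt'' t''n zt'']]] := chain_split Kt' t'n.
have [w [t3 [t''E _ _ _ _]]] := chain_split Kt'' t''n.
have xy : (x < y)%O by apply: xt; rewrite tE fset1U1.
have yz : (y < z)%O by apply: yt'; rewrite t'E fset1U1.
have zw : (z < w)%O by apply: zt''; rewrite t''E fset1U1.
have := model_lt_card xy; have := model_lt_card yz; have := model_lt_card zw.
move: x0; rewrite -card_gt0; have := supp_le3 w; lia.
Qed.

(** By [cocycle_classification], rational 1-cocycles are coboundaries, so the boundary matrix
    has rank [660 - (134 - 1) = 527], and [600 - 527 = 73]. *)
Lemma model_homology2 : zmod_isomorphic (reduced_homology int K 2) 'rV[int]_73.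
Proof.
have top s : K s -> #|` s| != 4%N.
  by move=> /model_face_card s3; apply/eqP => s4; rewrite s4 in s3.
have := top_homology top; rewrite boundary_mx_rank.
- by rewrite card_model_faces2 card_model_faces3 card_model_vertices.
- move=> w wD; have A_lt x y : A x -> (x < y)%O -> A y.
    move=> /without_bottom_model/set0Pn[i ix] /ltW/le_modelP[sxy _].
    by apply/without_bottom_model/set0Pn; exists i; exact: fintype.subsetP sxy _ ix.
  have [|u [g [u5 wE]]] := cocycle_classification (w := w).
    move=> x y z /without_bottom_model Ax xy yz.
    have Ay := A_lt _ _ Ax xy; exact: wD (A_lt _ _ Ay yz) xy yz.
  have u0 : u = 0 by move/eqP: u5; rewrite mulrn_eq0 => /eqP.
  by exists g => x y /without_bottom_model Ax _ xy; rewrite wE// u0 mul0rn addr0.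
- exists (vertex o0); split; first exact/without_bottom_model/supp_vertex_neq0.
  by move=> g gE; exact: model_connected.
Qed.

End SecondHomology.

(** * Primitives along a shelling *)

Section Shelling.
Local Open Scope classical_set_scope.

Lemma facet_above (V : choiceType) (J : set {fset V}) n s :
  (forall t, J t -> (#|` t| <= n)%N) -> J s -> exists2 t, facet J t & (s `<=` t)%fset.
Proof.
move=> Jn; have [m] := ubnP (n - #|` s|); elim: m s => // m IH s sm Js.
have [sF|] := pselect (facet J s); first by exists s.
move=> /not_andP[//|/existsNP[t /not_implyP[Jt /not_implyP[st /eqP ts]]]].
have {}st' : (s `<` t)%fset by rewrite fproperEneq eq_sym ts.
have [|u uF tu] := IH t _ Jt; last by exists u; rewrite // (fsubset_trans st).
by have := fproper_ltn_card st'; have := Jn _ Jt; lia.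
Qed.

(** Along the shelling, each new simplex carries a primitive, unique up to a constant; on each
    codimension one face in which it meets the previous simplices, it differs by a constant
    from the primitive built so far.  Two such faces share a vertex, since the simplices have
    at least three vertices, so the constants agree. *)
Lemma shellable_primitive (V : choiceType) (B : zmodType) (K : set {fset V})
    (e : rel V) (w : V -> V -> B) :
  shellable K ->
  (forall s, facet K s -> (2 < #|` s|)%N) ->
  (forall s, facet K s -> {in s &, forall x y, [|| x == y, e x y | e y x]}) ->
  (forall s, facet K s ->
    exists h : V -> B, {in s &, forall x y, e x y -> w x y = h y - h x}) ->
  exists g : V -> B, forall s, facet K s ->
    {in s &, forall x y, e x y -> w x y = g y - g x}.
Proof.
move=> [F [_ FK shell]] K3 Ke Kw.
suff [g gF] : exists g : V -> B, forall i, (i < size F)%N ->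
    {in nth fset0 F i &, forall x y, e x y -> w x y = g y - g x}.
  by exists g => s /FK /(nthP fset0)[i iF <-]; exact: gF.
suff : forall k, (k <= size F)%N -> exists g : V -> B, forall i, (i < k)%N ->
    {in nth fset0 F i &, forall x y, e x y -> w x y = g y - g x}.
  by apply.
elim=> [|k IH] kF; first by exists (fun=> 0).
have [g gP] := IH (ltnW kF).
have facetF i : (i < size F)%N -> facet K (nth fset0 F i) by move=> iF; apply/FK/mem_nth.
set S := nth fset0 F k; have SK : facet K S := facetF _ kF.
have [h hP] := Kw _ SK.
set J := simplex S `&` \bigcup_(i in [set i | (i < k)%N]) simplex (nth fset0 F i).
have Jcst t : J t -> {in t &, forall x y, g x - h x = g y - h y}.
  move=> [/fsubsetP tS [i /= ik /fsubsetP ti]] x y xt yt.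
  have H a b : a \in t -> b \in t -> e a b -> g a - h a = g b - h b.
    move=> at_ bt eab; have := gP i ik _ _ (ti _ at_) (ti _ bt) eab.
    rewrite (hP _ _ (tS _ at_) (tS _ bt) eab) => E.
    have -> : g b = h b - h a + g a by rewrite E subrK.
    by rewrite [RHS]addrAC [h b - h a]addrC addrK [RHS]addrC.
  by have /or3P[/eqP->|/H->|/H->] := Ke _ SK _ _ (tS _ xt) (tS _ yt).
have [c cP] : exists c, forall i x, (i < k)%N -> x \in nth fset0 F i -> x \in S ->
    g x = h x + c.
  have [k0|k0] := posnP k; first by exists 0 => i x; rewrite k0.
  have Jcard t : facet J t -> #|` t|.+1 = #|` S| by apply: shell; rewrite k0.
  have Jbound t : J t -> (#|` t| <= #|` S|)%N by move=> [/fsubset_leq_card].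
  have [|t0 t0J _] := facet_above (s := fset0) Jbound.
    by split; [exact: fsub0set|exists 0%N; rewrite //; exact: fsub0set].
  (* Two subsets of [S] with one element less than [S] meet, since [S] has three elements
     or more. *)
  have meet t : facet J t -> exists2 v, v \in t & v \in t0.
    move=> tJ; have [/fset0Pn[v]|] := boolP ((t `&` t0)%fset != fset0).
      by rewrite inE => /andP[vt vt0]; exists v.
    rewrite negbK => /eqP t0I; have := cardfsUI t t0; rewrite t0I cardfs0 addn0.
    have := Jcard _ tJ; have := Jcard _ t0J; have := K3 _ SK.
    have : (#|` t `|` t0| <= #|` S|)%fset%N.
      by apply: fsubset_leq_card; rewrite fsubUset; case: tJ t0J => -[-> _] _ [[-> _] _].
    by rewrite -/S; lia.
  have [v0 v0t _] := meet _ t0J.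
  exists (g v0 - h v0) => i x ik xi xS.
  have [|t tJ xt] := facet_above (s := [fset x]%fset) Jbound.
    by split; [rewrite /simplex /= fsub1set|exists i; rewrite /simplex /= ?fsub1set].
  have [v vt vt0] := meet _ tJ.
  rewrite fsub1set in xt.
  by rewrite -(Jcst t0 t0J.1 v v0 vt0 v0t) -(Jcst t tJ.1 x v xt vt) addrC subrK.
exists (fun x => if x \in S then h x + c else g x) => i; rewrite ltnS leq_eqVlt.
move=> /predU1P[->|ik] x y xi yi exy.
  by rewrite xi yi (hP _ _ xi yi exy) opprD addrACA subrr addr0.
rewrite (gP i ik _ _ xi yi exy).
have G z : z \in nth fset0 F i -> (if z \in S then h z + c else g z) = g z.
  by move=> zi; case: ifP => // zS; rewrite (cP i z).
by rewrite !G.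
Qed.

End Shelling.

(** * Facets and local primitives in the model *)

Section ModelFacets.
Local Open Scope classical_set_scope.
Local Notation A := (without_bottom model).
Local Notation K := (order_complex A).

Lemma facet_comparable d (P : porderType d) (B : set P) s z :
  facet (order_complex B) s -> B z -> {in s, forall x, (x >=< z)%O} -> z \in s.
Proof.
move=> [[sB sc] smax] Bz sz; suff <- : (z |` s)%fset = s by exact: fset1U1.
apply: smax; last exact: fsubsetUr.
split=> [x /=|x y]; first by rewrite !inE => /orP[/eqP->//|]; exact: sB.
rewrite !inE => /orP[/eqP->|xs] /orP[/eqP->|ys].
- by rewrite /Order.comparable lexx.
- by rewrite comparable_sym sz.
- exact: sz.
- exact: sc.
Qed.

Lemma facet1_comparable d (P : porderType d) (B : set P) (x z : P) :
  facet (order_complex B) [fset x]%fset -> B z -> (x >=< z)%O -> z = x.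
Proof.
move=> sF Bz xz; apply/fset1P; apply: (facet_comparable sF Bz) => y.
by rewrite inE => /eqP->.
Qed.

Lemma facet2_comparable d (P : porderType d) (B : set P) (x y z : P) :
  facet (order_complex B) [fset x; y]%fset -> B z -> (x >=< z)%O -> (y >=< z)%O ->
  z = x \/ z = y.
Proof.
move=> sF Bz xz yz; apply/fset2P; apply: (facet_comparable sF Bz) => w.
by rewrite !inE => /orP[]/eqP->.
Qed.

Lemma model_above x : (#|supp x| < 3)%N ->
  exists2 z, (x <= z)%O & #|supp z| = #|supp x|.+1.
Proof.
move=> x3; have [l lx] : exists l, l \notin supp x.
  have : (#|[set: 'I_4]%SET| > #|supp x|)%N by rewrite cardsT card_ord; lia.
  move=> /ltnW; case/boolP: [exists l, l \notin supp x] => [/existsP//|/existsPn h] _.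
  have : (supp x == [set: 'I_4])%SET by apply/eqP/finset.setP => l; rewrite inE; exact/negbNE.
  by move=> /eqP E; move: x3; rewrite E cardsT card_ord.
have I3 : (#|(l |: supp x)%SET| <= 3)%N by rewrite cardsU1 lx; lia.
exists (mk (label x) I3); last by rewrite supp_mk cardsU1 lx.
apply/le_modelP; rewrite supp_mk finset.subsetUr; split=> // i j ix jx.
by rewrite label_mk// !inE ?ix ?jx orbT.
Qed.

Lemma model_between x y : (x <= y)%O -> (#|supp x| < #|supp y|)%N ->
  exists z, [/\ (x <= z)%O, (z <= y)%O & #|supp z| = #|supp x|.+1].
Proof.
move=> /le_modelP[sxy lxy] xy.
have [l ly lx] : exists2 l, l \in supp y & l \notin supp x.
  by apply/fintype.subsetPn; apply/negP => /subset_leq_card; lia.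
have sI : (l |: supp x)%SET \subset supp y by rewrite finset.subUset finset.sub1set ly.
have I3 : (#|(l |: supp x)%SET| <= 3)%N := leq_trans (subset_leq_card sI) (supp_le3 y).
exists (mk (label y) I3); split; last by rewrite supp_mk cardsU1 lx.
  apply/le_modelP; rewrite supp_mk finset.subsetUr; split=> // i j ix jx.
  by rewrite label_mk// ?lxy// !inE ?ix ?jx orbT.
apply/le_modelP; rewrite supp_mk; split=> // i j ix jx.
by rewrite label_mk.
Qed.

Lemma model_vertex_below x : A x -> exists i, (vertex i <= x)%O.
Proof. by move=> /without_bottom_model/set0Pn[i /vertex_le ix]; exists i. Qed.

Lemma card_supp_vertex i : #|supp (vertex i)| = 1%N.
Proof. by rewrite supp_mk cards1. Qed.

Lemma A_vertex i : A (vertex i).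
Proof. exact/without_bottom_model/supp_vertex_neq0. Qed.

Lemma A_card x : A x <-> (0 < #|supp x|)%N.
Proof. by rewrite without_bottom_model card_gt0. Qed.

Lemma comparableW d (P : porderType d) (x y : P) : (x <= y)%O -> (x >=< y)%O.
Proof. by rewrite /Order.comparable => ->. Qed.

Lemma comparableWV d (P : porderType d) (x y : P) : (x <= y)%O -> (y >=< x)%O.
Proof. by rewrite /Order.comparable => ->; rewrite orbT. Qed.

(** A nonempty chain of at most two elements can be extended above its greatest element, below its
    least element or between the two. *)
Lemma model_facet_card s : facet K s -> (2 < #|` s|)%N.
Proof.
move=> sF; have Ks := sF.1; rewrite ltnNge; apply/negP.
case sn : #|` s| => [|[|[|//]]] _.
- have s0 := cardfs0_eq sn; have : vertex o0 \in s.
    by apply: (facet_comparable sF (@A_vertex o0)) => x; rewrite s0 inE.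
  by rewrite s0 inE.
- have [x Ax sE] := face1 Ks sn; rewrite sE in sF.
  have [x3|x3] := ltnP #|supp x| 3.
    have [z xz zn] := model_above x3.
    have Az : A z by apply/A_card; rewrite zn.
    have zx := facet1_comparable sF Az (comparableW xz).
    by move: zn; rewrite zx; lia.
  have [i ix] := model_vertex_below Ax.
  have vx := facet1_comparable sF (@A_vertex i) (comparableWV ix).
  by move: x3; rewrite -vx card_supp_vertex.
- have [x [y [sE Ax Ay xy]]] := face2 Ks sn; rewrite sE in sF.
  have sxy := model_lt_card xy.
  have [y3|y3] := ltnP #|supp y| 3.
    have [z yz zn] := model_above y3.
    have Az : A z by apply/A_card; rewrite zn.
    have xz := le_trans (ltW xy) yz.
    have [zE|zE] := facet2_comparable sF Az (comparableW xz) (comparableW yz).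
      by move: zn; rewrite zE; lia.
    by move: zn; rewrite zE; lia.
  have [x1|x1] := ltnP 1 #|supp x|.
    have [i ix] := model_vertex_below Ax.
    have iy := le_trans ix (ltW xy).
    have [vE|vE] := facet2_comparable sF (@A_vertex i) (comparableWV ix) (comparableWV iy).
      by move: x1; rewrite -vE card_supp_vertex.
    by move: y3; rewrite -vE card_supp_vertex.
  have [|z [xz zy zn]] := model_between (ltW xy); first by lia.
  have Az : A z by apply/A_card; rewrite zn.
  have [zE|zE] := facet2_comparable sF Az (comparableW xz) (comparableWV zy).
    by move: zn; rewrite zE; lia.
  by move: zn; rewrite zE; lia.
Qed.

(** A cocycle has a primitive on a chain: its values on the edges from the least element. *)
Lemma cocycle_local_primitive d (Q : finPOrderType d) (B : set Q) (V : zmodType)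
    (w : Q -> Q -> V) s :
  (forall x y z, B x -> (x < y)%O -> (y < z)%O -> w x z = w x y + w y z) ->
  order_complex B s -> exists h : Q -> V,
  {in s &, forall x y, (x < y)%O -> w x y = h y - h x}.
Proof.
move=> wD Ks; case sn : #|` s| => [|n].
  by exists (fun=> 0) => x y; rewrite (cardfs0_eq sn) inE.
have [m [t [sE Bm _ _ mt]]] := chain_split Ks sn.
exists (fun y => if y == m then 0 else w m y) => x y.
have ms z : z \in s -> z = m \/ (m < z)%O.
  by rewrite sE !inE => /predU1P[->|/mt]; [left|right].
move=> /ms[->|mx] /ms[->|my] xy.
- by rewrite ltxx in xy.
- by rewrite eqxx subr0 gt_eqF.
- by have := lt_trans mx xy; rewrite ltxx.
- by rewrite !gt_eqF// (wD _ _ _ Bm mx xy) addrAC addrN add0r.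
Qed.

(** The elements [edge o0 o1 a] lie above the same two vertices, so the difference of their
    labels at these vertices would not depend on [a]. *)
Lemma model_no_primitive (g : model -> 'F_5) :
  ~ (forall x y, A x -> A y -> (x < y)%O -> model_cocycle x y = g y - g x).
Proof.
move=> gE; have ve i a : i \in [set o0; o1]%SET ->
    label (edge o0 o1 a) i = g (edge o0 o1 a) - g (vertex i).
  move=> ie; rewrite -gE; first by rewrite /model_cocycle supp_mk sel1.
  - exact: A_vertex.
  - by apply/A_card; rewrite supp_mk cards2.
  - exact: vertex_lt_edge.
have [i0 i1] : o0 \in [set o0; o1]%SET /\ o1 \in [set o0; o1]%SET by rewrite !inE !eqxx orbT.
have gap a : a = g (vertex o1) - g (vertex o0).
  have : label (edge o0 o1 a) o0 - label (edge o0 o1 a) o1 = a.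
    by rewrite label_mk// subr0.
  by rewrite !ve// => {1}<-; rewrite opprB addrC addrA subrK.
by have /eqP := etrans (gap 1) (esym (gap 0)).
Qed.

End ModelFacets.

(** * The complexes are neither Cohen-Macaulay nor shellable *)

Section Consequences.
Local Open Scope classical_set_scope.
Context (d : Order.disp_t) (P : porderType d) (f : P -> model).
Hypotheses (fbij : bijective f) (fm : {mono f : x y / (x <= y)%O}).
Local Notation B := (without_bottom P).
Local Notation K := (order_complex B).

(** The cocycle of the model has a primitive on every chain; if the complex were shellable,
    it would have a global one. *)
Lemma iso_model_not_shellable : ~ shellable K.
Proof.
have [g fK gK] := fbij.
have gm : {mono g : x y / (x <= y)%O} by move=> x y; rewrite -fm !gK.
have AB y : without_bottom model y <-> B (g y) by rewrite (without_bottom_iso fbij fm) gK.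
have tr s := order_complex_transport fK gK gm AB s.
have card s := card_gfset gK s.
have mem s y := mem_gfset gK s y.
have KF s : facet K (g @` s)%fset -> facet (order_complex (without_bottom model)) s.
  move=> [/tr Ks smax]; split=> // t /tr Kt st.
  apply: (gfset_inj gK); apply: smax => //.
  by apply/fsubsetP => x; rewrite !(gfsetE fK gK); exact/fsubsetP.
move=> shK; have [|||h hE] := shellable_primitive (e := fun x y => (x < y)%O)
    (w := fun x y => model_cocycle (f x) (f y)) shK.
- by move=> s'; have [s ->] := gfset_surj fK gK s'; rewrite card => /KF/model_facet_card.
- move=> s [[_ sc] _] x y xs ys; have := sc _ _ xs ys.
  by rewrite /Order.comparable !le_eqVlt eq_sym => /orP[/orP[->|->]|/orP[->|->]]; rewrite ?orbT.
- move=> s'; have [s ->] := gfset_surj fK gK s' => /KF[Ks _].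
  have [|h hE] := cocycle_local_primitive (w := model_cocycle) _ Ks.
    by move=> x y z /without_bottom_model; exact: model_cocycleD.
  exists (h \o f) => x y; rewrite !(gfsetE fK gK) => xs ys xy.
  by rewrite hE// (leW_mono fm).
apply: (@model_no_primitive (h \o g)) => x y Ax Ay xy.
have Kxy : K (g @` [fset x; y])%fset by apply/tr; exact: face_fset2.
have [|s sF /fsubsetP xys] := facet_above (n := 3) _ Kxy.
  by move=> t'; have [t ->] := gfset_surj fK gK t'; rewrite card => /tr/model_face_card.
have xs := xys _ (etrans (mem _ _) (fset21 x y)).
have ys := xys _ (etrans (mem _ _) (fset22 x y)).
have gxy : (g x < g y)%O by rewrite (leW_mono gm).
by have := hE s sF (g x) (g y) xs ys gxy; rewrite !gK.
Qed.

(** The link of the empty face is the whole complex, whose first homology does not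
    vanish in characteristic 5. *)
Lemma iso_model_not_cohen_macaulay (k : fieldType) :
  (5 \in [pchar k])%N -> ~ cohen_macaulay k K.
Proof.
move=> k5 CM; have [g fK gK] := fbij.
have gm : {mono g : x y / (x <= y)%O} by move=> x y; rewrite -fm !gK.
have AB y : without_bottom model y <-> B (g y) by rewrite (without_bottom_iso fbij fm) gK.
have linkE : link K fset0 = K.
  apply/seteqP; split=> t; rewrite /link /= fset0U; first by case.
  by rewrite fdisjoint0X.
have K0 : K fset0 by split=> [x /=|x y]; rewrite inE.
have M0 : order_complex (without_bottom model) fset0 by split=> [x /=|x y]; rewrite inE.
have [s sF _] := facet_above model_face_card M0.
have Ks : K (g @` s)%fset by apply/(order_complex_transport fK gK gm AB s); exact: sF.1.
have s3 : (2 < #|` (g @` s)%fset|)%N by rewrite (card_gfset gK); exact: model_facet_card.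
have := CM _ K0 1%N; rewrite linkE => /(_ (ex_intro2 _ _ _ Ks s3)) H0.
have [phi [psi _ psiK]] := homology_iso fbij fm k 1.
have [x /eqP[]] := model_homology1_char5 k5.
by rewrite -(psiK x) (H0 (psi x)) raddf0.
Qed.

End Consequences.

Theorem mainTheorem6 (R : realType) :
  let M := arith_matroidA in
  [/\ exists r : 'I_13 -> vector_config 'I_4,
        [/\ forall i, essential_representation M (r i),
            forall i j, equivalent_representations (r i) (r j) -> i = j &
            forall s, essential_representation M s ->
              exists i, equivalent_representations s (r i)],
      forall r s : vector_config 'I_4,
        essential_representation M r -> essential_representation M s ->
        poset_isomorphic (arithmetic_independence_poset R r)
                         (arithmetic_independence_poset R s) &
      forall r : vector_config 'I_4, essential_representation M r ->
        let K := order_complex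
                   (without_bottom (arithmetic_independence_poset R r)) in
        [/\ forall x : reduced_homology int K 0, x = 0,
            zmod_isomorphic (reduced_homology int K 1) 'Z_5,
            zmod_isomorphic (reduced_homology int K 2) 'rV[int]_73,
            forall k : fieldType, (5 \in [pchar k])%N -> ~ cohen_macaulay k K &
            ~ shellable K]].
Proof.
move=> M; split; first exact: thirteen_classes.
  move=> r s rM sM.
  exact: poset_iso_trans (essential_model R rM) (poset_iso_sym (essential_model R sM)).
move=> r rM K; have [f [fbij fm]] := essential_model R rM; split.
- move=> x; have [phi [psi phiK _]] := homology_iso fbij fm int 0.
  by rewrite -(phiK x) (model_homology0 (phi x)) -(raddf0 phi) phiK.
- exact: zmod_iso_trans (homology_iso fbij fm int 1) model_homology1.
- exact: zmod_iso_trans (homology_iso fbij fm int 2) model_homology2.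
- by move=> k k5; exact: (iso_model_not_cohen_macaulay fbij fm k5).
- exact: (iso_model_not_shellable fbij fm).
Qed.
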